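(* Let $N\ge 3$ and let $\kappa: V_N\times V_N\to \mathcal{O}(\mathrm{SO}_N)^*$ be a skew-symmetric $\mathrm{SO}_N$-equivariant $\mathbb{C}$-bilinear map. The algebra $\mathcal{H}_\kappa(\mathrm{SO}_N,V_N)$ satisfies the PBW property if and only if there exists an $\mathrm{SO}_N$-invariant distribution $c\in \mathcal{O}(S)^*$ such that $\kappa(x,y)=((g-g^{-1})x,y)\,c$ for all $x,y\in V_N$.
   Context: All varieties and groups are over $\mathbb{C}$. $V_N=\mathbb{C}^N$ is equipped with the standard nondegenerate symmetric bilinear form $(\cdot,\cdot)$ and $\mathrm{SO}_N=\mathrm{SO}_N(\mathbb{C})$ acts on it naturally. Algebraic distributions: for an affine scheme $X$ of finite type over $\mathbb{C}$, $\mathcal{O}(X)$ is the algebra of regular functions and $\mathcal{O}(X)^*$ is its full linear dual; it is an $\mathcal{O}(X)$-module by $\langle f\mu,h\rangle=\langle\mu,fh\rangle$. For a closed subscheme $Z\subset X$, $\mathcal{O}(Z)^*\subset\mathcal{O}(X)^*$ is the space of distributions annihilating the ideal of $Z$. For a reductive group $G$ and a finite dimensional algebraic representation $V$, $\mathcal{O}(G)^*$ is an algebra under convolution (so $\delta_g\delta_h=\delta_{gh}$, unit $\delta_{1_G}$), and $G$ acts on $\mathcal{O}(G)^*$ by the action induced from conjugation. The algebra $\mathcal{O}(G)^*\ltimes TV$ is generated by $\mathcal{O}(G)^*$ and $V$ with the relations $\mu\cdot x=\sum_i v_i\cdot\big((v_i^*,gx)\mu\big)$ for $x\in V$, $\mu\in\mathcal{O}(G)^*$,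 where $\{v_i\}$ is a basis of $V$, $\{v_i^*\}$ the dual basis, and $(v_i^*,gx)\mu$ is the product of the regular function $g\mapsto (v_i^*,gx)$ with $\mu$ (so $\delta_g x\,\delta_g^{-1}=gx$). The algebra $\mathcal{O}(G)^*\ltimes SV$ is its quotient by $[x,y]=0$, $x,y\in V$. For a skew-symmetric $G$-equivariant bilinear $\kappa:V\times V\to\mathcal{O}(G)^*$ put $\mathcal{H}_\kappa(G,V)=\mathcal{O}(G)^*\ltimes TV/([x,y]-\kappa(x,y)\mid x,y\in V)$, filtered by $\deg V=1$, $\deg\mathcal{O}(G)^*=0$. It satisfies the PBW property if the natural surjection $\mathcal{O}(G)^*\ltimes SV\to\mathrm{gr}\,\mathcal{H}_\kappa(G,V)$ is an isomorphism. $S=\{g\in\mathrm{SO}_N:\ \mathrm{rk}(1-g|_{V_N})\le 2\}$ is a reduced closed subscheme of $\mathrm{SO}_N$, stable under conjugation; invariance of $c$ refers to the conjugation action. The symbol $((g-g^{-1})x,y)\,c$ is the product of the regular function $g\mapsto((g-g^{-1})x,y)$ and the distribution $c$. *)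

(* Defs.v *)
From HB Require Import structures.
From mathcomp Require Import all_boot all_order all_algebra all_classical reals.
From mathcomp.real_closed Require Import complex.
From mathcomp.multinomials Require monalg mpoly.
Set Implicit Arguments.
Unset Strict Implicit.
Unset Printing Implicit Defensive.
Import GRing.Theory.
Local Open Scope ring_scope.
Local Open Scope quotient_scope.

(* Two-sided quotients of rings in which 1 = 0 is allowed: a ring defined by
   generators and relations may be zero, and {ideal_quot I} only covers
   nontrivial commutative rings. *)
Section Quotient.
Variable A : pzRingType.

Record ideal := Ideal {
  in_ideal :> A -> Prop;
  ideal0 : in_ideal 0;
  idealD : forall x y, in_ideal x -> in_ideal y -> in_ideal (x + y);
  idealMl : forall a x, in_ideal x -> in_ideal (a * x);
  idealMr : forall a x, in_ideal x -> in_ideal (x * a)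
}.

Inductive gen_ideal (X : A -> Prop) : A -> Prop :=
| gen_ideal_in x : X x -> gen_ideal X x
| gen_ideal0 : gen_ideal X 0
| gen_idealD x y : gen_ideal X x -> gen_ideal X y -> gen_ideal X (x + y)
| gen_idealMl a x : gen_ideal X x -> gen_ideal X (a * x)
| gen_idealMr a x : gen_ideal X x -> gen_ideal X (x * a).

Definition ideal_of (X : A -> Prop) : ideal :=
  Ideal (gen_ideal0 X) (@gen_idealD X) (@gen_idealMl X) (@gen_idealMr X).

Definition ideal_pred (I : ideal) : {pred A} := fun x => `[< I x >].

Lemma ideal_predE (I : ideal) x : (x \in ideal_pred I) = `[< I x >].
Proof. by []. Qed.

Fact ideal_zmod (I : ideal) : zmod_closed (ideal_pred I).
Proof.
split; first by rewrite ideal_predE; apply/asboolP/ideal0.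
move=> x y; rewrite !ideal_predE => /asboolP Ix /asboolP Iy; apply/asboolP.
by apply: idealD Ix _; rewrite -mulN1r; apply: idealMl.
Qed.

HB.instance Definition _ (I : ideal) :=
  GRing.isZmodClosed.Build A (ideal_pred I) (ideal_zmod I).

Definition quot_ring (I : ideal) : Type := Quotient.quot (ideal_pred I).

Section Instances.
Variable I : ideal.
Local Notation Q := (quot_ring I).

HB.instance Definition _ := GRing.Zmodule.on Q.

Definition qpi (x : A) : Q := \pi_(Quotient.quot (ideal_pred I)) x.

Lemma qpiP x y : qpi x = qpi y <-> I (x - y).
Proof.
rewrite /qpi; split=> [/eqP|h].
  by rewrite -Quotient.idealrBE ideal_predE => /asboolP.
by apply/eqP; rewrite -Quotient.idealrBE ideal_predE; apply/asboolP.
Qed.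

Lemma qpiD x y : qpi (x + y) = qpi x + qpi y.
Proof. by rewrite /qpi; exact: (Quotient.pi_add (ideal_pred I)). Qed.

Definition qrepr (q : Q) : A := repr (q : Quotient.quot (ideal_pred I)).

Lemma qreprK q : qpi (qrepr q) = q.
Proof. exact: reprK. Qed.

Lemma qreprP x : I (qrepr (qpi x) - x).
Proof. by apply/qpiP; rewrite qreprK. Qed.

Definition qmul (p q : Q) : Q := qpi (qrepr p * qrepr q).

Lemma qpiM x y : qpi (x * y) = qmul (qpi x) (qpi y).
Proof.
apply/esym/qpiP; set x' := qrepr _; set y' := qrepr _.
rewrite (_ : _ - _ = (x' - x) * y' + x * (y' - y)); last first.
  by rewrite mulrBl mulrBr addrA subrK.
by apply: idealD; [apply: idealMr | apply: idealMl]; apply: qreprP.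
Qed.

Fact qmulA : associative qmul.
Proof.
by move=> p q r; rewrite -(qreprK p) -(qreprK q) -(qreprK r) -!qpiM mulrA.
Qed.
Fact qmul1 : left_id (qpi 1) qmul.
Proof. by move=> p; rewrite -(qreprK p) -qpiM mul1r. Qed.
Fact q1mul : right_id (qpi 1) qmul.
Proof. by move=> p; rewrite -(qreprK p) -qpiM mulr1. Qed.
Fact qmulDl : left_distributive qmul +%R.
Proof.
move=> p q r; rewrite -(qreprK p) -(qreprK q) -(qreprK r).
by rewrite -qpiD -!qpiM -qpiD mulrDl.
Qed.
Fact qmulDr : right_distributive qmul +%R.
Proof.
move=> p q r; rewrite -(qreprK p) -(qreprK q) -(qreprK r).
by rewrite -qpiD -!qpiM -qpiD mulrDr.
Qed.
HB.instance Definition _ :=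
  GRing.Zmodule_isPzRing.Build Q qmulA qmul1 q1mul qmulDl qmulDr.

Lemma qpi_is_zmod : zmod_morphism (@qpi : A -> Q).
Proof.
move=> x y; rewrite qpiD; congr (_ + _); apply/eqP; rewrite -addr_eq0.
have q0 : qpi 0 = 0 by apply: (@addrI _ (qpi 0)); rewrite -qpiD !addr0.
by rewrite -qpiD addNr q0.
Qed.
Lemma qpi_is_monoid : monoid_morphism (@qpi : A -> Q).
Proof. by split=> // x y; rewrite qpiM. Qed.

End Instances.
End Quotient.

HB.instance Definition _ (A : pzRingType) (I : ideal A) :=
  GRing.isZmodMorphism.Build A (quot_ring I) (@qpi A I) (@qpi_is_zmod A I).
HB.instance Definition _ (A : pzRingType) (I : ideal A) :=
  GRing.isMonoidMorphism.Build A (quot_ring I) (@qpi A I)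
    (@qpi_is_monoid A I).

Section AssociatedGraded.
Variable A : pzRingType.

Record filtration := Filtration {
  fil :> nat -> A -> Prop;
  fil0 : forall n, fil n 0;
  filD : forall n x y, fil n x -> fil n y -> fil n (x + y);
  filN : forall n x, fil n x -> fil n (- x);
  filS : forall n x, fil n x -> fil n.+1 x;
  fil1 : fil 0 1;
  filM : forall m n x y, fil m x -> fil n y -> fil (m + n) (x * y)
}.

Inductive gen_fil (X : nat -> A -> Prop) : nat -> A -> Prop :=
| gen_fil_in n x : X n x -> gen_fil X n x
| gen_fil0 n : gen_fil X n 0
| gen_filD n x y : gen_fil X n x -> gen_fil X n y -> gen_fil X n (x + y)
| gen_filN n x : gen_fil X n x -> gen_fil X n (- x)
| gen_filS n x : gen_fil X n x -> gen_fil X n.+1 x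
| gen_fil1 : gen_fil X 0 1
| gen_filM m n x y :
    gen_fil X m x -> gen_fil X n y -> gen_fil X (m + n) (x * y).

Definition filtration_of (X : nat -> A -> Prop) : filtration :=
  Filtration (gen_fil0 X) (@gen_filD X) (@gen_filN X) (@gen_filS X)
    (gen_fil1 X) (@gen_filM X).

(* Sequences with the Cauchy product (formal power series in t over A). *)
Definition fps : Type := nat -> A.
HB.instance Definition _ := GRing.Zmodule.on fps.

Definition fps1 : fps := fun n => if n == 0%N then 1 else 0.
Definition fps_mul (s t : fps) : fps :=
  fun n => \sum_(i < n.+1) s i * t (n - i)%N.

Lemma fps_mul_rev s t n :
  fps_mul s t n = \sum_(i < n.+1) s (n - i)%N * t i.
Proof.
rewrite /fps_mul (reindex_inj rev_ord_inj) /=.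
by apply: eq_bigr => i _; rewrite (sub_ordK i).
Qed.

Fact fps_mulA : associative fps_mul.
Proof.
move=> s t u; apply/funext => n; rewrite [RHS]fps_mul_rev.
rewrite [LHS](_ : _ = \sum_(j < n.+1) s j * fps_mul t u (n - j)%N) //.
pose F j k := s j * (t (n - j - k)%N * u k).
transitivity (\sum_(j < n.+1) \sum_(k < n.+1 | (k <= n - j)%N) F j k).
  apply: eq_bigr => /= j _; rewrite fps_mul_rev big_distrr /=.
  by rewrite (big_ord_narrow_leq (leq_subr _ _)).
rewrite (exchange_big_dep predT) //=; apply: eq_bigr => k _.
transitivity (\sum_(j < n.+1 | (j <= n - k)%N) F j k).
  apply: eq_bigl => j; rewrite -ltnS -(ltnS j) -!subSn ?leq_ord //.
  by rewrite -subn_gt0 -(subn_gt0 j) -!subnDA addnC.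
rewrite (big_ord_narrow_leq (leq_subr _ _)) /fps_mul big_distrl /=.
by apply: eq_bigr => j _; rewrite /F -!subnDA addnC mulrA.
Qed.

Fact fps_mul1 : left_id fps1 fps_mul.
Proof.
move=> s; apply/funext => n; rewrite /fps_mul big_ord_recl /= mul1r subn0.
by rewrite big1 ?addr0// => i _; rewrite /fps1 /= mul0r.
Qed.

Fact fps_1mul : right_id fps1 fps_mul.
Proof.
move=> s; apply/funext => n; rewrite fps_mul_rev big_ord_recl /= mulr1 subn0.
by rewrite big1 ?addr0// => i _; rewrite /fps1 /= mulr0.
Qed.

Fact fps_mulDl : left_distributive fps_mul +%R.
Proof.
move=> s t u; apply/funext => n; rewrite /fps_mul [RHS]/GRing.add /=.
by rewrite -big_split; apply: eq_bigr => i _; apply: mulrDl.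
Qed.

Fact fps_mulDr : right_distributive fps_mul +%R.
Proof.
move=> s t u; apply/funext => n; rewrite /fps_mul [RHS]/GRing.add /=.
by rewrite -big_split; apply: eq_bigr => i _; apply: mulrDr.
Qed.

HB.instance Definition _ := GRing.Zmodule_isPzRing.Build fps
  fps_mulA fps_mul1 fps_1mul fps_mulDl fps_mulDr.

Variable F : filtration.

(* The Rees algebra, whose elements are the finite sums of x t^n, x in F n. *)
Definition rees_pred : {pred fps} := fun s =>
  `[< (forall n, F n (s n)) /\ exists m, forall n, (m <= n)%N -> s n = 0 >].

Lemma fil_sum n I (r : seq I) (P : pred I) (f : I -> A) :
  (forall i, P i -> F n (f i)) -> F n (\sum_(i <- r | P i) f i).
Proof. by move=> h; elim/big_ind: _ => //; [exact: fil0 | exact: filD]. Qed.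

Fact rees_subring : subring_closed rees_pred.
Proof.
split.
- apply/asboolP; split=> [[|n]|].
  + exact: fil1.
  + exact: fil0.
  + by exists 1%N; case.
- move=> s t /asboolP[Fs [m sm]] /asboolP[Ft [k tk]]; apply/asboolP; split.
    by move=> n; apply: filD => //; apply: filN.
  exists (maxn m k) => n; rewrite geq_max => /andP[mn kn].
  by rewrite [LHS]/GRing.add /= sm// [X in 0 + X]/GRing.opp /= tk// subrr.
- move=> s t /asboolP[Fs [m sm]] /asboolP[Ft [k tk]]; apply/asboolP; split.
    move=> n; apply: fil_sum => i _.
    by have := filM (Fs i) (Ft (n - i)%N); rewrite subnKC// leq_ord.
  exists (m + k)%N => n mkn; rewrite /GRing.mul /= /fps_mul big1// => i _.
  have [/sm ->|im] := leqP m i; first by rewrite mul0r.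
  rewrite tk ?mulr0//; rewrite leq_subRL; last exact: leq_ord.
  by apply: leq_trans mkn; rewrite leq_add2r ltnW.
Qed.

HB.instance Definition _ :=
  GRing.isSubringClosed.Build fps rees_pred rees_subring.

Record rees : Type :=
  Rees { rees_val : fps; rees_valP : rees_val \in rees_pred }.
HB.instance Definition _ := [isSub for rees_val].
HB.instance Definition _ := [Choice of rees by <:].
HB.instance Definition _ := 
  GRing.SubChoice_isSubPzRing.Build fps rees_pred rees rees_subring.


Definition fil_pred n (x : A) : Prop := 
  match n with 0%N => x = 0 | m.+1 => F m x end.

Lemma fil_predS n x : fil_pred n x -> F n x.
Proof. by case: n => [->|n]; [exact: fil0 | exact: filS]. Qed.

Lemma fil_pred0 n : fil_pred n 0.
Proof. by case: n => //= n; exact: fil0. Qed.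

Lemma fil_predD n x y : fil_pred n x -> fil_pred n y -> fil_pred n (x + y).
Proof. by case: n => /= [-> ->|n]; [rewrite addr0 | exact: filD]. Qed.

Lemma fil_predMl m n x y : F m x -> fil_pred n y -> fil_pred (m + n) (x * y).
Proof.
case: n => /= [|n] Fx; last by rewrite addnS; exact: filM.
by move=> ->; rewrite mulr0; exact: fil_pred0.
Qed.

Lemma fil_predMr m n x y : fil_pred m x -> F n y -> fil_pred (m + n) (x * y).
Proof.
case: m => /= [|m]; last by exact: filM.
by move=> -> _; rewrite mul0r; exact: fil_pred0.
Qed.

Lemma fil_pred_sum n I (r : seq I) (P : pred I) (f : I -> A) :
  (forall i, P i -> fil_pred n (f i)) ->
  fil_pred n (\sum_(i <- r | P i) f i).
Proof.
by move=> h; elim/big_ind: _ => //; [exact: fil_pred0 | exact: fil_predD].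
Qed.

Lemma rees_fil (s : rees) n : F n (rees_val s n).
Proof. by have /asboolP[] := rees_valP s. Qed.

Definition rees_lower (s : rees) : Prop := forall n, fil_pred n (rees_val s n).

Fact rees_lower0 : rees_lower 0.
Proof. exact: fil_pred0. Qed.
Fact rees_lowerD s t : rees_lower s -> rees_lower t -> rees_lower (s + t).
Proof. by move=> ls lt n; apply: fil_predD. Qed.
Fact rees_lowerMl a s : rees_lower s -> rees_lower (a * s).
Proof.
move=> ls n; apply: fil_pred_sum => i _.
have := fil_predMl (rees_fil a i) (ls (n - i)%N).
by rewrite subnKC// leq_ord.
Qed.
Fact rees_lowerMr a s : rees_lower s -> rees_lower (s * a).
Proof.
move=> ls n; apply: fil_pred_sum => i _.
have := fil_predMr (ls i) (rees_fil a (n - i)%N).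
by rewrite subnKC// leq_ord.
Qed.

Definition rees_lower_ideal : ideal rees :=
  Ideal rees_lower0 rees_lowerD rees_lowerMl rees_lowerMr.

(* The sum of the F n t^n modulo the sum of the F (n - 1) t^n, that is the
   direct sum of the F n / F (n - 1) with its induced product. *)
Definition gr : Type := quot_ring rees_lower_ideal.
HB.instance Definition _ := GRing.PzRing.on gr.

Fact monomial_rees n x : F n x ->
  (fun k => if k == n then x else 0) \in rees_pred.
Proof.
move=> Fx; apply/asboolP; split=> [k|].
  by case: eqP => [->//|_]; exact: fil0.
by exists n.+1 => k; case: eqP => // ->; rewrite ltnn.
Qed.

(* The class of x in F n / F (n - 1). *)
Definition gr_class n x (Fx : F n x) : gr :=
  qpi rees_lower_ideal (Rees (monomial_rees Fx)).

End AssociatedGraded.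

Section SpecialOrthogonal.
Variables (R : realType) (N : nat).
Local Notation C := R[i].
Local Notation V := 'cV[C]_N.

Definition so_form (x y : V) : C := (x^T *m y) 0 0.

Definition so_pred (g : 'M[C]_N) : bool := (g^T *m g == 1%:M) && (\det g == 1).

Record SO : Type := MkSO { so_val :> 'M[C]_N; so_valP : so_pred so_val }.
HB.instance Definition _ := [isSub for so_val].
HB.instance Definition _ := [Choice of SO by <:].

Lemma so_trmul (g : SO) : g^T *m g = 1%:M.
Proof. by case/andP: (so_valP g) => /eqP. Qed.

Lemma so_multr (g : SO) : g *m g^T = 1%:M.
Proof. exact/mulmx1C/so_trmul. Qed.

Lemma so_det (g : SO) : \det g = 1.
Proof. by case/andP: (so_valP g) => _ /eqP. Qed.

Fact so_one_subproof : so_pred 1%:M.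
Proof. by rewrite /so_pred trmx1 mulmx1 det1 !eqxx. Qed.
Fact so_mul_subproof (g h : SO) : so_pred (g *m h).
Proof.
rewrite /so_pred det_mulmx !so_det mulr1 eqxx andbT trmx_mul mulmxA.
by rewrite -[_ *m _ *m g]mulmxA so_trmul mulmx1 so_trmul.
Qed.
Fact so_inv_subproof (g : SO) : so_pred g^T.
Proof. by rewrite /so_pred trmxK so_multr det_tr so_det !eqxx. Qed.

Definition so_one := MkSO so_one_subproof.
Definition so_mul g h := MkSO (so_mul_subproof g h).
Definition so_inv g := MkSO (so_inv_subproof g).

Fact so_mulA : associative so_mul.
Proof. by move=> g h k; apply: val_inj; rewrite /= mulmxA. Qed.
Fact so_mul1 : left_id so_one so_mul.
Proof. by move=> g; apply: val_inj; rewrite /= mul1mx. Qed.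
Fact so_1mul : right_id so_one so_mul.
Proof. by move=> g; apply: val_inj; rewrite /= mulmx1. Qed.
Fact so_mulV : left_inverse so_one so_inv so_mul.
Proof. by move=> g; apply: val_inj; rewrite /= so_trmul. Qed.
Fact so_Vmul : right_inverse so_one so_inv so_mul.
Proof. by move=> g; apply: val_inj; rewrite /= so_multr. Qed.
HB.instance Definition _ :=
  isGroup.Build SO so_mulA so_mul1 so_1mul so_mulV so_Vmul.

End SpecialOrthogonal.

Section RegularFunctions.
Import mpoly.
Variables (R : realType) (N : nat).
Local Notation C := R[i].
Local Notation G := (SO R N).

Definition regular (f : G -> C) : Prop :=
  exists p : {mpoly C[N * N]}, forall g : G, f g = p.@[fun k => mxvec g 0 k].

Lemma regular_cst a : regular (fun=> a).
Proof. by exists a%:MP => g; rewrite mevalC. Qed.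

Lemma regular_entry i j : regular (fun g => g i j).
Proof. by exists 'X_(mxvec_index i j) => g; rewrite mevalXU mxvecE. Qed.

Lemma regularD f h : regular f -> regular h -> regular (fun g => f g + h g).
Proof. by move=> [p fp] [q hq]; exists (p + q) => g; rewrite mevalD fp hq. Qed.

Lemma regularN f : regular f -> regular (fun g => - f g).
Proof. by move=> [p fp]; exists (- p) => g; rewrite mevalN fp. Qed.

Lemma regularM f h : regular f -> regular h -> regular (fun g => f g * h g).
Proof. by move=> [p fp] [q hq]; exists (p * q) => g; rewrite mevalM fp hq. Qed.

Lemma regular_ind (P : (G -> C) -> Prop) :
  (forall a, P (fun=> a)) -> (forall i j, P (fun g => g i j)) ->
  (forall f h, P f -> P h -> P (fun g => f g + h g)) ->
  (forall f h, P f -> P h -> P (fun g => f g * h g)) ->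
  forall f, regular f -> P f.
Proof.
move=> Pc Pe PD PM f [p fp].
have -> : f = fun g => p.@[fun k => mxvec g 0 k] by apply/funext.
elim/mpolyind: p {fp} => [|c m p _ _ IH].
  by rewrite (_ : (fun g => _) = fun=> 0)//; apply/funext => g; rewrite meval0.
rewrite (_ : (fun g => _) = fun g : G => c * 'X_[m].@[fun k => mxvec g 0 k] +
    p.@[fun k => mxvec g 0 k]); last first.
  by apply/funext => g; rewrite mevalD mevalZ.
apply: PD IH; apply: (PM); first exact: Pc.
rewrite (_ : (fun g => _) = fun g : G =>
    \prod_(k < N * N) mxvec g 0 k ^+ m k); last first.
  by apply/funext => g; rewrite mevalX.
elim: (index_enum _) => [|k r IH].
  rewrite (_ : (fun g => _) = fun=> 1)//.
  by apply/funext => g; rewrite big_nil.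
rewrite (_ : (fun g => _) = fun g : G => mxvec g 0 k ^+ m k *
    \prod_(i <- r) mxvec g 0 i ^+ m i); last first.
  by apply/funext => g; rewrite big_cons.
apply: (PM) IH; elim: (m k) => [|e IH]; first exact: Pc.
rewrite (_ : (fun g => _) = fun g : G => mxvec g 0 k * mxvec g 0 k ^+ e).
  apply: (PM) IH; case/mxvec_indexP: k => i j.
  rewrite (_ : (fun g => _) = fun g : G => g i j)//.
  by apply/funext => g; rewrite mxvecE.
by apply/funext => g; rewrite exprS.
Qed.

Fact regular_subring : subring_closed (fun f : G -> C => `[< regular f >]).
Proof.
split.
- by apply/asboolP; exact: (regular_cst 1).
- move=> f h /asboolP rf /asboolP rh; apply/asboolP.
  exact: (regularD rf (regularN rh)).
- by move=> f h /asboolP rf /asboolP rh; apply/asboolP; exact: (regularM rf rh).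
Qed.

Fact regular_submod : submod_closed (fun f : G -> C => `[< regular f >]).
Proof.
split; first by apply/asboolP; exact: (regular_cst 0).
move=> a f h /asboolP rf /asboolP rh; apply/asboolP.
exact: (regularD (regularM (regular_cst a) rf) rh).
Qed.

(* The algebra O(SO_N): restrictions to SO_N of the polynomials in the matrix
   entries. *)
Record regfun : Type := RegFun {
  regfun_val :> G -> C;
  regfun_valP : `[< regular regfun_val >]
}.
HB.instance Definition _ := [isSub for regfun_val].
HB.instance Definition _ := gen_eqMixin regfun.
HB.instance Definition _ := gen_choiceMixin regfun.
HB.instance Definition _ :=
  GRing.SubChoice_isSubComPzRing.Build _ _ regfun regular_subring.
HB.instance Definition _ :=
  GRing.SubZmodule_isSubLmodule.Build C _ _ regfun regular_submod.

Definition mk_regfun (f : G -> C) (rf : regular f) : regfun :=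
  RegFun (asboolT rf).

Lemma regfun_regular (f : regfun) : regular f.
Proof. exact/asboolP/regfun_valP. Qed.

Lemma regfunP (f h : regfun) : (forall g, f g = h g) -> f = h.
Proof. by move=> fh; apply: val_inj; apply/funext. Qed.

Lemma regfunDE (f h : regfun) g : (f + h) g = f g + h g.
Proof. by []. Qed.

Lemma regfunME (f h : regfun) g : (f * h) g = f g * h g.
Proof. by []. Qed.

Lemma regfunZE a (f : regfun) g : (a *: f) g = a * f g.
Proof. by []. Qed.

Lemma regular_comp_mul (f : regfun) :
  exists s : seq (regfun * regfun),
    forall g h : G, f (g * h)%g = \sum_(p <- s) p.1 g * p.2 h.
Proof.
apply: (regular_ind (P := fun f => exists s : seq (regfun * regfun),
    forall g h : G, f (g * h)%g = \sum_(p <- s) p.1 g * p.2 h)) => //.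
- move=> a; exists [:: (mk_regfun (regular_cst a), 1)] => g h.
  by rewrite big_seq1 [X in _ * X](_ : _ = 1)// mulr1.
- move=> i j; exists [seq (mk_regfun (regular_entry i k),
                     mk_regfun (regular_entry k j)) | k : 'I_N] => g h.
  by rewrite big_image/= mxE.
- move=> f1 f2 [s1 e1] [s2 e2]; exists (s1 ++ s2) => g h.
  by rewrite big_cat/= e1 e2.
- move=> f1 f2 [s1 e1] [s2 e2].
  exists [seq (p.1 * q.1, p.2 * q.2) | p <- s1, q <- s2] => g h.
  rewrite e1 e2 big_allpairs_dep/= big_distrl/=; apply: eq_bigr => p _.
  rewrite big_distrr/=; apply: eq_bigr => q _.
  exact: mulrACA.
- exact: regfun_regular.
Qed.

End RegularFunctions.

Section Distributions.
Variables (R : realType) (N : nat).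
Local Notation C := R[i].
Local Notation V := 'cV[C]_N.
Local Notation G := (SO R N).
Local Notation OG := (regfun R N).

Lemma regular_mulr (f : OG) (g : G) : regular (fun h => f (h * g)%g).
Proof.
have [s fs] := regular_comp_mul f.
rewrite (_ : (fun h => _) = (\sum_(p <- s) p.2 g *: p.1 : OG)).
  exact: regfun_regular.
apply/funext => h; rewrite fs; elim: s {fs} => [|p s IH].
  by rewrite !big_nil.
by rewrite !big_cons IH mulrC.
Qed.

Lemma regular_mull (f : OG) (g : G) : regular (fun h => f (g * h)%g).
Proof.
have [s fs] := regular_comp_mul f.
rewrite (_ : (fun h => _) = (\sum_(p <- s) p.1 g *: p.2 : OG)).
  exact: regfun_regular.
apply/funext => h; rewrite fs; elim: s {fs} => [|p s IH].
  by rewrite !big_nil.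
by rewrite !big_cons IH.
Qed.

Definition translate (g : G) (f : OG) : OG := mk_regfun (regular_mull f g).

Definition conj_fun (g : G) (f : OG) : OG :=
  mk_regfun (regular_mulr (translate g f) g^-1%g).

Lemma conj_funE g f h : conj_fun g f h = f (g * (h * g^-1))%g.
Proof. by []. Qed.

(* The full linear dual of O(SO_N). *)
Definition dist : Type := {scalar OG}.
HB.instance Definition _ := gen_eqMixin dist.
HB.instance Definition _ := gen_choiceMixin dist.
Definition dist_fun (mu : dist) : OG -> C := (mu : {scalar OG}).
Coercion dist_fun : dist >-> Funclass.

Lemma distP (mu nu : dist) : (forall f, mu f = nu f) -> mu = nu.
Proof.
case: mu nu => [m [[cm] [am]]] [n [[cn] [an]]] /= /funext mn.
rewrite /dist_fun/= in mn; case: _ / mn in cn an *.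
by congr (GRing.Linear.Pack (GRing.Linear.Class _ _)); congr (_ _);
   exact: Prop_irrelevance.
Qed.

Definition mk_dist (m : OG -> C) (lm : scalar m) : dist :=
  let aux := GRing.isLinear.Build C OG C *%R m lm in
  (HB.pack m aux : {scalar OG}).

Lemma mk_distE m lm f : @mk_dist m lm f = m f.
Proof. by []. Qed.

Lemma dist_linear (mu : dist) : scalar mu.
Proof. exact: linearP. Qed.

Definition dist0 : dist := \0 : {scalar OG}.
Definition dist_add (mu nu : dist) : dist :=
  ((mu : {scalar OG}) \+ (nu : {scalar OG})) : {scalar OG}.
Definition dist_opp (mu : dist) : dist :=
  (\- (mu : {scalar OG})) : {scalar OG}.
Fact dist_scale_subproof (a : C) (mu : dist) : scalar (fun f => a * mu f).
Proof. by move=> b f h; rewrite dist_linear mulrDr mulrCA. Qed.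
Definition dist_scale (a : C) (mu : dist) : dist :=
  mk_dist (dist_scale_subproof a mu).

Fact dist_addA : associative dist_add.
Proof. by move=> mu nu xi; apply: distP => f; apply: addrA. Qed.
Fact dist_addC : commutative dist_add.
Proof. by move=> mu nu; apply: distP => f; apply: addrC. Qed.
Fact dist_add0 : left_id dist0 dist_add.
Proof. by move=> mu; apply: distP => f; apply: add0r. Qed.
Fact dist_addN : left_inverse dist0 dist_opp dist_add.
Proof. by move=> mu; apply: distP => f; apply: addNr. Qed.
HB.instance Definition _ :=
  GRing.isZmodule.Build dist dist_addA dist_addC dist_add0 dist_addN.

Fact dist_scaleA a b mu :
  dist_scale a (dist_scale b mu) = dist_scale (a * b) mu.
Proof. by apply: distP => f; apply: mulrA. Qed.
Fact dist_scale1 : left_id 1 dist_scale.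
Proof. by move=> mu; apply: distP => f; apply: mul1r. Qed.
Fact dist_scaleDr : right_distributive dist_scale +%R.
Proof. by move=> a mu nu; apply: distP => f; apply: mulrDr. Qed.
Fact dist_scaleDl mu : {morph dist_scale^~ mu : a b / a + b}.
Proof. by move=> a b; apply: distP => f; apply: mulrDl. Qed.
HB.instance Definition _ := GRing.Zmodule_isLmodule.Build C dist
  dist_scaleA dist_scale1 dist_scaleDr dist_scaleDl.

Fact delta_subproof (g : G) : scalar (fun f : OG => f g).
Proof. by []. Qed.
Definition delta (g : G) : dist := mk_dist (delta_subproof g).

Fact act_fun_subproof (f : OG) (mu : dist) : scalar (fun h => mu (f * h)).
Proof.
move=> a h k; rewrite -dist_linear; congr (mu _).
by apply: regfunP => g; rewrite !regfunME !regfunDE !regfunZE !regfunME;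
   rewrite mulrDr mulrCA.
Qed.
Definition act_fun (f : OG) (mu : dist) : dist :=
  mk_dist (act_fun_subproof f mu).

Fact act_conj_subproof (g : G) (mu : dist) :
  scalar (fun h => mu (conj_fun g h)).
Proof.
by move=> a h k; rewrite -dist_linear; congr (mu _); apply: regfunP.
Qed.
Definition act_conj (g : G) (mu : dist) : dist :=
  mk_dist (act_conj_subproof g mu).

Lemma regular_integral (f : OG) (nu : dist) :
  regular (fun g => nu (translate g f)).
Proof.
have [s fs] := regular_comp_mul f.
rewrite (_ : (fun g => _) = (\sum_(p <- s) nu p.2 *: p.1 : OG)).
  exact: regfun_regular.
apply/funext => g.
have -> : translate g f = \sum_(p <- s) p.1 g *: p.2.
  apply: regfunP => h; rewrite [LHS]fs; elim: s {fs} => [|p s IH].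
    by rewrite !big_nil.
  by rewrite !big_cons IH.
elim: s {fs} => [|p s IH]; first by rewrite !big_nil; exact: linear0.
by rewrite !big_cons dist_linear IH mulrC.
Qed.

Definition integrate (nu : dist) (f : OG) : OG :=
  mk_regfun (regular_integral f nu).

Fact conv_subproof (mu nu : dist) : scalar (fun f => mu (integrate nu f)).
Proof.
move=> a f h; rewrite -dist_linear; congr (mu _); apply: regfunP => g.
rewrite regfunDE regfunZE /= -dist_linear; congr (nu _).
exact: regfunP.
Qed.
(* <mu * nu, f> is mu applied to g |-> nu (h |-> f (g h)). *)
Definition conv (mu nu : dist) : dist := mk_dist (conv_subproof mu nu).

Fact convA : associative conv.
Proof.
move=> mu nu xi; apply: distP => f; rewrite !mk_distE; congr (mu _).
apply: regfunP => g; rewrite /=; congr (nu _).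
apply: regfunP => h /=; congr (xi _); apply: regfunP => k /=.
by rewrite mulgA.
Qed.
Fact conv1 : left_id (delta 1%g) conv.
Proof.
move=> mu; apply: distP => f; rewrite !mk_distE /=; congr (mu _).
by apply: regfunP => g /=; rewrite mul1g.
Qed.
Fact conv_1 : right_id (delta 1%g) conv.
Proof.
move=> mu; apply: distP => f; rewrite !mk_distE /=; congr (mu _).
by apply: regfunP => g /=; rewrite mulg1.
Qed.
Fact convDl : left_distributive conv +%R.
Proof. by move=> mu nu xi; apply: distP. Qed.
Fact convDr : right_distributive conv +%R.
Proof.
move=> mu nu xi; apply: distP => f.
rewrite [RHS](_ : _ = mu (integrate nu f) + mu (integrate xi f))//.
rewrite -[mu (integrate nu f)]mul1r -dist_linear mk_distE; congr (mu _).
by apply: regfunP => g; rewrite regfunDE regfunZE mul1r.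
Qed.
HB.instance Definition _ :=
  GRing.Zmodule_isPzRing.Build dist convA conv1 conv_1 convDl convDr.

Lemma deltaM g h : delta g * delta h = delta (g * h)%g.
Proof. exact: distP. Qed.

End Distributions.

Section ContinuousHecke.
Import monalg.
Variables (R : realType) (N : nat).
Local Notation C := R[i].
Local Notation V := 'cV[C]_N.
Local Notation G := (SO R N).
Local Notation D := (dist R N).

Lemma regular_sum I (r : seq I) (f : I -> G -> C) :
  (forall i, regular (f i)) -> regular (fun g => \sum_(i <- r) f i g).
Proof.
move=> rf; elim: r => [|i r IH].
  rewrite (_ : (fun g => _) = fun=> 0); first exact: regular_cst.
  by apply/funext => g; rewrite big_nil.
rewrite (_ : (fun g => _) = fun g => f i g + \sum_(j <- r) f j g).
  exact: regularD.
by apply/funext => g; rewrite big_cons.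
Qed.

Lemma regular_coord (x : V) i : regular (fun g : G => (g *m x) i 0).
Proof.
rewrite (_ : (fun g => _) = fun g : G => \sum_j g i j * x j 0).
  by apply: regular_sum => j; exact/regularM/regular_cst/regular_entry.
by apply/funext => g; rewrite mxE.
Qed.

Lemma regular_pairing (x y : V) :
  regular (fun g : G => so_form ((so_val g - so_val g^-1%g) *m x) y).
Proof.
rewrite (_ : (fun g => _) = fun g : G =>
    \sum_j (\sum_k (g j k + (- g k j)) * x k 0) * y j 0).
  apply: regular_sum => j; apply: regularM; last exact: regular_cst.
  apply: regular_sum => k; apply: regularM; last exact: regular_cst.
  by apply: regularD; [|apply: regularN]; exact: regular_entry.
apply/funext => g; rewrite /so_form mxE; apply: eq_bigr => j _; congr (_ * _).
by rewrite !mxE; apply: eq_bigr => k _; rewrite !mxE.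
Qed.

Definition pairing_fun (x y : V) : regfun R N :=
  mk_regfun (regular_pairing x y).

Local Notation gens := (D + V)%type.
Definition free_alg : Type := {malg C[{fmonom gens}]}.
HB.instance Definition _ := GRing.Lalgebra.on free_alg.

Definition free_dist (mu : D) : free_alg := << fmu (inl mu : gens) >>.
Definition free_vec (x : V) : free_alg := << fmu (inr x : gens) >>.

(* (v_i^*, g x) for the standard basis v_i of V. *)
Definition coord_fun (x : V) (i : 'I_N) : regfun R N :=
  mk_regfun (regular_coord x i).

Inductive smashT_rel : free_alg -> Prop :=
| smashT_dist_linear (a : C) (mu nu : D) : smashT_rel
    (free_dist (a *: mu + nu) - (a *: free_dist mu + free_dist nu))
| smashT_dist1 : smashT_rel (free_dist 1 - 1)
| smashT_distM (mu nu : D) :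
    smashT_rel (free_dist (mu * nu) - free_dist mu * free_dist nu)
| smashT_vec_linear (a : C) (x y : V) : smashT_rel
    (free_vec (a *: x + y) - (a *: free_vec x + free_vec y))
| smashT_cross (mu : D) (x : V) : smashT_rel
    (free_dist mu * free_vec x -
     \sum_(i < N) free_vec (delta_mx i 0) *
                  free_dist (act_fun (coord_fun x i) mu)).

(* The algebra O(SO_N)^* |x TV. *)
Definition smashT : Type := quot_ring (ideal_of smashT_rel).
HB.instance Definition _ := GRing.PzRing.on smashT.

Definition smashT_dist (mu : D) : smashT :=
  qpi (ideal_of smashT_rel) (free_dist mu).
Definition smashT_vec (x : V) : smashT :=
  qpi (ideal_of smashT_rel) (free_vec x).

Inductive smashS_rel : smashT -> Prop :=
| smashS_comm (x y : V) : smashS_rel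
    (smashT_vec x * smashT_vec y - smashT_vec y * smashT_vec x).

(* The algebra O(SO_N)^* |x SV. *)
Definition smashS : Type := quot_ring (ideal_of smashS_rel).
HB.instance Definition _ := GRing.PzRing.on smashS.
Definition smashS_dist (mu : D) : smashS :=
  qpi (ideal_of smashS_rel) (smashT_dist mu).
Definition smashS_vec (x : V) : smashS :=
  qpi (ideal_of smashS_rel) (smashT_vec x).

Variable kappa : V -> V -> D.

Inductive hecke_rel : smashT -> Prop :=
| hecke_comm (x y : V) : hecke_rel
    (smashT_vec x * smashT_vec y - smashT_vec y * smashT_vec x
     - smashT_dist (kappa x y)).

(* The algebra H_kappa(SO_N, V_N). *)
Definition hecke : Type := quot_ring (ideal_of hecke_rel).
HB.instance Definition _ := GRing.PzRing.on hecke.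
Definition hecke_dist (mu : D) : hecke :=
  qpi (ideal_of hecke_rel) (smashT_dist mu).
Definition hecke_vec (x : V) : hecke :=
  qpi (ideal_of hecke_rel) (smashT_vec x).

Inductive hecke_deg : nat -> hecke -> Prop :=
| hecke_deg_dist (mu : D) : hecke_deg 0 (hecke_dist mu)
| hecke_deg_vec (x : V) : hecke_deg 1 (hecke_vec x).

Definition hecke_fil : filtration hecke := filtration_of hecke_deg.

Definition gr_dist (mu : D) : gr hecke_fil :=
  gr_class (F := hecke_fil) (gen_fil_in (hecke_deg_dist mu)).
Definition gr_vec (x : V) : gr hecke_fil :=
  gr_class (F := hecke_fil) (gen_fil_in (hecke_deg_vec x)).

(* O(SO_N)^* and V generate smashS, so phi is unique: it is the natural
   surjection.  The scalars a in C act as the elements a *: 1 of O(SO_N)^*, so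
   the ideals and the filtration above are C-subspaces and phi is C-linear. *)
Definition PBW_property : Prop :=
  exists phi : {rmorphism smashS -> gr hecke_fil},
    [/\ forall mu, phi (smashS_dist mu) = gr_dist mu,
        forall x, phi (smashS_vec x) = gr_vec x
      & bijective phi].

Definition skew_symmetric : Prop := forall x y, kappa x y = - kappa y x.

Definition equivariant : Prop :=
  forall (g : G) (x y : V), kappa (g *m x) (g *m y) = act_conj g (kappa x y).

(* S = {g | rk (1 - g) <= 2}, with its reduced structure: the ideal of S is the
   set of the regular functions vanishing on S. *)
Definition in_S (g : G) : Prop := (\rank (1%:M - so_val g)%R <= 2)%N.

Definition supported_on_S (c : D) : Prop :=
  forall f : regfun R N, (forall g, in_S g -> f g = 0) -> c f = 0.

Definition conj_invariant (c : D) : Prop := forall g : G, act_conj g c = c.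

End ContinuousHecke.

(* Main.v *)
Require Import Defs.
From HB Require Import structures.
From mathcomp Require Import all_boot all_order all_algebra all_fingroup all_classical reals.
From mathcomp Require Import ring zify finmap.
From mathcomp.real_closed Require Import complex.
From mathcomp.multinomials Require freeg ssrcomplements mpoly xfinmap monalg.
(* Write A = 1 - g and K_ij = kappa(e_i, e_j). Both conditions are equivalent to
   the Jacobi identity A_uz K_xy + A_ux K_yz + A_uy K_zx = 0 in O(SO_N)^*.

   PBW and Jacobi. In H_kappa, [z, [x, y]] + (cyclic) = 0 reads
   sum_u v_u (A_uz K_xy + A_ux K_yz + A_uy K_zx) = 0, so PBW forces the identity.
   Conversely the identity makes the rewriting of words in the basis vectors
   into sorted words confluent: H_kappa acts on the families of distributions
   indexed by words that satisfy its commutation relations, the coefficient of a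
   sorted word s in the normal form is such a family, and these families
   separate the leading symbols.

   Jacobi and c. On S the matrix A has rank at most 2, and the identity holds for
   K = p c with p = A - A^T. Conversely, the identity implies that K commutes
   with A and that s = p K is symmetric, with many quadratic relations. Together
   with the invariance under unipotent rotations they show, by induction on the
   degree of a monomial in the entries of p and A + A^T, that an equivariant
   solution K is determined by the numbers <sum_kj p_kj K_jk, (tr A)^n>. All
   values of these numbers are attained by some p c: the rotations
   1 + 2 a w + 2 w^2, where w = x y^T - y x^T and a^2 + |x|^2 |y|^2 - (x, y)^2 = 1,
   lie in S, and c is the mean over formal Gaussian vectors x and y, with an
   arbitrary weight in each degree. *)
Set Implicit Arguments.
Unset Strict Implicit.
Unset Printing Implicit Defensive.
Import GRing.Theory Num.Theory.
Local Open Scope ring_scope.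

(** * Matrices killed by their minors *)

(** Two obstacles shape the passage from K to c. The Jacobi identity yields only that K is killed by
    the 3 by 3 minors of A, and to conclude from this that K lives on the reduced scheme S these
    minors would have to generate a radical ideal. Moreover p vanishes at the identity and at the
    rotations of angle pi in a plane, so c is not a quotient of K by p. Both are avoided by
    comparison: c is built on S from the outset, with prescribed moments, and uniqueness is applied
    to K - p c.

    The relations behind the uniqueness are those of a rotation by theta in one plane with
    projection P, where t = tr A = 2 - 2 cos theta, A + A^T = t P and p^2 = t (t - 4) P. They are
    derived only after multiplication by an entry of K, since K lives in a module and nothing can be
    divided out.

    The bound N > 2 serves twice: a third direction makes each infinitesimal rotation a combination
    of nilpotent ones, and the nonzero factor N - 2 forces K to vanish in degree 0. *)

Section Determinant.
Variables (R : comPzRingType) (N : nat).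
Hypothesis R_tf : forall (x : R) n, x *+ n.+1 = 0 -> x = 0.

Definition minor3 (M : 'M[R]_N) (i j l a b c : 'I_N) : R :=
  M i a * (M j b * M l c - M j c * M l b)
  + M i b * (M j c * M l a - M j a * M l c)
  + M i c * (M j a * M l b - M j b * M l a).

(* Each permutation is averaged with its composites with the six permutations
   of the rows i, j, l: this avoids a Laplace expansion along three rows. *)
Lemma det_mul_minor3 (M : 'M[R]_N) (k : R) (i j l : 'I_N) :
  i != j -> j != l -> i != l ->
  (forall a b c, minor3 M i j l a b c * k = 0) -> \det M * k = 0.
Proof.
move=> ij jl il Mk; apply: (@R_tf _ 5).
pose F (s : 'S_N) : R := (-1) ^+ s * \prod_u M u (s u).
have detF (t : 'S_N) : \det M = \sum_s F (t * s)%g.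
  rewrite [LHS](reindex_inj (mulgI t)) /=; exact: eq_bigr.
pose rest (s : 'S_N) := \prod_(u | (u != i) && (u != j) && (u != l)) M u (s u).
have FE (t s : 'S_N) : (forall u, u != i -> u != j -> u != l -> t u = u) ->
    F (t * s)%g = (-1) ^+ t * (-1) ^+ s * (M i (s (t i)) * M j (s (t j)) * M l (s (t l)) * rest s).
  move=> tu; rewrite /F odd_permM signr_addb.
  rewrite (bigD1 i) //= (bigD1 j) /=; last by rewrite eq_sym.
  rewrite (bigD1 l) /=; last by rewrite (eq_sym l i) (eq_sym l j) il jl.
  rewrite !permM !mulrA; congr (_ * _); apply: eq_bigr => u /andP[/andP[ui uj] ul].
  by rewrite permM tu.
pose ts := [:: 1%g; tperm i j; tperm j l; tperm i l; (tperm i j * tperm j l)%g; (tperm i j * tperm i l)%g].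
have -> : \det M * k *+ 6 = \sum_(t <- ts) \det M * k.
  by rewrite /ts !big_cons big_nil addr0 !mulrS mulr0n addr0.
transitivity (\sum_(s : {perm 'I_N}) ((-1) ^+ s * rest s * (minor3 M i j l (s i) (s j) (s l) * k))).
  rewrite /ts !big_cons big_nil addr0 {1}(detF 1%g) {1}(detF (tperm i j)) {1}(detF (tperm j l)) {1}(detF (tperm i l)).
  rewrite {1}(detF (tperm i j * tperm j l)%g) {1}(detF (tperm i j * tperm i l)%g).
  rewrite !mulr_suml -!big_split /=; apply: eq_bigr => s _.
  rewrite !FE ?odd_permM ?odd_perm1 ?odd_tperm ?ij ?jl ?il /=; first last.
  - by move=> u ui uj ul; rewrite perm1.
  - by move=> u ui uj ul; rewrite tpermD // eq_sym.
  - by move=> u ui uj ul; rewrite tpermD // eq_sym.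
  - by move=> u ui uj ul; rewrite tpermD // eq_sym.
  - by move=> u ui uj ul; rewrite permM !tpermD // eq_sym.
  - by move=> u ui uj ul; rewrite permM !tpermD // eq_sym.
  rewrite !permM !perm1 !tpermL !tpermR.
  rewrite (tpermD (x:=i) (y:=j) (z:=l)) // ?(eq_sym l) //.
  rewrite (tpermD (x:=j) (y:=l) (z:=i)) // ?(eq_sym _ i) //; try by rewrite eq_sym.
  rewrite (tpermD (x:=i) (y:=l) (z:=j)) // ?tpermL ?tpermR //; try by rewrite eq_sym.
  rewrite /minor3 /= expr0 expr1.
  move: ((-1) ^+ s) (rest s) (M i (s i)) (M i (s j)) (M i (s l)) (M j (s i)) (M j (s j)) (M j (s l))
    (M l (s i)) (M l (s j)) (M l (s l)) => e r a1 a2 a3 b1 b2 b3 c1 c2 c3.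
  ring.
by rewrite big1 // => s _; rewrite Mk mulr0.
Qed.
(* The row r of P - Q, below the first rows of P and above the last of Q. *)
Definition mix_row (P Q : 'M[R]_N) (r : 'I_N) : 'M[R]_N :=
  \matrix_(i, j) if (i < r)%N then P i j
                 else if i == r then P i j - Q i j else Q i j.

(** The rows of [Q] are replaced by those of [P] one at a time, and the determinant is linear in the
    row being replaced. *)
Lemma det_telescope (P Q : 'M[R]_N) :
  \det P = \det Q + \sum_r \det (mix_row P Q r).
Proof.
pose f (m : nat) := \det (\matrix_(i, j) if (i < m)%N then P i j else Q i j).
have -> : \det P = f N.
  by congr (\det _); apply/matrixP => i j; rewrite mxE ltn_ord.
have -> : \det Q = f 0 by congr (\det _); apply/matrixP => i j; rewrite mxE.
apply/eqP; rewrite addrC -subr_eq; apply/eqP.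
rewrite -(telescope_sumr f) // big_mkord; apply: eq_bigr => r _.
rewrite /f.
rewrite (@determinant_multilinear _ _ (\matrix_(i, j) if (i < r.+1)%N then P i j else Q i j)
  (mix_row P Q r) (\matrix_(i, j) if (i < r)%N then P i j else Q i j) r 1 1) ?mul1r ?addrK //.
- by apply/rowP => j; rewrite !mxE ltnS leqnn ltnn eqxx !mul1r subrK.
- apply/matrixP => i j; rewrite !mxE; move: (lift r i) (neq_lift r i) => {}i ri.
  have -> : (i < r.+1)%N = (i < r)%N.
    by rewrite ltnS leq_eqVlt; move: ri; rewrite -val_eqE /= eq_sym => /negbTE ->.
  by rewrite eq_sym (negbTE ri).
- apply/matrixP => i j; rewrite !mxE; move: (lift r i) (neq_lift r i) => {}i ri.
  have -> : (i < r.+1)%N = (i < r)%N.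
    by rewrite ltnS leq_eqVlt; move: ri; rewrite -val_eqE /= eq_sym => /negbTE ->.
  by [].
Qed.

Lemma det_row0 (M : 'M[R]_N) i : (forall j, M i j = 0) -> \det M = 0.
Proof.
move=> M0; rewrite (expand_det_row _ i) big1 // => j _.
by rewrite M0 mul0r.
Qed.

Definition id_row1 (r : 'I_N) (v : 'I_N -> R) : 'M[R]_N :=
  \matrix_(i, j) if i == r then v j else (i == j)%:R.

Definition id_row2 (r s : 'I_N) (v w : 'I_N -> R) : 'M[R]_N :=
  \matrix_(i, j) if i == r then v j else if i == s then w j else (i == j)%:R.

Lemma det_id_row1 r v : \det (id_row1 r v) = v r.
Proof.
rewrite /determinant (bigD1 1%g) //= odd_perm1 mul1r [X in _ + X]big1 ?addr0.
  rewrite (bigD1 r) //= mxE eqxx perm1 big1 ?mulr1 // => i ir.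
  by rewrite mxE (negbTE ir) perm1 eqxx.
move=> s s1; have [i ir si] : exists2 i, i != r & s i != i.
  apply/exists_inP; apply: contraR s1 => /exists_inPn h; apply/eqP/permP => i.
  rewrite perm1; have h' j : j != r -> s j = j by move=> jr; apply/eqP/negPn/h.
  have [->|/h' //] := eqVneq i r; apply/eqP/negPn/negP => sr.
  by have /perm_inj/eqP := h' _ sr; rewrite (negbTE sr).
by rewrite (bigD1 i) //= mxE (negbTE ir) eq_sym (negbTE si) mul0r mulr0.
Qed.

(** A permutation contributes only if it fixes every index other than [r] and [s], which leaves two
    terms of the Leibniz sum. *)
Lemma det_id_row2 r s v w : r != s ->
  \det (id_row2 r s v w) = v r * w s - v s * w r.
Proof.
move=> rs; have sr : s != r by rewrite eq_sym.
have t1 : tperm r s != 1%g.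
  by apply/eqP => /permP/(_ r); rewrite tpermL perm1 => /eqP; rewrite (negbTE sr).
rewrite /determinant (bigD1 1%g) //= (bigD1 (tperm r s)) //=.
rewrite odd_perm1 odd_tperm rs mul1r expr1 mulN1r [X in _ + (_ + X)]big1 ?addr0; last first.
  move=> t /andP[tn1 tnt].
  have [i /andP[ir is_] ti] : exists2 i, (i != r) && (i != s) & t i != i.
    apply/exists_inP; apply: contraR tn1 => /exists_inPn h.
    have h' j : j != r -> j != s -> t j = j.
      by move=> jr js; apply/eqP/negPn/h/andP.
    have tr : (t r == r) || (t r == s).
      apply: contraT; rewrite negb_or => /andP[n1 n2].
      by have /perm_inj/eqP := h' _ n1 n2; rewrite (negbTE n1).
    have ts : (t s == r) || (t s == s).
      apply: contraT; rewrite negb_or => /andP[n1 n2].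
      by have /perm_inj/eqP := h' _ n1 n2; rewrite (negbTE n2).
    case/orP: tr => /eqP tr.
      apply/eqP/permP => i; rewrite perm1.
      have [->//|ir] := eqVneq i r; have [->|is_] := eqVneq i s; last exact: h'.
      by case/orP: ts => /eqP // tsr; move: (perm_inj (etrans tsr (esym tr))) => /eqP; rewrite (negbTE sr).
    case/negP: tnt; apply/eqP/permP => i.
    case: tpermP => [->//|->|/eqP ir /eqP is_]; last exact: h'.
    by case/orP: ts => /eqP // tss; move: (perm_inj (etrans tss (esym tr))) => /eqP; rewrite (negbTE sr).
  by rewrite (bigD1 i) //= mxE (negbTE ir) (negbTE is_) eq_sym (negbTE ti) mul0r mulr0.
congr (_ - _); rewrite (bigD1 r) //= (bigD1 s) //= big1 ?mulr1; last first.
- by move=> i /andP[ir is_]; rewrite mxE (negbTE ir) (negbTE is_) tpermD ?eqxx // eq_sym.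
- by rewrite !mxE eqxx (negbTE sr) eqxx tpermL tpermR.
- by move=> i /andP[ir is_]; rewrite mxE (negbTE ir) (negbTE is_) perm1 eqxx.
- by rewrite !mxE eqxx (negbTE sr) eqxx !perm1.
Qed.

(** In det (1 - M) = 1 - e_1 + e_2 - ..., where e_j is the sum of the principal minors of order j,
    multiplication by [k] kills all e_j with j at least 3. The doubling avoids the division in e_2 =
    ((tr M)^2 - tr (M^2)) / 2. *)
Lemma det_1B_mul_minor3 (M : 'M[R]_N) (k : R) :
  (forall i j l a b c, minor3 M i j l a b c * k = 0) ->
  (\det (1%:M - M) * k) *+ 2 = (2%:R - \tr M *+ 2 + (\tr M ^+ 2 - \tr (M *m M))) * k.
Proof.
move=> Mk.
have tel1 : \det (1%:M - M) = 1 + \sum_r \det (mix_row (1%:M - M) 1%:M r).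
  by rewrite (det_telescope _ 1%:M) det1.
(* Each term is telescoped again, so that rows of [- M] stand at indices q < s < r. Two such rows
   give a principal minor of order 2; a third one is killed by [det_mul_minor3]. *)
have tel2 r : \det (mix_row (1%:M - M) 1%:M r) * k
   = - M r r * k + \sum_(s < N | (s < r)%N) (M r r * M s s - M r s * M s r) * k.
  set P := mix_row _ _ _.
  rewrite (det_telescope P (id_row1 r (fun j => - M r j))) det_id_row1 mulrDl; congr (_ + _).
  rewrite mulr_suml [RHS]big_mkcond /=; apply: eq_bigr => s _.
  have [sr|rs] := ltnP s r; last first.
    rewrite (@det_row0 _ s) ?mul0r // => j; rewrite !mxE ltnn eqxx.
    have [->|nsr] := eqVneq s r; rewrite ?ltnn ?eqxx //=.
      ring.
    by rewrite ltnNge rs /= subrr.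
  set P2 := mix_row P _ s.
  have nrs : r != s by apply: contraTneq sr => ->; rewrite ltnn.
  have nsr : s != r by rewrite eq_sym.
  rewrite (det_telescope P2 (id_row2 r s (fun j => - M r j) (fun j => - M s j))).
  rewrite det_id_row2 // mulrDl !mulrNN mulr_suml [X in _ + X]big1 ?addr0 //.
  move=> q _; have [qs|sq] := ltnP q s; last first.
    rewrite (@det_row0 _ q) ?mul0r // => j; rewrite !mxE ltnn eqxx.
    have [->|nqr] := eqVneq q r.
      by rewrite ltnNge (ltnW sr) /= (negbTE nrs) subrr.
    have [->|nqs] := eqVneq q s.
      by rewrite ltnn sr; ring.
    by rewrite ltnNge sq /= subrr.
  have nqs : q != s by apply: contraTneq qs => ->; rewrite ltnn.
  have nqr : q != r by apply: contraTneq (ltn_trans qs sr) => ->; rewrite ltnn.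
  apply: (det_mul_minor3 nqs nsr nqr) => a b c.
  have E1 j : mix_row P2 (id_row2 r s (fun j => - M r j) (fun j => - M s j)) q q j = - M q j.
    rewrite !mxE ltnn eqxx qs (ltn_trans qs sr) (negbTE nqr) (negbTE nqs).
    by rewrite ?(negbTE nqr) ?(negbTE nqs) /=; ring.
  have E2 j : mix_row P2 (id_row2 r s (fun j => - M r j) (fun j => - M s j)) q s j = - M s j.
    by rewrite !mxE ltnNge (ltnW qs) /= eq_sym (negbTE nqs) (negbTE nsr) eqxx.
  have E3 j : mix_row P2 (id_row2 r s (fun j => - M r j) (fun j => - M s j)) q r j = - M r j.
    by rewrite !mxE ltnNge (ltnW (ltn_trans qs sr)) /= eq_sym (negbTE nqr) eqxx.
  rewrite /minor3 !E1 !E2 !E3 -[RHS]oppr0 -(Mk q s r a b c) /minor3; ring.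
have off r s : (M r r * M s s - M r s * M s r) * k = (M s s * M r r - M s r * M r s) * k by ring.
rewrite tel1 mulrDl mulr_suml (eq_bigr _ (fun r _ => tel2 r)) big_split /=.
set S2 := \sum_r \sum_(s | _) _.
have -> : \sum_r - M r r * k = - \tr M * k.
  by rewrite -mulr_suml sumrN.
have S2E : S2 *+ 2 = (\tr M ^+ 2 - \tr (M *m M)) * k.
  have -> : (\tr M ^+ 2 - \tr (M *m M)) * k = \sum_r \sum_s (M r r * M s s - M r s * M s r) * k.
    rewrite expr2 /mxtrace big_distrl /= -sumrB mulr_suml; apply: eq_bigr => r _.
    by rewrite mxE big_distrr /= -sumrB mulr_suml; apply: eq_bigr.
  transitivity (S2 + \sum_(r < N) \sum_(s < N | (r < s)%N) (M r r * M s s - M r s * M s r) * k).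
    rewrite mulr2n; congr (_ + _).
    rewrite /S2 (exchange_big_dep predT) //=; apply: eq_bigr => r _; apply: eq_bigr => s _; exact: off.
  rewrite -big_split /=; apply: eq_bigr => r _.
  rewrite [RHS](bigID (fun s : 'I_N => (s < r)%N)) /=; congr (_ + _).
  rewrite [RHS](bigD1 r) ?ltnn //= subrr mul0r add0r; apply: eq_bigl => s.
  by rewrite -leqNgt ltn_neqAle andbC eq_sym.
rewrite !mulrnDl S2E; ring.
Qed.
End Determinant.

(** * Algebraic consequences of the Jacobi identity *)

Section Relations.
Variables (R : comPzRingType) (N : nat).
Hypothesis R_tf : forall (x : R) n, x *+ n.+1 = 0 -> x = 0.
Variables A K : 'M[R]_N.
Hypothesis K_skew : K^T = - K.
Hypothesis AtA : A^T *m A = A + A^T.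
Hypothesis AAt : A *m A^T = A + A^T.
Hypothesis det1A : \det (1%:M - A) = 1.

(** The 3-form a /\ K is zero, with [K] read as a 2-form and [a] as a 1-form. *)
Definition wedge0 (a : 'I_N -> R) : Prop :=
  forall x y z, a x * K y z + a y * K z x + a z * K x y = 0.

Hypothesis A_wedge : forall u, wedge0 (A u).

Local Notation p := (A - A^T).
Local Notation sg := (A + A^T).
Local Notation t := (\tr A).
Local Notation s := (p *m K).

Lemma skewE x y : K x y = - K y x.
Proof. by have /matrixP/(_ y x) := K_skew; rewrite !mxE. Qed.

Lemma mul_2I (x y : R) : x *+ 2 = y *+ 2 -> x = y.
Proof. by move=> xy; apply/eqP; rewrite -subr_eq0; apply/eqP/(@R_tf _ 1); rewrite mulrnBl xy subrr. Qed.

Lemma wedge0_comb (I : finType) (f : I -> R) (a : I -> 'I_N -> R) :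
  (forall i, wedge0 (a i)) -> wedge0 (fun x => \sum_i f i * a i x).
Proof.
move=> aP x y z; rewrite !mulr_suml -!big_split big1 //= => i _.
by rewrite -[RHS](mulr0 (f i)) -(aP i x y z); ring.
Qed.

Lemma wedge0D a b : wedge0 a -> wedge0 b -> wedge0 (fun x => a x + b x).
Proof.
by move=> aP bP x y z; rewrite -[RHS]addr0 -{1}(aP x y z) -(bP x y z); ring.
Qed.

Lemma wedge0B a b : wedge0 a -> wedge0 b -> wedge0 (fun x => a x - b x).
Proof.
by move=> aP bP x y z; rewrite -[RHS]subr0 -{1}(aP x y z) -(bP x y z); ring.
Qed.

Lemma wedge0_eq a b : a =1 b -> wedge0 a -> wedge0 b.
Proof. by move=> ab aP x y z; rewrite -!ab. Qed.

(** Orthogonality of 1 - A gives A^T = A^T A - A, so the rows of A^T are combinations of those of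
    A. *)
Lemma At_wedge u : wedge0 (A^T u).
Proof.
apply: (@wedge0_eq (fun x => (\sum_v A^T u v * A v x) - A u x)).
  by move=> x; have /matrixP/(_ u x) := AtA; rewrite mxE => ->; rewrite !mxE; ring.
by apply: wedge0B; [apply: wedge0_comb => v; exact: A_wedge | exact: A_wedge].
Qed.

Lemma sg_wedge u : wedge0 (sg u).
Proof.
apply: wedge0_eq (wedge0D (A_wedge u) (At_wedge u)) => x.
by rewrite !mxE.
Qed.

Lemma p_wedge u : wedge0 (p u).
Proof.
apply: wedge0_eq (wedge0B (A_wedge u) (At_wedge u)) => x.
by rewrite !mxE.
Qed.

(** Heuristically [a] and [b] lie in the plane of the 2-form [K], so a /\ b is proportional to [K].
    This is the proportionality with denominators cleared; it takes two instances of each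
    hypothesis. *)
Lemma wedge_swap a b x y z w : wedge0 a -> wedge0 b ->
  (a x * b y - a y * b x) * K z w = (a z * b w - a w * b z) * K x y.
Proof.
move=> aP bP.
apply/eqP; rewrite -subr_eq0; apply/eqP.
transitivity (b y * (a x * K z w + a z * K w x + a w * K x z)
  + a z * (b y * K x w + b x * K w y + b w * K y x)
  - a w * (b y * K x z + b x * K z y + b z * K y x)
  - b x * (a y * K z w + a z * K w y + a w * K y z)).
  rewrite (skewE w x) (skewE w y) (skewE y x) (skewE z y); ring.
by rewrite !aP !bP; ring.
Qed.

(** Three 1-forms in one plane are dependent: after expansion along [a], the swap exchanges the
    indices of b /\ c with those of [K] and leaves a multiple of a /\ K. *)
Lemma minor3_mul_skew a b c x y z q r : wedge0 a -> wedge0 b -> wedge0 c ->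
  (a x * (b y * c z - b z * c y) + a y * (b z * c x - b x * c z)
   + a z * (b x * c y - b y * c x)) * K q r = 0.
Proof.
move=> aP bP cP.
rewrite !mulrDl -!mulrA !(wedge_swap _ _ q r bP cP).
by rewrite -[RHS](mulr0 (b q * c r - b r * c q)) -(aP x y z); ring.
Qed.

(** Here det (1 - A) = 1 enters: the expansion truncated after e_2 gives e_2(A) K = t K, and
    [wedge_swap] turns e_2(A) K into A^T K A. *)
Lemma trA_skew : A^T *m K *m A = t *: K.
Proof.
apply/matrixP => x y; rewrite [in RHS]mxE.
have e := det_1B_mul_minor3 R_tf (M := A) (k := K x y)
  (fun i j l a b c => minor3_mul_skew a b c x y (A_wedge i) (A_wedge j) (A_wedge l)).
rewrite det1A mul1r in e.
have e2 : (t ^+ 2 - \tr (A *m A)) * K x y = (t * K x y) *+ 2.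
  apply/eqP; rewrite -subr_eq0; apply/eqP.
  transitivity ((2 - t *+ 2 + (t ^+ 2 - \tr (A *m A))) * K x y - K x y *+ 2); last by rewrite -e subrr.
  by ring.
apply: mul_2I; rewrite -e2.
have -> : (t ^+ 2 - \tr (A *m A)) * K x y
   = \sum_i \sum_j (A i x * A j y - A i y * A j x) * K i j.
  rewrite expr2 /mxtrace big_distrl /= -sumrB mulr_suml; apply: eq_bigr => i _.
  rewrite mxE big_distrr /= -sumrB mulr_suml; apply: eq_bigr => j _.
  exact: wedge_swap (A_wedge i) (A_wedge j).
have E x' y' : (A^T *m K *m A) x' y' = \sum_i \sum_j A i x' * A j y' * K i j.
  rewrite mxE exchange_big /=; apply: eq_bigr => j _; rewrite mxE mulr_suml.
  by apply: eq_bigr => i _; rewrite mxE; ring.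
have -> : \sum_i \sum_j (A i x * A j y - A i y * A j x) * K i j
  = (A^T *m K *m A) x y - (A^T *m K *m A) y x.
  rewrite !E -sumrB; apply: eq_bigr => i _; rewrite -sumrB; apply: eq_bigr => j _; ring.
rewrite mulr2n; congr (_ + _).
have /matrixP/(_ y x) : (A^T *m K *m A)^T = - (A^T *m K *m A).
  by rewrite !trmx_mul trmxK K_skew mulNmx mulmxN mulmxA.
by rewrite !mxE => <-.
Qed.

(** The identity for the row [u] is taken with [u] as one of its three arguments too, and summed
    over [u]. *)
Lemma anticomm (M : 'M[R]_N) : (forall u, wedge0 (M u)) ->
  K *m M + M^T *m K = \tr M *: K.
Proof.
move=> MP; apply/matrixP => x y.
have e : \sum_u (M u u * K x y + M u x * K y u + M u y * K u x) = 0.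
  by rewrite big1 // => u _; apply: MP.
rewrite !big_split /= -mulr_suml in e.
rewrite !mxE.
have -> : \sum_j K x j * M j y = - \sum_u M u y * K u x.
  by rewrite -sumrN; apply: eq_bigr => u _; rewrite (skewE x); ring.
have -> : \sum_j M^T x j * K j y = - \sum_u M u x * K y u.
  by rewrite -sumrN; apply: eq_bigr => u _; rewrite mxE (skewE y); ring.
by apply/eqP; rewrite -subr_eq0 -oppr_eq0 -[X in _ == X]e; apply/eqP; rewrite /mxtrace; ring.
Qed.

(** With g = 1 - A, the terms of g^T K g that are linear and quadratic in A cancel by [anticomm] and
    [trA_skew], so g^T K g = K. Orthogonality of g makes this a commutation. *)
Lemma comm_A : K *m A = A *m K.
Proof.
have gKg : (1%:M - A)^T *m K *m (1%:M - A) = K.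
  rewrite [(1%:M - A)^T]raddfB /= trmx1 mulmxBr mulmx1 mulmxBl mul1mx mulmxBl trA_skew -(anticomm A_wedge).
  rewrite [K *m A + _]addrC opprB addrA; by rewrite !addrA; apply/matrixP => i j; rewrite !mxE; ring.
have ggt : (1%:M - A) *m (1%:M - A)^T = 1%:M.
  rewrite [(1%:M - A)^T]raddfB /= trmx1 mulmxBr mulmx1 mulmxBl mul1mx AAt.
  by apply/matrixP => i j; rewrite !mxE; ring.
have : (1%:M - A) *m K = K *m (1%:M - A).
  by rewrite -{1}gKg !mulmxA ggt mul1mx.
by rewrite mulmxBl mulmxBr mul1mx mulmx1 => /addrI/oppr_inj.
Qed.

Lemma comm_At : K *m A^T = A^T *m K.
Proof.
have := congr1 trmx comm_A; rewrite !trmx_mul K_skew mulmxN mulNmx.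
by move/oppr_inj => <-.
Qed.

Lemma sg_skew : sg *m K = t *: K.
Proof. by rewrite -(anticomm A_wedge) mulmxDl comm_A. Qed.

Lemma skew_sg : K *m sg = t *: K.
Proof. by rewrite -sg_skew mulmxDl mulmxDr comm_A comm_At. Qed.

Lemma p_comm : K *m p = p *m K.
Proof. by rewrite mulmxBr mulmxBl comm_A comm_At. Qed.

Lemma s_sym x y : s x y = s y x.
Proof.
have /matrixP/(_ x y) : s^T = s; last by rewrite mxE => ->.
by rewrite trmx_mul K_skew -p_comm mulNmx -mulmxN [p^T]raddfB /= trmxK opprB.
Qed.

Lemma pE x y : p x y = A x y - A y x.
Proof. by rewrite !mxE. Qed.

Lemma p_skewE x y : p x y = - p y x.
Proof. by rewrite !pE opprB. Qed.

Lemma sgE x y : sg x y = A x y + A y x.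
Proof. by rewrite !mxE. Qed.

Lemma sg_symE x y : sg x y = sg y x.
Proof. by rewrite !sgE addrC. Qed.

(* The octahedron argument: the pair symmetry of a curvature tensor. *)
Lemma p_swap x y z w : p x y * K z w = p z w * K x y.
Proof.
apply: mul_2I; apply/eqP; rewrite -subr_eq0; apply/eqP.
transitivity ((p x y * K z w + p x z * K w y + p x w * K y z)
  - (p y x * K z w + p y z * K w x + p y w * K x z)
  - (p z x * K y w + p z y * K w x + p z w * K x y)
  + (p w x * K y z + p w y * K z x + p w z * K x y)); last by rewrite !p_wedge; ring.
rewrite (p_skewE y x) (p_skewE z x) (p_skewE z y) (p_skewE w x) (p_skewE w y) (p_skewE w z).
rewrite (skewE w y) (skewE w x) (skewE z x); ring.
Qed.

Lemma s_wedge b k l y : wedge0 b ->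
  b y * s k l - b l * s k y = (\sum_j p k j * b j) * K y l.
Proof.
move=> bP; rewrite !mxE !mulr_sumr -sumrB mulr_suml; apply: eq_bigr => j _.
apply/eqP; rewrite -subr_eq0; apply/eqP.
rewrite -[RHS](mulr0 (p k j)) -(bP y j l).
rewrite (skewE j y) (skewE l y); ring.
Qed.

(** For a rotation by theta in a plane, the block of A has trace and determinant t = 2 - 2 cos
    theta, and A + A^T is t times the projection. The relation is then Cayley-Hamilton for this 2 by
    2 block. *)
Lemma sqrA_mul_skew k x y l :
  (A *m A) k x * K y l = (t * A k x - sg k x) * K y l.
Proof.
have e1 : (t * A k x - (A *m A) k x) * K y l
   = A k y * (K *m A) x l - A k l * (K *m A) x y.
  transitivity (\sum_j (A k x * A j j - A k j * A j x) * K y l).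
    rewrite -mulr_suml; congr (_ * _); rewrite sumrB -mulr_sumr [in RHS]mulrC; congr (_ - _).
    by rewrite mxE.
  transitivity (\sum_j (A k y * A j l - A k l * A j y) * K x j).
    by apply: eq_bigr => j _; apply: wedge_swap.
  rewrite !mxE !mulr_sumr -sumrB; apply: eq_bigr => j _; ring.
have KA u v : (K *m A) u v *+ 2 = t * K u v + s u v.
  have /matrixP/(_ u v) : K *m A *+ 2 = t *: K + s.
    rewrite -skew_sg -p_comm mulmxDr mulmxBr mulr2n. by rewrite addrACA subrr addr0.
  by rewrite !mxE.
have e2 : A k y * s x l - A k l * s x y = (- (A *m A) k x + sg k x) * K y l.
  rewrite (s_wedge _ _ _ (A_wedge k)); congr (_ * _).
  transitivity ((A *m p^T) k x); first by rewrite !mxE; apply: eq_bigr => j _; rewrite !mxE; ring.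
  by rewrite [p^T]raddfB /= trmxK mulmxBr AAt !mxE; ring.
have e3 := A_wedge k y x l.
apply/eqP; rewrite -subr_eq0; apply/eqP.
(* As 2 A is the sum of A + A^T and p, [KA] expresses twice [e1] by K and p K; [e2] removes p K, and
   t times [e3] gathers the remaining terms. *)
transitivity (- (((t * A k x - (A *m A) k x) * K y l) *+ 2 - (A k y * ((K *m A) x l *+ 2) - A k l * ((K *m A) x y *+ 2))) - ((A k y * s x l - A k l * s x y) - (- (A *m A) k x + sg k x) * K y l) - t * (A k y * K x l + A k x * K l y + A k l * K y x)).
  rewrite !KA; move: (sg k x) (s x l) (s x y) ((A *m A) k x) => a b c d.
  rewrite (skewE l y) (skewE x l) (skewE y x); ring.
by rewrite e1 e2 e3; ring.
Qed.

(** In the model of a plane rotation p^2 is -4 (sin theta)^2 = t (t - 4) times the projection: this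
    is the origin of t - 4 below. *)
Lemma sqr_p_mul_skew k x y l : (p *m p) k x * K y l = (t - 4) * sg k x * K y l.
Proof.
have -> : (p *m p) k x = (A *m A) k x + (A *m A) x k - sg k x *+ 2.
  have -> : p *m p = A *m A + (A *m A)^T - sg *+ 2.
    rewrite mulmxBl !mulmxBr AtA AAt trmx_mul.
    by apply/matrixP => i j; rewrite !mxE; ring.
  by rewrite !mxE; congr (_ + _ - _); apply: eq_bigr => j _; rewrite !mxE.
rewrite !mulrDl !sqrA_mul_skew !sgE; ring.
Qed.

Lemma p_sg_mul_skew k x y l : (p *m sg) k x * K y l = t * p k x * K y l.
Proof.
have -> : (p *m sg) k x = (A *m A) k x - (A *m A) x k.
  have -> : p *m sg = A *m A - (A *m A)^T.
    rewrite mulmxBl !mulmxDr AtA AAt trmx_mul.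
    by apply/matrixP => i j; rewrite !mxE; ring.
  by rewrite !mxE; congr (_ - _); apply: eq_bigr => j _; rewrite !mxE.
rewrite mulrBl !sqrA_mul_skew !sgE pE; ring.
Qed.

Lemma skew_p_contract x y : \sum_q s x q * p q y = t * (t - 4) * K x y.
Proof.
transitivity (((p *m p) *m K) x y).
  have -> : p *m p *m K = s *m p by rewrite -[RHS]mulmxA p_comm mulmxA.
  by rewrite [RHS]mxE.
rewrite mxE (eq_bigr _ (fun u _ => sqr_p_mul_skew x u u y)).
have /matrixP/(_ x y) := sg_skew; rewrite !mxE => e.
transitivity ((t - 4) * \sum_j sg x j * K j y); last by rewrite e; ring.
by rewrite mulr_sumr; apply: eq_bigr => j _; ring.
Qed.

Lemma skew_sg_contract x y : \sum_q s x q * sg q y = t * s x y.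
Proof.
transitivity ((p *m (K *m sg)) x y); first by rewrite mulmxA mxE.
by rewrite skew_sg -scalemxAr mxE.
Qed.

Lemma s_wedge_p k x y l :
  p x y * s k l - p x l * s k y = - ((t - 4) * sg k x * K y l).
Proof.
rewrite (s_wedge _ _ _ (p_wedge x)) -sqr_p_mul_skew -mulNr; congr (_ * _).
by rewrite mxE -sumrN; apply: eq_bigr => j _; rewrite (p_skewE x); ring.
Qed.

Lemma s_wedge_sg k x y l :
  sg x y * s k l - sg x l * s k y = t * p k x * K y l.
Proof.
rewrite (s_wedge _ _ _ (sg_wedge x)) -p_sg_mul_skew; congr (_ * _).
by rewrite mxE; apply: eq_bigr => j _; rewrite (sg_symE x).
Qed.

(** Inside tr (p K), [p_swap] exchanges the summed pair of indices with the free one, and tr (p^2)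
    K_xy appears. *)
Lemma p_trs x y : p x y * \tr s = t * (t - 4) *+ 2 * K x y.
Proof.
transitivity (\sum_k (p *m p) k k * K x y).
  rewrite /mxtrace mulr_sumr; apply: eq_bigr => k _.
  rewrite [s k k]mxE [(p *m p) k k]mxE mulr_sumr mulr_suml.
  apply: eq_bigr => j _; rewrite mulrCA p_swap; exact: mulrA.
rewrite (eq_bigr _ (fun k _ => sqr_p_mul_skew k k x y)) -mulr_suml -mulr_sumr; congr (_ * _).
have -> : \sum_i sg i i = t *+ 2.
  by rewrite /mxtrace -sumrMnl; apply: eq_bigr => i _; rewrite sgE mulr2n.
ring.
Qed.

Lemma sg_trs x y : sg x y * \tr s = (t * s x y) *+ 2.
Proof.
have : \sum_k (sg x y * s k k - sg x k * s k y) = \sum_k t * p k x * K y k.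
  by apply: eq_bigr => k _; apply: s_wedge_sg.
have -> : \sum_k t * p k x * K y k = t * s x y.
  have /matrixP/(_ y x) := p_comm; rewrite -/(s y x) s_sym => <-.
  by rewrite mxE mulr_sumr; apply: eq_bigr => k _; ring.
rewrite sumrB -mulr_sumr.
have -> : \sum_i sg x i * s i y = t * s x y.
  rewrite s_sym -skew_sg_contract; apply: eq_bigr => i _.
  by rewrite (s_sym i) (sg_symE x) mulrC.
by rewrite mulr2n => /eqP; rewrite subr_eq => /eqP.
Qed.

End Relations.

(** * Distributions as a module over the regular functions *)

Section Module.
Variables (R : realType) (N : nat).
Local Notation C := R[i].
Local Notation G := (SO R N).
Local Notation OG := (regfun R N).
Local Notation D := (dist R N).
Local Notation "f \> mu" := (act_fun f mu) (at level 38, right associativity).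

Lemma act_funE (f h : OG) (mu : D) : dist_fun (f \> mu) h = dist_fun mu (f * h).
Proof. by []. Qed.

Lemma distD (mu nu : D) f : dist_fun (mu + nu) f = dist_fun mu f + dist_fun nu f.
Proof. by []. Qed.

Lemma distN (mu : D) f : dist_fun (- mu) f = - dist_fun mu f.
Proof. by []. Qed.

Lemma dist_zero f : dist_fun (0 : D) f = 0.
Proof. by []. Qed.

Lemma distZ a (mu : D) f : dist_fun (a *: mu) f = a * dist_fun mu f.
Proof. by []. Qed.

Lemma dist_sum I (r : seq I) (P : pred I) (F : I -> D) f :
  dist_fun (\sum_(i <- r | P i) F i) f = \sum_(i <- r | P i) dist_fun (F i) f.
Proof. by apply: (big_morph (fun mu : D => dist_fun mu f)). Qed.

Lemma dist_funD (mu : D) f h : dist_fun mu (f + h) = dist_fun mu f + dist_fun mu h.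
Proof. exact: (linearD (mu : {scalar OG})). Qed.

Lemma dist_funN (mu : D) f : dist_fun mu (- f) = - dist_fun mu f.
Proof. exact: (linearN (mu : {scalar OG})). Qed.

Lemma dist_fun0 (mu : D) : dist_fun mu 0 = 0.
Proof. exact: (linear0 (mu : {scalar OG})). Qed.

Lemma dist_funZ (mu : D) a f : dist_fun mu (a *: f) = a * dist_fun mu f.
Proof. exact: (linearZ_LR (mu : {scalar OG})). Qed.

Lemma dist_fun_sum (mu : D) I (r : seq I) (P : pred I) (F : I -> OG) :
  dist_fun mu (\sum_(i <- r | P i) F i) = \sum_(i <- r | P i) dist_fun mu (F i).
Proof. exact: (linear_sum (mu : {scalar OG})). Qed.

Lemma act_fun1 (mu : D) : 1 \> mu = mu.
Proof. by apply: distP => f; rewrite act_funE mul1r. Qed.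

Lemma act_funM f h (mu : D) : (f * h) \> mu = f \> h \> mu.
Proof. by apply: distP => k; rewrite !act_funE mulrCA mulrA. Qed.

Lemma act_funDl f h (mu : D) : (f + h) \> mu = f \> mu + h \> mu.
Proof. by apply: distP => k; rewrite distD !act_funE mulrDl dist_funD. Qed.

Lemma act_funDr f (mu nu : D) : f \> (mu + nu) = f \> mu + f \> nu.
Proof. exact: distP. Qed.

Lemma act_funNr f (mu : D) : f \> (- mu) = - (f \> mu).
Proof. exact: distP. Qed.

Lemma act_funNl f (mu : D) : (- f) \> mu = - (f \> mu).
Proof. by apply: distP => k; rewrite distN !act_funE mulNr dist_funN. Qed.

Lemma act_fun0 f : f \> (0 : D) = 0.
Proof. exact: distP. Qed.

Lemma act_0fun (mu : D) : 0 \> mu = 0.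
Proof. by apply: distP => k; rewrite act_funE mul0r dist_fun0. Qed.

Lemma act_fun_sumr f I (r : seq I) (P : pred I) (F : I -> D) :
  f \> (\sum_(i <- r | P i) F i) = \sum_(i <- r | P i) f \> F i.
Proof. by apply: (big_morph _ (act_funDr f) (act_fun0 f)). Qed.

Lemma act_fun_suml (mu : D) I (r : seq I) (P : pred I) (F : I -> OG) :
  (\sum_(i <- r | P i) F i) \> mu = \sum_(i <- r | P i) F i \> mu.
Proof.
by apply: (big_morph (fun f => f \> mu) (fun f h => act_funDl f h mu) (act_0fun mu)).
Qed.

(* The square zero extension O(G) + O(G)^* of O(G): identities which are linear
   in distributions become identities in a commutative ring. *)
Definition sqz : Type := (OG * D)%type.
HB.instance Definition _ := GRing.Zmodule.on sqz.

Definition sqz_mul (x y : sqz) : sqz := (x.1 * y.1, x.1 \> y.2 + y.1 \> x.2).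
Definition sqz1 : sqz := (1, 0).

Fact sqz_mulA : associative sqz_mul.
Proof.
move=> [f m] [h n] [k l]; rewrite /sqz_mul /=; congr (_, _); first exact: mulrA.
rewrite !act_funDr !act_funM addrA; congr (_ + _ + _).
  by rewrite -!act_funM mulrC.
by rewrite -!act_funM mulrC.
Qed.
Fact sqz_mulC : commutative sqz_mul.
Proof. by move=> [f m] [h n]; rewrite /sqz_mul /= mulrC addrC. Qed.
Fact sqz_mul1 : left_id sqz1 sqz_mul.
Proof. by move=> [f m]; rewrite /sqz_mul /= mul1r act_fun1 act_fun0 addr0. Qed.
Fact sqz_mulDl : left_distributive sqz_mul +%R.
Proof.
move=> [f m] [h n] [k l]; rewrite /sqz_mul /= mulrDl act_funDl act_funDr.
by congr (_, _); rewrite addrACA.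
Qed.
HB.instance Definition _ := GRing.Zmodule_isComPzRing.Build sqz
  sqz_mulA sqz_mulC sqz_mul1 sqz_mulDl.

Definition sqz_fun (f : OG) : sqz := (f, 0).
Definition sqz_dist (mu : D) : sqz := (0, mu).

Lemma sqz_fun_zmod : zmod_morphism sqz_fun.
Proof. by move=> f h; rewrite /sqz_fun; congr (_, _); rewrite /= subr0. Qed.
Lemma sqz_fun_monoid : monoid_morphism sqz_fun.
Proof.
split=> // f h; rewrite /sqz_fun [RHS]/GRing.mul /= /sqz_mul /=.
by rewrite !act_fun0 addr0.
Qed.
HB.instance Definition _ := GRing.isZmodMorphism.Build OG sqz sqz_fun sqz_fun_zmod.
HB.instance Definition _ := GRing.isMonoidMorphism.Build OG sqz sqz_fun sqz_fun_monoid.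

Lemma sqz_dist_zmod : zmod_morphism sqz_dist.
Proof. by move=> f h; rewrite /sqz_dist; congr (_, _); rewrite /= subr0. Qed.
HB.instance Definition _ := GRing.isZmodMorphism.Build D sqz sqz_dist sqz_dist_zmod.

Lemma sqz_dist_inj : injective sqz_dist.
Proof. by move=> mu nu [->]. Qed.

Lemma sqz_act f (mu : D) : sqz_fun f * sqz_dist mu = sqz_dist (f \> mu).
Proof. by rewrite /GRing.mul /= /sqz_mul /= mulr0 act_0fun addr0. Qed.

Lemma mulrSn_eq0 (x : C) n : x *+ n.+1 = 0 -> x = 0.
Proof. by move/eqP; rewrite mulrn_eq0 /= => /eqP. Qed.

Lemma regfunMnE (f : OG) n g : regfun_val (f *+ n) g = f g *+ n.
Proof. by elim: n => [//|n IH]; rewrite !mulrS regfunDE IH. Qed.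

Lemma distMnE (mu : D) n f : dist_fun (mu *+ n) f = dist_fun mu f *+ n.
Proof. by elim: n => [//|n IH]; rewrite !mulrS distD IH. Qed.

Lemma sqz_tf (x : sqz) n : x *+ n.+1 = 0 -> x = 0.
Proof.
case: x => f mu xn.
have E k : ((f, mu) : sqz) *+ k = (f *+ k, mu *+ k).
  by elim: k => [//|k IH]; rewrite !mulrS IH.
rewrite E in xn; case: xn => fn mun; congr (_, _).
  by apply: regfunP => g; apply: (@mulrSn_eq0 _ n); rewrite -regfunMnE fn.
by apply: distP => h; apply: (@mulrSn_eq0 _ n); rewrite -distMnE mun.
Qed.

Definition ev (g : G) (f : OG) : C := f g.
Lemma ev_zmod g : zmod_morphism (ev g). Proof. by []. Qed.
Lemma ev_monoid g : monoid_morphism (ev g). Proof. by []. Qed.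
HB.instance Definition _ g := GRing.isZmodMorphism.Build OG C (ev g) (@ev_zmod g).
HB.instance Definition _ g := GRing.isMonoidMorphism.Build OG C (ev g) (@ev_monoid g).

Definition entry (i j : 'I_N) : OG := mk_regfun (@regular_entry R N i j).

Definition amx : 'M[OG]_N := 1%:M - \matrix_(i, j) entry i j.

Lemma map_amx g : map_mx (ev g) amx = 1%:M - so_val g.
Proof.
rewrite map_mxB map_mx1; congr (_ - _).
by apply/matrixP => i j; rewrite !mxE.
Qed.

Lemma ev_mx_inj m n (M1 M2 : 'M[OG]_(m, n)) :
  (forall g, map_mx (ev g) M1 = map_mx (ev g) M2) -> M1 = M2.
Proof.
move=> e; apply/matrixP => i j; apply: regfunP => g.
by have /matrixP/(_ i j) := e g; rewrite !mxE.
Qed.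

Lemma amx_tr_mul : amx^T *m amx = amx + amx^T.
Proof.
apply: ev_mx_inj => g; rewrite map_mxM [in RHS](map_mxD _ amx) -map_trmx !map_amx.
rewrite [(1%:M - so_val g)^T]raddfB /= trmx1 mulmxBl !mulmxBr !mulmx1 mul1mx so_trmul.
by apply/matrixP => i j; rewrite !mxE; ring.
Qed.

Lemma amx_mul_tr : amx *m amx^T = amx + amx^T.
Proof.
apply: ev_mx_inj => g; rewrite map_mxM [in RHS](map_mxD _ amx) -map_trmx !map_amx.
rewrite [(1%:M - so_val g)^T]raddfB /= trmx1 mulmxBl !mulmxBr !mulmx1 mul1mx so_multr.
by apply/matrixP => i j; rewrite !mxE; ring.
Qed.

Lemma det_1B_amx : \det (1%:M - amx) = 1.
Proof.
apply: regfunP => g; rewrite -[LHS]/(ev g _) -det_map_mx map_mxB map_mx1 map_amx.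
by rewrite opprB addrC subrK so_det.
Qed.

Definition tau : OG := \tr amx.

(** The boolean is the parity under transposition: [true] is the skew p, [false] the symmetric A +
    A^T. Their sum is 2 A, so together they generate the functions on the group. *)
Definition bmx (b : bool) : 'M[OG]_N := if b then amx - amx^T else amx + amx^T.

Lemma bmxE1 x y : bmx true x y = amx x y - amx y x.
Proof. by rewrite /bmx [LHS]mxE [X in _ + X]mxE [amx^T x y]mxE. Qed.

Lemma bmxE0 x y : bmx false x y = amx x y + amx y x.
Proof. by rewrite /bmx [LHS]mxE [amx^T x y]mxE. Qed.

Lemma bmx_tr b x y : bmx b x y = (-1) ^+ b * bmx b y x.
Proof. by case: b; rewrite ?bmxE1 ?bmxE0 ?expr1 ?expr0; ring. Qed.

Section Class.
Variable K : 'I_N -> 'I_N -> D.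

Definition skew_fam := forall x y, K x y = - K y x.

Definition jacobi := forall u x y z,
  amx u z \> K x y + amx u x \> K y z + amx u y \> K z x = 0.

Definition sfam x y : D := \sum_j bmx true x j \> K j y.

Definition trs : D := \sum_k sfam k k.

Hypothesis K_skew : skew_fam.
Hypothesis K_jac : jacobi.

Let Kz : 'M[sqz]_N := \matrix_(i, j) sqz_dist (K i j).
Let Az : 'M[sqz]_N := map_mx sqz_fun amx.

Let AzE i j : Az i j = sqz_fun (amx i j). Proof. exact: mxE. Qed.
Let KzE i j : Kz i j = sqz_dist (K i j). Proof. exact: mxE. Qed.

Let Kz_skew : Kz^T = - Kz.
Proof. by apply/matrixP => i j; rewrite mxE [RHS]mxE !KzE K_skew raddfN. Qed.

Let AzK u : wedge0 Kz (Az u).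
Proof.
move=> x y z; rewrite !AzE !KzE !sqz_act -!raddfD /= addrC addrA K_jac.
exact: raddf0.
Qed.

Let AtA : Az^T *m Az = Az + Az^T.
Proof. by rewrite map_trmx -map_mxM amx_tr_mul map_mxD. Qed.
Let AAt : Az *m Az^T = Az + Az^T.
Proof. by rewrite map_trmx -map_mxM amx_mul_tr map_mxD. Qed.
Let detAz : \det (1%:M - Az) = 1.
Proof. by rewrite -(map_mx1 sqz_fun) -map_mxB det_map_mx det_1B_amx rmorph1. Qed.
Let trAz : \tr Az = sqz_fun tau.
Proof. by rewrite trace_map_mx. Qed.

Let bmxz b x y : sqz_fun (bmx b x y) = (if b then Az - Az^T else Az + Az^T) x y.
Proof.
have tE : Az^T x y = sqz_fun (amx y x) by rewrite mxE AzE.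
case: b; rewrite [RHS]mxE AzE.
  by rewrite [X in _ = _ + X]mxE tE -raddfB bmxE1.
by rewrite tE -raddfD bmxE0.
Qed.

Let sz x y : sqz_dist (sfam x y) = ((Az - Az^T) *m Kz) x y.
Proof.
rewrite raddf_sum mxE /=; apply: eq_bigr => j _.
by rewrite -sqz_act (bmxz true) KzE.
Qed.

Let trz : sqz_dist trs = \tr ((Az - Az^T) *m Kz).
Proof. by rewrite raddf_sum; apply: eq_bigr => k _; exact: sz. Qed.

Lemma sfam_sym x y : sfam x y = sfam y x.
Proof. by apply: sqz_dist_inj; rewrite !sz; apply: (s_sym sqz_tf Kz_skew AAt detAz AzK). Qed.

Lemma bmx_mul_fam b x y :
  \sum_u bmx b x u \> K u y = if b then sfam x y else tau \> K x y.
Proof.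
case: b => //; apply: sqz_dist_inj; rewrite -sqz_act -trAz.
have /matrixP/(_ x y) := sg_skew sqz_tf Kz_skew AAt detAz AzK.
rewrite [RHS]mxE KzE => <-; rewrite mxE raddf_sum /=; apply: eq_bigr => u _.
by rewrite -(bmxz false) KzE sqz_act.
Qed.

Lemma bmx_wedge b u x y z :
  bmx b u x \> K y z + bmx b u y \> K z x + bmx b u z \> K x y = 0.
Proof.
apply: sqz_dist_inj; rewrite !raddfD /= -!sqz_act -!KzE !bmxz; case: b.
  by rewrite (p_wedge AtA AzK) [RHS]raddf0.
by rewrite (sg_wedge AtA AzK) [RHS]raddf0.
Qed.

Lemma sfam_mul_bmx b x y : \sum_q bmx b q y \> sfam x q =
  if b then (tau * (tau - 4)) \> K x y else tau \> sfam x y.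
Proof.
apply: sqz_dist_inj; rewrite raddf_sum /=.
have -> : \sum_i sqz_dist (bmx b i y \> sfam x i) = \sum_q ((Az - Az^T) *m Kz) x q * sqz_fun (bmx b q y).
  by apply: eq_bigr => q _; rewrite -sqz_act sz mulrC.
under eq_bigr do rewrite bmxz.
case: b; rewrite -sqz_act ?rmorphM ?rmorphB ?rmorph_nat /= -?trAz.
  by rewrite -KzE (skew_p_contract sqz_tf Kz_skew AtA AAt detAz AzK).
by rewrite sz (skew_sg_contract sqz_tf Kz_skew AAt detAz AzK).
Qed.

Lemma sfam_swap b x y k l :
  bmx b x y \> sfam k l - bmx b x l \> sfam k y =
  (if b then 4 - tau else tau) \> bmx (~~ b) k x \> K y l.
Proof.
apply: sqz_dist_inj; rewrite raddfB /= -!sqz_act !sz -KzE !bmxz.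
case: b; rewrite ?rmorphB ?rmorph_nat /= -?trAz.
  by rewrite (s_wedge_p sqz_tf Kz_skew AtA AAt detAz AzK); ring.
by rewrite (s_wedge_sg sqz_tf Kz_skew AtA AAt detAz AzK); ring.
Qed.

Lemma bmx_trs b x y : bmx b x y \> trs =
  (if b then (tau * (tau - 4)) \> K x y else tau \> sfam x y) *+ 2.
Proof.
apply: sqz_dist_inj; rewrite raddfMn /= -!sqz_act trz bmxz.
case: b; rewrite -sqz_act ?rmorphM ?rmorphB ?rmorph_nat /= -?trAz.
  by rewrite (p_trs sqz_tf Kz_skew AtA AAt detAz AzK) KzE mulrnAl.
by rewrite (sg_trs sqz_tf Kz_skew AtA AAt detAz AzK) sz.
Qed.

End Class.
End Module.

(** * Rotations supported on two vectors *)

Section Rotations.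
Variables (R : realType) (N : nat).
Local Notation C := R[i].
Local Notation V := 'cV[C]_N.
Local Notation G := (SO R N).

Lemma mxE_mul_form (x y z : V) : z *m (x^T *m y) = so_form x y *: z.
Proof. by rewrite (mx11_scalar (x^T *m y)) mul_mx_scalar. Qed.

Lemma so_formC (x y : V) : so_form x y = so_form y x.
Proof.
have e : x^T *m y = (y^T *m x)^T by rewrite trmx_mul trmxK.
by rewrite /so_form e mxE.
Qed.

Definition bivec (x y : V) : 'M[C]_N := x *m y^T - y *m x^T.

Definition gram (x y : V) : C := so_form x x * so_form y y - so_form x y ^+ 2.

Lemma bivec_tr x y : (bivec x y)^T = - bivec x y.
Proof. by rewrite /bivec raddfB /= !trmx_mul !trmxK opprB. Qed.

Lemma bivec_swap x y : bivec y x = - bivec x y.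
Proof. by rewrite /bivec opprB. Qed.

Lemma bivec_mul x y (z : V) : bivec x y *m z = so_form y z *: x - so_form x z *: y.
Proof. by rewrite mulmxBl -!mulmxA !mxE_mul_form. Qed.

(** The image of [bivec x y] is spanned by x and y, and on both of them its square is the scalar
    [- gram x y]. *)
Lemma bivec_cube x y :
  bivec x y *m bivec x y *m bivec x y = - gram x y *: bivec x y.
Proof.
have Ex : bivec x y *m bivec x y *m x = - gram x y *: x.
  rewrite -mulmxA [bivec x y *m x]bivec_mul mulmxBr -!scalemxAr !bivec_mul (so_formC y x) /gram.
  by apply/matrixP => i j; rewrite !mxE; ring.
have Ey : bivec x y *m bivec x y *m y = - gram x y *: y.
  rewrite -mulmxA [bivec x y *m y]bivec_mul mulmxBr -!scalemxAr !bivec_mul (so_formC y x) /gram.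
  by apply/matrixP => i j; rewrite !mxE; ring.
rewrite {3}/bivec mulmxBr !mulmxA Ex Ey -!scalemxAl -scalerBr //.
Qed.

Section Quadratic.
Variables (w : 'M[C]_N) (n : C).
Hypothesis w3 : w *m w *m w = - n *: w.

Definition quad (a b c : C) : 'M[C]_N := a%:M + b *: w + c *: (w *m w).

Lemma quad_mul a b c a' b' c' : quad a b c *m quad a' b' c' =
  quad (a * a') (a * b' + b * a' - n * (b * c' + c * b'))
    (a * c' + b * b' + c * a' - n * (c * c')).
Proof.
have w3' : w *m (w *m w) = - n *: w by rewrite mulmxA.
have w4 : w *m w *m (w *m w) = - n *: (w *m w) by rewrite mulmxA w3 -scalemxAl.
rewrite /quad !mulmxDl !mulmxDr !mul_scalar_mx !mul_mx_scalar.
rewrite -!scalemxAl -!scalemxAr w3 w3' w4 ?scale_scalar_mx.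
by move: (w *m w) => w2; apply/matrixP => i j; rewrite !mxE; ring.
Qed.

Lemma quad1 : quad 1 0 0 = 1%:M.
Proof. by rewrite /quad !scale0r !addr0. Qed.

Hypothesis w_skew : w^T = - w.

Lemma quad_tr a b c : (quad a b c)^T = quad a (- b) c.
Proof.
rewrite /quad !raddfD /= tr_scalar_mx !linearZ /= trmx_mul w_skew.
by rewrite mulNmx mulmxN opprK scalerN scaleNr.
Qed.
End Quadratic.

(** Rodrigues' formula in the half angle phi: for a = cos phi and a bivector of norm sin phi it is
    the rotation by 2 phi. In this form it is polynomial in a, x and y. *)
Definition rot_mx (a : C) (x y : V) := quad (bivec x y) 1 (2 * a) 2.

Lemma quad_opp w a b c : quad (- w) a b c = quad w a (- b) c.
Proof. by rewrite /quad mulNmx mulmxN opprK scalerN scaleNr. Qed.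

Lemma rot_mx_so a x y : a ^+ 2 + gram x y = 1 -> so_pred (rot_mx a x y).
Proof.
move=> an; have nE : gram x y = 1 - a ^+ 2 by rewrite -an addrC addKr.
have w3 := bivec_cube x y; have ws := bivec_tr x y.
apply/andP; split.
  rewrite /rot_mx quad_tr // (quad_mul w3) nE -(quad1 (bivec x y)).
  by apply/eqP; congr (quad _ _ _ _); ring.
(* The pairs (a, w) and (-a, -w) give the same rotation, and exchanging x with y changes the sign of
   w; thus a = -1 reduces to a = 1. *)
wlog an1 : a x y an nE w3 ws / a + 1 != 0.
  move=> hw; have [a1|] := eqVneq (a + 1) 0; last exact: hw.
  have aE : a = -1 by apply/eqP; rewrite -addr_eq0 a1.
  have g0 : gram x y = gram y x by rewrite /gram (so_formC y x) mulrC.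
  have -> : rot_mx a x y = rot_mx 1 y x.
    by rewrite /rot_mx bivec_swap quad_opp aE mulr1 mulrN1 opprK.
  apply: hw.
  - by rewrite -g0 nE aE; ring.
  - by rewrite -g0 nE aE; ring.
  - exact: bivec_cube.
  - exact: bivec_tr.
  - by rewrite -mulr2n pnatr_eq0.
pose k := (a + 1)^-1.
have kE : k * (a + 1) = 1 by rewrite mulVf.
(* The rotation by half the angle: 1 + w + (1 - cos phi) (w / sin phi)^2, with 1 - cos phi = (sin
   phi)^2 / (1 + cos phi). Since [rot_mx] is its square, the determinant is det (h^T h) = 1. *)
pose h := quad (bivec x y) 1 1 k.
have hh : h *m h = rot_mx a x y.
  rewrite /h (quad_mul w3) nE; congr (quad _ _ _ _).
  - ring.
  - transitivity (2 - 2 * (k * (a + 1)) * (1 - a)); first by ring.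
    by rewrite kE; ring.
  - transitivity (1 + 2 * k - (k * (a + 1)) * (1 - a) * k); first by ring.
    rewrite kE; transitivity (1 + k * (a + 1)); first by ring.
    by rewrite kE.
have ht : h^T *m h = 1%:M.
  rewrite /h quad_tr // (quad_mul w3) nE -(quad1 (bivec x y)); congr (quad _ _ _ _).
  - ring.
  - ring.
  - transitivity (2 * k - 1 - (k * (a + 1)) * (1 - a) * k); first by ring.
    rewrite kE; transitivity (k * (a + 1) - 1); first by ring.
    by rewrite kE subrr.
by rewrite -hh det_mulmx -[X in X * _]det_tr -det_mulmx ht det1.
Qed.

Definition rot a x y (h : a ^+ 2 + gram x y = 1) : G := MkSO (rot_mx_so h).

Definition nilp (u v : V) := so_form u u = 0 /\ so_form u v = 0.

Lemma so_formZl c (x y : V) : so_form (c *: x) y = c * so_form x y.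
Proof. by rewrite /so_form linearZ /= -scalemxAl mxE. Qed.

Lemma nilp_gram u v (s : C) : nilp u v -> 1 ^+ 2 + gram ((s / 2) *: u) v = 1.
Proof.
move=> [uu uv]; have e : so_form ((s / 2) *: u) ((s / 2) *: u) = 0.
  by rewrite so_formZl so_formC so_formZl uu; ring.
rewrite /gram e so_formZl uv; ring.
Qed.

(** For [u] isotropic and orthogonal to [v] the Gram determinant vanishes, the bivector has cube 0
    and the rotation is its exponential, polynomial in s. Derivatives along such subgroups need no
    analysis. *)
Lemma rot_nilp u v s : nilp u v -> rot_mx 1 ((s / 2) *: u) v =
  1%:M + s *: bivec u v + (s ^+ 2 / 2) *: (bivec u v *m bivec u v).
Proof.
have n2 : (2 : C) != 0 by rewrite pnatr_eq0.
move=> nuv; rewrite /rot_mx /quad.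
have -> : bivec ((s / 2) *: u) v = (s / 2) *: bivec u v.
  by rewrite /bivec linearZ /= -scalemxAl -scalemxAr scalerBr.
rewrite -scalemxAl -scalemxAr !scalerA; congr (_ + _ *: _ + _ *: _).
  by rewrite mulr1 mulrC divfK.
by rewrite mulrA mulrC mulrA; field.
Qed.
End Rotations.

(** * Infinitesimal invariance *)

Section FirstOrder.
Variables (R : realType) (N : nat).
Local Notation C := R[i].
Local Notation OG := (regfun R N).
Local Notation D := (dist R N).

Inductive poly_family : (C -> OG) -> Prop :=
| poly_family0 : poly_family (fun=> 0)
| poly_familyD F H : poly_family F -> poly_family H -> poly_family (fun s => F s + H s)
| poly_family_mon m f : poly_family (fun s => s ^+ m *: f).

Lemma regfun_scaleA (a : C) (f h : OG) : a *: f * h = a *: (f * h).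
Proof. by apply: regfunP => g; rewrite regfunME !regfunZE regfunME mulrA. Qed.

Lemma poly_family_eq F H : F =1 H -> poly_family F -> poly_family H.
Proof. by move=> /funext ->. Qed.

Lemma poly_familyZ (m : nat) F : poly_family F -> poly_family (fun s => s ^+ m *: F s).
Proof.
elim=> [|F1 F2 _ IH1 _ IH2|k f].
- by apply: poly_family_eq poly_family0 => s; rewrite scaler0.
- by apply: poly_family_eq (poly_familyD IH1 IH2) => s; rewrite scalerDr.
- by apply: poly_family_eq (poly_family_mon (m + k) f) => s; rewrite scalerA exprD.
Qed.

Lemma poly_family_scale (a : C) F : poly_family F -> poly_family (fun s => a *: F s).
Proof.
elim=> [|F1 F2 _ IH1 _ IH2|k f].
- by apply: poly_family_eq poly_family0 => s; rewrite scaler0.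
- by apply: poly_family_eq (poly_familyD IH1 IH2) => s; rewrite scalerDr.
- apply: poly_family_eq (poly_family_mon k (a *: f)) => s.
  by rewrite !scalerA mulrC.
Qed.

Lemma poly_family_cst f : poly_family (fun=> f).
Proof. by apply: poly_family_eq (poly_family_mon 0 f) => s; rewrite scale1r. Qed.

Lemma poly_familyM F H : poly_family F -> poly_family H -> poly_family (fun s => F s * H s).
Proof.
move=> + hH; elim=> [|F1 F2 _ IH1 _ IH2|k f].
- by apply: poly_family_eq poly_family0 => s; rewrite mul0r.
- by apply: poly_family_eq (poly_familyD IH1 IH2) => s; rewrite mulrDl.
- elim: hH => [|F1 F2 _ IH1 _ IH2|l h].
  + by apply: poly_family_eq poly_family0 => s; rewrite mulr0.
  + by apply: poly_family_eq (poly_familyD IH1 IH2) => s; rewrite mulrDr.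
  + apply: poly_family_eq (poly_family_mon (k + l) (f * h)) => s.
    by apply: regfunP => g; rewrite !(regfunZE, regfunME) exprD; ring.
Qed.

Lemma poly_family_dist (mu : D) F : poly_family F ->
  exists P : {poly C}, forall s, dist_fun mu (F s) = P.[s].
Proof.
elim=> [|F1 F2 _ [P1 e1] _ [P2 e2]|k f].
- by exists 0 => s; rewrite horner0 dist_fun0.
- by exists (P1 + P2) => s; rewrite hornerD dist_funD e1 e2.
- exists ((dist_fun mu f) *: 'X^k) => s.
  by rewrite dist_funZ hornerZ hornerXn mulrC.
Qed.

(** [f'] is the derivative at s = 0; the remainder is required to be polynomial in s, so that any
    distribution, without continuity, can be applied to it. *)
Definition first_order (f f' : OG) (F : C -> OG) : Prop :=
  exists2 r, poly_family r & forall s, F s = f + s *: f' + s ^+ 2 *: r s.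

Lemma first_order_eq f f' F H : F =1 H -> first_order f f' F -> first_order f f' H.
Proof. by move=> /funext ->. Qed.

Lemma first_order_cst f : first_order f 0 (fun=> f).
Proof. by exists (fun=> 0); [exact: poly_family0 | move=> s; rewrite !scaler0 !addr0]. Qed.

Lemma first_orderD f f' F h h' H : first_order f f' F -> first_order h h' H ->
  first_order (f + h) (f' + h') (fun s => F s + H s).
Proof.
move=> [r rP Fr] [q qP Hq]; exists (fun s => r s + q s); first exact: poly_familyD.
by move=> s; rewrite Fr Hq !scalerDr; ring.
Qed.

Lemma first_order_sum (I : finType) (f f' : I -> OG) (F : I -> C -> OG) :
  (forall i, first_order (f i) (f' i) (F i)) ->
  first_order (\sum_i f i) (\sum_i f' i) (fun s => \sum_i F i s).
Proof.
move=> FP; elim: (index_enum I) => [|i r IH].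
  rewrite !big_nil; apply: first_order_eq (first_order_cst 0) => s.
  by rewrite big_nil.
rewrite !big_cons; apply: first_order_eq (first_orderD (FP i) IH) => s.
by rewrite big_cons.
Qed.

Lemma first_orderM f f' F h h' H : first_order f f' F -> first_order h h' H ->
  first_order (f * h) (f' * h + f * h') (fun s => F s * H s).
Proof.
move=> [r rP Fr] [q qP Hq].
exists (fun s => f' * h' + (f * q s + s ^+ 1 *: (f' * q s)) + (r s * h + s ^+ 1 *: (r s * h')
    + s ^+ 2 *: (r s * q s))).
  apply: poly_familyD; first apply: poly_familyD.
  - exact: poly_family_cst.
  - apply: poly_familyD; first exact: poly_familyM (poly_family_cst f) qP.
    exact/poly_familyZ/(poly_familyM (poly_family_cst f') qP).
  - apply: poly_familyD; last exact/poly_familyZ/poly_familyM.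
    apply: poly_familyD; first exact: poly_familyM rP (poly_family_cst h).
    exact/poly_familyZ/(poly_familyM rP (poly_family_cst h')).
move=> s; rewrite Fr Hq; apply: regfunP => g.
rewrite !(regfunDE, regfunME, regfunZE); ring.
Qed.

(** The scalar a + s b + s^2 c has the shape of an entry of a unipotent rotation. *)
Lemma first_order_scale (a b c : C) f f' F : first_order f f' F ->
  first_order (a *: f) (b *: f + a *: f') (fun s => (a + s * b + s ^+ 2 * c) *: F s).
Proof.
move=> [r rP Fr].
exists (fun s => (c *: f + (b *: f' + s ^+ 1 *: (c *: f'))) + (a *: r s + s ^+ 1 *: (b *: r s)
   + s ^+ 2 *: (c *: r s))).
  apply: poly_familyD; first apply: poly_familyD.
  - exact: poly_family_cst.
  - apply: poly_familyD; first exact: poly_family_cst.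
    exact/poly_familyZ/poly_family_cst.
  - apply: poly_familyD; last exact/poly_familyZ/poly_family_scale.
    apply: poly_familyD; first exact: poly_family_scale.
    exact/poly_familyZ/poly_family_scale.
move=> s; rewrite Fr; apply: regfunP => g.
rewrite !(regfunDE, regfunME, regfunZE); ring.
Qed.

Lemma poly_horner_inf (P : {poly C}) : (forall n : nat, P.[n.+1%:R] = 0) -> P = 0.
Proof.
move=> P0; apply/eqP/negPn/negP => Pn0.
pose rs := [seq n.+1%:R : C | n <- iota 0 (size P)].
have := @max_poly_roots _ P rs Pn0; rewrite size_map size_iota ltnn.
have -> : all (root P) rs by apply/allP => _ /mapP[n _ ->]; rewrite /root P0.
have -> : uniq rs.
  rewrite map_inj_uniq ?iota_uniq // => m n /eqP.
  by rewrite eqr_nat eqSS => /eqP.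
by move/(_ isT isT).
Qed.

(** The sum of the pairings is a polynomial in s; being constant on an infinite set, it has no
    linear coefficient. *)
Lemma first_order_const (I : finType) (mu : I -> D) (f f' : I -> OG) (F : I -> C -> OG) (a : C) :
  (forall i, first_order (f i) (f' i) (F i)) ->
  (forall s, \sum_i dist_fun (mu i) (F i s) = a) -> \sum_i dist_fun (mu i) (f' i) = 0.
Proof.
move=> FP Fa.
have [P PE] : exists P : {poly C}, forall s, \sum_i dist_fun (mu i) (F i s) =
    \sum_i dist_fun (mu i) (f i) + s * \sum_i dist_fun (mu i) (f' i) + s ^+ 2 * P.[s].
  elim: (index_enum I) => [|i r [P PE]].
    by exists 0 => s; rewrite !big_nil horner0; ring.
  have [q qP FE] := FP i; have [Q QE] := poly_family_dist (mu i) qP.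
  exists (Q + P) => s; rewrite !big_cons PE hornerD FE !dist_funD !dist_funZ QE; ring.
pose b := \sum_i dist_fun (mu i) (f' i).
have a0 : \sum_i dist_fun (mu i) (f i) = a.
  by rewrite -(Fa 0) PE; ring.
have Q0 : b%:P + 'X * P = 0.
  apply: poly_horner_inf => n; rewrite hornerD hornerC hornerM hornerX.
  have := PE n.+1%:R; rewrite Fa a0 -/b => e.
  have nz : (n.+1%:R : C) != 0 by rewrite pnatr_eq0.
  apply: (mulfI nz); rewrite mulr0.
  transitivity (a + n.+1%:R * b + n.+1%:R ^+ 2 * P.[n.+1%:R] - a); first by ring.
  by rewrite -e subrr.
have := congr1 (fun Q : {poly C} => Q.[0]) Q0.
by rewrite hornerD hornerC hornerM hornerX mul0r addr0 horner0.
Qed.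
End FirstOrder.

(** * Equivariance under one-parameter groups of rotations *)

Section Infinitesimal.
Variables (R : realType) (N : nat).
Local Notation C := R[i].
Local Notation V := 'cV[C]_N.
Local Notation G := (SO R N).
Local Notation OG := (regfun R N).
Local Notation D := (dist R N).
Local Notation bmx := (@bmx R N).
Local Notation amx := (@amx R N).

Lemma conj_funM g (f h : OG) : conj_fun g (f * h) = conj_fun g f * conj_fun g h.
Proof. exact: regfunP. Qed.

Lemma map_amx_conj (g h : G) : map_mx (ev (g * (h * g^-1))%g) amx =
  so_val g *m map_mx (ev h) amx *m (so_val g)^T.
Proof.
rewrite !map_amx mulmxBr mulmxBl mulmx1 so_multr; congr (_ - _).
by rewrite /= mulmxA.
Qed.

Lemma map_bmx b (h : G) : map_mx (ev h) (bmx b) =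
  if b then map_mx (ev h) amx - (map_mx (ev h) amx)^T
  else map_mx (ev h) amx + (map_mx (ev h) amx)^T.
Proof.
case: b; first by rewrite /bmx (map_mxB _ amx) map_trmx.
by rewrite /bmx (map_mxD _ amx) map_trmx.
Qed.

Lemma conj_bmx g b i j : conj_fun g (bmx b i j) =
  \sum_p so_val g i p *: \sum_q so_val g j q *: bmx b p q.
Proof.
apply: regfunP => h; rewrite -[LHS]/(ev (g * (h * g^-1))%g (bmx b i j)).
rewrite -[RHS]/(ev h _) raddf_sum /=.
have -> : ev (g * (h * g^-1))%g (bmx b i j) = map_mx (ev (g * (h * g^-1))%g) (bmx b) i j.
  by rewrite mxE.
have -> : map_mx (ev (g * (h * g^-1))%g) (bmx b) = so_val g *m map_mx (ev h) (bmx b) *m (so_val g)^T.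
  rewrite !map_bmx map_amx_conj !trmx_mul trmxK mulmxA.
  by case: b; rewrite ?mulmxBr ?mulmxBl ?mulmxDr ?mulmxDl.
rewrite mxE; under [LHS]eq_bigr do rewrite mxE mulr_suml.
rewrite exchange_big /=; apply: eq_bigr => p _.
rewrite -[RHS]/(so_val g i p * ev h _) raddf_sum /= mulr_sumr.
apply: eq_bigr => q _; rewrite [(so_val g)^T _ _]mxE [map_mx _ _ p q]mxE.
by rewrite -[RHS]/(so_val g i p * (so_val g j q * ev h (bmx b p q))); ring.
Qed.

Lemma conj_tau g : conj_fun g (tau R N) = tau R N.
Proof.
apply: regfunP => h; rewrite -[LHS]/(ev (g * (h * g^-1))%g (tau R N)) -[RHS]/(ev h (tau R N)).
rewrite /tau -!trace_map_mx map_amx_conj -mulmxA mxtrace_mulC -mulmxA so_trmul.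
by rewrite mulmx1.
Qed.

Local Notation block := (bool * ('I_N * 'I_N))%type.

Definition blk (b : block) : OG := bmx b.1 b.2.1 b.2.2.
Definition mon (bs : seq block) : OG := \prod_(b <- bs) blk b.

Lemma mon_cons b bs : mon (b :: bs) = blk b * mon bs.
Proof. exact: big_cons. Qed.

Lemma mon_cat bs cs : mon (bs ++ cs) = mon bs * mon cs.
Proof. exact: big_cat. Qed.

(* The derivatives at s = 0 along g = 1 + s X + ... *)
Definition dblk (X : 'M[C]_N) (b : block) : OG :=
  \sum_q (X b.2.1 q *: bmx b.1 q b.2.2 + X b.2.2 q *: bmx b.1 b.2.1 q).

Fixpoint dmon X (bs : seq block) : OG :=
  if bs is b :: bs' then dblk X b * mon bs' + blk b * dmon X bs' else 0.

Lemma sum_delta_scale (i : 'I_N) (F : 'I_N -> OG) :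
  \sum_p (i == p)%:R *: F p = F i.
Proof.
rewrite (bigD1 i) //= eqxx scale1r big1 ?addr0 // => p pi.
by rewrite eq_sym (negbTE pi) scale0r.
Qed.

Lemma first_order_conj (X Y : 'M[C]_N) (g : C -> G) bs :
  (forall s, so_val (g s) = 1%:M + s *: X + s ^+ 2 *: Y) ->
  first_order (mon bs) (dmon X bs) (fun s => conj_fun (g s) (mon bs)).
Proof.
move=> gE.
have gE' s i p : so_val (g s) i p = (i == p)%:R + s * X i p + s ^+ 2 * Y i p.
  by rewrite gE !mxE.
elim: bs => [|[b [i j]] bs IH] /=.
  rewrite /mon big_nil; apply: first_order_eq (first_order_cst 1) => s.
  exact: regfunP.
rewrite mon_cons.
apply: first_order_eq (fun s => esym (conj_funM (g s) _ _)) _.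
apply: first_orderM IH.
have h : first_order
   (\sum_p (i == p)%:R *: \sum_q (j == q)%:R *: bmx b p q)
   (\sum_p (X i p *: (\sum_q (j == q)%:R *: bmx b p q) +
      (i == p)%:R *: \sum_q (X j q *: bmx b p q + (j == q)%:R *: 0)))
   (fun s => conj_fun (g s) (bmx b i j)).
  apply: (first_order_eq (F := fun s => \sum_p ((i == p)%:R + s * X i p + s ^+ 2 * Y i p) *:
     \sum_q ((j == q)%:R + s * X j q + s ^+ 2 * Y j q) *: bmx b p q)).
    move=> s; rewrite conj_bmx; apply: eq_bigr => p _; rewrite -gE'; congr (_ *: _).
    by apply: eq_bigr => q _; rewrite -gE'.
  apply: first_order_sum => p; apply: first_order_scale.
  apply: first_order_sum => q; apply: first_order_scale.
  exact: first_order_cst.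
move: h; rewrite sum_delta_scale sum_delta_scale.
have -> // : \sum_p (X i p *: (\sum_q (j == q)%:R *: bmx b p q) +
      (i == p)%:R *: \sum_q (X j q *: bmx b p q + (j == q)%:R *: 0)) = dblk X (b, (i, j)).
rewrite /dblk !big_split /= sum_delta_scale; congr (_ + _).
  by apply: eq_bigr => p _; rewrite sum_delta_scale.
by apply: eq_bigr => q _; rewrite scaler0 addr0.
Qed.

Definition equivariant_fam (K : 'I_N -> 'I_N -> D) := forall (g : G) k l f,
  dist_fun (K k l) f =
  \sum_k' \sum_l' so_val g k k' * so_val g l l' * dist_fun (K k' l') (conj_fun g f).

(** Equivariance differentiated at the identity in the direction [X]: two terms for the indices of
    K, one for the test monomial. *)
Definition inf_inv (K : 'I_N -> 'I_N -> D) (X : 'M[C]_N) := forall k l bs,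
  \sum_m X k m * dist_fun (K m l) (mon bs) + \sum_m X l m * dist_fun (K k m) (mon bs)
  + dist_fun (K k l) (dmon X bs) = 0.

Lemma sum_delta_mul (i : 'I_N) (F : 'I_N -> C) : \sum_p (i == p)%:R * F p = F i.
Proof.
rewrite (bigD1 i) //= eqxx mul1r big1 ?addr0 // => p pi.
by rewrite eq_sym (negbTE pi) mul0r.
Qed.

Lemma inf_inv_nilp K u v : equivariant_fam K -> nilp u v -> inf_inv K (bivec u v).
Proof.
move=> Keq uv k l bs.
pose g s := rot (nilp_gram s uv).
pose X := bivec u v; pose Y := 2^-1 *: (X *m X).
have gE s : so_val (g s) = 1%:M + s *: X + s ^+ 2 *: Y.
  by rewrite /g /= rot_nilp // /Y scalerA.
have gE' s i p : so_val (g s) i p = (i == p)%:R + s * X i p + s ^+ 2 * Y i p.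
  by rewrite gE !mxE.
have FO := first_order_conj bs gE.
have FO2 (p : 'I_N * 'I_N) := first_order_scale ((k == p.1)%:R) (X k p.1) (Y k p.1)
   (first_order_scale ((l == p.2)%:R) (X l p.2) (Y l p.2) FO).
have inv s : \sum_p dist_fun (K p.1 p.2) ((((k == p.1)%:R + s * X k p.1 + s ^+ 2 * Y k p.1) *:
    (((l == p.2)%:R + s * X l p.2 + s ^+ 2 * Y l p.2) *: conj_fun (g s) (mon bs)))) =
    dist_fun (K k l) (mon bs).
  rewrite (Keq (g s)) pair_bigA /=; apply: eq_bigr => p _.
  by rewrite -!gE' !dist_funZ mulrA.
have := first_order_const FO2 inv.
under eq_bigr do rewrite dist_funD !dist_funZ dist_funD !dist_funZ.
rewrite -(pair_bigA _ (fun a b => X k a * ((l == b)%:R * dist_fun (K a b) (mon bs)) +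
  (k == a)%:R * (X l b * dist_fun (K a b) (mon bs) + (l == b)%:R * dist_fun (K a b) (dmon X bs)))) /=.
under eq_bigr do rewrite big_split /= -!mulr_sumr sum_delta_mul big_split /= sum_delta_mul.
rewrite big_split /= sum_delta_mul addrA.
by [].
Qed.

Lemma dblkD X Y b : dblk (X + Y) b = dblk X b + dblk Y b.
Proof.
rewrite /dblk -big_split; apply: eq_bigr => q _ /=.
by apply: regfunP => g; rewrite !(regfunDE, regfunZE) !mxE; ring.
Qed.

Lemma dblkZ a X b : dblk (a *: X) b = a *: dblk X b.
Proof.
rewrite /dblk scaler_sumr; apply: eq_bigr => q _ /=.
by apply: regfunP => g; rewrite !(regfunDE, regfunZE) !mxE; ring.
Qed.

Lemma dmonD X Y bs : dmon (X + Y) bs = dmon X bs + dmon Y bs.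
Proof. by elim: bs => [|b bs IH] /=; rewrite ?addr0 // IH dblkD; ring. Qed.

Lemma dmonZ a X bs : dmon (a *: X) bs = a *: dmon X bs.
Proof.
elim: bs => [|b bs IH] /=; rewrite ?scaler0 // IH dblkZ.
by apply: regfunP => g; rewrite !(regfunDE, regfunME, regfunZE); ring.
Qed.

Lemma inf_invD K X Y : inf_inv K X -> inf_inv K Y -> inf_inv K (X + Y).
Proof.
move=> hX hY k l bs; rewrite dmonD dist_funD.
have E i (F : 'I_N -> C) : \sum_m (X + Y) i m * F m = \sum_m X i m * F m + \sum_m Y i m * F m.
  by rewrite -big_split; apply: eq_bigr => m _; rewrite mxE mulrDl.
rewrite !E -[RHS](addr0 0) -[X in _ = X + _](hX k l bs) -[X in _ = _ + X](hY k l bs); ring.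
Qed.

Lemma inf_invZ K a X : inf_inv K X -> inf_inv K (a *: X).
Proof.
move=> hX k l bs; rewrite dmonZ dist_funZ -[RHS](mulr0 a) -[X in _ = _ * X](hX k l bs) !mulrDr !mulr_sumr.
by congr (_ + _ + _); apply: eq_bigr => m _; rewrite mxE mulrA.
Qed.

Definition rot_gen (p q : 'I_N) : 'M[C]_N := delta_mx p q - delta_mx q p.

Lemma bivecDl (x x' y : V) : bivec (x + x') y = bivec x y + bivec x' y.
Proof. by rewrite /bivec mulmxDl raddfD /= mulmxDr opprD addrACA. Qed.

Lemma bivec_delta p q : bivec (delta_mx p 0 : V) (delta_mx q 0) = rot_gen p q.
Proof. by rewrite /bivec !trmx_delta !mul_delta_mx. Qed.

Lemma so_form_delta (p q : 'I_N) : so_form (delta_mx p 0 : V) (delta_mx q 0) = (p == q)%:R.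
Proof. by rewrite /so_form trmx_delta mul_delta_mx_cond; case: eqP => _; rewrite ?mulr1n ?mulr0n !mxE ?eqxx. Qed.

Lemma so_formDl (x x' y : V) : so_form (x + x') y = so_form x y + so_form x' y.
Proof. by rewrite /so_form raddfD /= mulmxDl mxE. Qed.

(** With a third index r, e_p /\ e_q is half the sum of (e_p + i e_r) /\ e_q and (e_p - i e_r) /\
    e_q. The vectors e_p + i e_r and e_p - i e_r are isotropic and orthogonal to e_q, so both terms
    are nilpotent. *)
Lemma inf_inv_rot_gen K p q : (2 < N)%N -> equivariant_fam K -> inf_inv K (rot_gen p q).
Proof.
move=> N3 Keq.
have [<-|pq] := eqVneq p q.
  have -> : rot_gen p p = 0 *: rot_gen p p by rewrite /rot_gen subrr scaler0.
  have -> : 0 *: rot_gen p p = 0 *: bivec (0 : V) 0 by rewrite !scale0r.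
  apply/inf_invZ/inf_inv_nilp => //; rewrite /nilp /so_form trmx0 mul0mx mxE //.
have [r /andP[rp rq]] : exists r, (r != p) && (r != q).
  apply/existsP; apply: contraLR N3 => /existsPn h.
  rewrite -leqNgt -[N]card_ord (leq_trans (subset_leq_card (B := [set p; q]) _)) //.
    by apply/fintype.subsetP => x _; rewrite !inE; apply: contraNT (h x); rewrite negb_or.
  by rewrite cards2; case: (p != q).
pose u a : V := delta_mx p 0 + a *: delta_mx r 0.
have nu a : a ^+ 2 = -1 -> nilp (u a) (delta_mx q 0).
  move=> a2; rewrite /nilp /u; split; last first.
    by rewrite so_formDl so_formZl !so_form_delta (negbTE pq) (negbTE rq) mulr0n mulr0 addr0.
  rewrite so_formDl so_formZl so_formC so_formDl so_formZl [X in _ + _ * X]so_formC so_formDl so_formZl.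
  rewrite !so_form_delta !eqxx (negbTE rp) eq_sym (negbTE rp).
  by transitivity (1 + a ^+ 2); [rewrite ?mulr0n ?mulr1n; ring | rewrite a2 subrr].
have -> : rot_gen p q = 2^-1 *: (bivec (u 'i%C) (delta_mx q 0) + bivec (u (- 'i%C)) (delta_mx q 0)).
  rewrite -bivecDl /u addrACA -scalerDl subrr scale0r addr0 bivecDl bivec_delta.
  by rewrite -[X in 2^-1 *: X]mulr2n -[X in 2^-1 *: X]scaler_nat scalerA mulVf ?scale1r // pnatr_eq0.
apply/inf_invZ/inf_invD; apply: inf_inv_nilp => //; apply: nu.
  exact: sqr_i.
by rewrite sqrrN sqr_i.
Qed.
End Infinitesimal.

(** * Uniqueness of the solutions of the Jacobi identity *)

Section Uniqueness.
Variables (R : realType) (N : nat).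
Local Notation C := R[i].
Local Notation G := (SO R N).
Local Notation OG := (regfun R N).
Local Notation D := (dist R N).
Local Notation "f \> mu" := (act_fun f mu) (at level 38, right associativity).
Local Notation bmx := (@bmx R N).
Local Notation amx := (@amx R N).
Local Notation tau := (tau R N).
Local Notation block := (bool * ('I_N * 'I_N))%type.
Local Notation mon := (@mon R N).
Local Notation fam := ('I_N -> 'I_N -> D).
Hypothesis N3 : (2 < N)%N.

(** [null_trs] is imposed for every n so that the class is stable under multiplication by tau, a
    factor that the quadratic relations bring in. *)
Record null_fam (K : fam) : Prop := NullFam {
  null_skew : skew_fam K;
  null_jac : jacobi K;
  null_equiv : equivariant_fam K;
  null_trs : forall n, dist_fun (trs K) (tau ^+ n) = 0
}.

Definition tau_fam (K : fam) : fam := fun x y => tau \> K x y.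

Lemma sfam_tau K x y : sfam (tau_fam K) x y = tau \> sfam K x y.
Proof.
rewrite /sfam act_fun_sumr; apply: eq_bigr => j _.
by rewrite /tau_fam -!act_funM mulrC.
Qed.

Lemma null_fam_tau K : null_fam K -> null_fam (tau_fam K).
Proof.
move=> [Ks Kj Ke Kt]; split.
- by move=> x y; rewrite /tau_fam Ks act_funNr.
- move=> u x y z; rewrite /tau_fam -!act_funM ![_ * tau]mulrC !act_funM -!act_funDr.
  by rewrite Kj act_fun0.
- move=> g k l f; rewrite /tau_fam !act_funE (Ke g); apply: eq_bigr => k' _.
  by apply: eq_bigr => l' _; rewrite conj_funM conj_tau.
- move=> n; have -> : trs (tau_fam K) = tau \> trs K.
    by rewrite /trs act_fun_sumr; apply: eq_bigr => k _; rewrite sfam_tau.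
  by rewrite act_funE -exprS Kt.
Qed.

Section Step.
Variables (K : fam) (d : nat).
Hypothesis K_null : null_fam K.

Let Ks := null_skew K_null.
Let Kj := null_jac K_null.

Definition vanish (mu : D) n := forall bs : seq block, size bs = n -> dist_fun mu (mon bs) = 0.

Lemma sum_rot_gen (i p q : 'I_N) (F : 'I_N -> C) :
  \sum_m (rot_gen R p q) i m * F m = (i == p)%:R * F q - (i == q)%:R * F p.
Proof.
have E (r s : 'I_N) : \sum_m (delta_mx r s : 'M[C]_N) i m * F m = (i == r)%:R * F s.
  rewrite (bigD1 s) //= mxE eqxx andbT big1 ?addr0 // => m ms.
  by rewrite mxE (negbTE ms) andbF mul0r.
rewrite -!E -sumrB; apply: eq_bigr => m _.
by rewrite [rot_gen _ _ _ _ _]mxE [X in (_ + X) * _]mxE mulrDl mulNr.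
Qed.

Lemma dblk_rot_gen p q (b : bool) (x y : 'I_N) : dblk (rot_gen R p q) (b, (x, y)) =
  (x == p)%:R *: bmx b q y - (x == q)%:R *: bmx b p y
  + ((y == p)%:R *: bmx b x q - (y == q)%:R *: bmx b x p).
Proof.
apply: regfunP => g; transitivity (\sum_m (rot_gen R p q x m * bmx b m y g
    + rot_gen R p q y m * bmx b x m g)); first exact: (raddf_sum (ev g)).
rewrite big_split /= !sum_rot_gen.
by [].

Qed.

Lemma bmx_trZ b x y : bmx b x y = (-1) ^+ b *: bmx b y x.
Proof.
rewrite bmx_tr; case: b; last by rewrite expr0 mul1r scale1r.
by rewrite !expr1 mulN1r scaleN1r.
Qed.

(** Infinitesimal invariance along the generators (k, q) is summed over q. The rotation of the first
    index of K gives 1 - N, that of the second gives 1 by skew symmetry. *)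
Lemma fam_inf k l bs : \sum_q dist_fun (K q l) (dmon (rot_gen R k q) bs)
  = (N%:R - 2) * dist_fun (K k l) (mon bs).
Proof.
have Keq := null_equiv K_null.
have e : \sum_q (\sum_m rot_gen R k q q m * dist_fun (K m l) (mon bs)
   + \sum_m rot_gen R k q l m * dist_fun (K q m) (mon bs)
   + dist_fun (K q l) (dmon (rot_gen R k q) bs)) = 0.
  by rewrite big1 // => q _; exact: (inf_inv_rot_gen k q N3 Keq).
have K0 q f : dist_fun (K q q) f = 0.
  have /(congr1 (fun mu : D => dist_fun mu f)) := Ks q q; rewrite distN => h.
  by apply: (@mulrSn_eq0 R _ 1); rewrite mulr2n {1}h addNr.
apply/eqP; rewrite -subr_eq0 -[X in _ == X]e !big_split /=.
under [X in _ == X + _ + _]eq_bigr do rewrite sum_rot_gen eqxx mul1r [_ == k]eq_sym.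
under [X in _ == _ + X + _]eq_bigr do rewrite sum_rot_gen K0 mulr0 sub0r.
rewrite !sumrB sumrN !sum_delta_mul sumr_const card_ord (Ks l) distN.
by apply/eqP; rewrite -[_ *+ N]mulr_natl; ring.
Qed.

Section FamStep.
Hypothesis IHK : forall x y, vanish (tau \> K x y) d.
Hypothesis IHs : forall x y, vanish (sfam K x y) d.

Lemma contract_vanish b x y m : size m = d ->
  \sum_q dist_fun (K q y) (bmx b x q * mon m) = 0.
Proof.
move=> sm; have := bmx_mul_fam Ks Kj b x y.
move/(congr1 (fun mu : D => dist_fun mu (mon m))); rewrite dist_sum => e.
transitivity (dist_fun (if b then sfam K x y else tau \> K x y) (mon m)).
  by rewrite -e; apply: eq_bigr.
by case: b {e}; [exact: IHs | exact: IHK].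
Qed.

(** The derivative replaces an index of the block. If the new index is [q], the block is contracted
    with K and [contract_vanish] applies. Otherwise [k] enters the block and an index of the block
    enters K; antisymmetrized in k and l, the wedge relations lead back to K_kl times the original
    block. *)
Lemma fam_block b x y k l m : size m = d ->
  \sum_q dist_fun (K q l) (dblk (rot_gen R k q) (b, (x, y)) * mon m)
  - \sum_q dist_fun (K q k) (dblk (rot_gen R l q) (b, (x, y)) * mon m)
  = - (dist_fun (K k l) (bmx b x y * mon m) *+ 2).
Proof.
move=> sm.
have E k' l' : \sum_q dist_fun (K q l') (dblk (rot_gen R k' q) (b, (x, y)) * mon m)
  = - dist_fun (K x l') (bmx b k' y * mon m) - dist_fun (K y l') (bmx b x k' * mon m).
  have c1 := contract_vanish b y l' sm; have c2 := contract_vanish b x l' sm.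
  transitivity (\sum_q ((x == k')%:R * ((-1) ^+ b * dist_fun (K q l') (bmx b y q * mon m))
    - (x == q)%:R * dist_fun (K q l') (bmx b k' y * mon m)
    + ((y == k')%:R * dist_fun (K q l') (bmx b x q * mon m)
    - (y == q)%:R * dist_fun (K q l') (bmx b x k' * mon m)))).
    apply: eq_bigr => q _; rewrite dblk_rot_gen.
    rewrite !mulrDl !dist_funD !mulNr !dist_funN !regfun_scaleA !dist_funZ.
    by rewrite [bmx b q y]bmx_trZ !regfun_scaleA !dist_funZ.
  rewrite big_split /= !sumrB -!mulr_sumr c1 c2 !sum_delta_mul; ring.
rewrite !E.
have Kkl z w f : dist_fun (K z w) f = - dist_fun (K w z) f by rewrite Ks distN.
have w1 : dist_fun (K x l) (bmx b k y * mon m) + dist_fun (K l k) (bmx b x y * mon m)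
   + dist_fun (K k x) (bmx b l y * mon m) = 0.
  have := congr1 (fun mu : D => (-1) ^+ b * dist_fun mu (mon m)) (bmx_wedge Kj b y k x l).
  rewrite dist_zero mulr0 !distD !act_funE => <-.
  rewrite (bmx_trZ b k) (bmx_trZ b x) (bmx_trZ b l) !regfun_scaleA !dist_funZ; ring.
have w2 : dist_fun (K y l) (bmx b x k * mon m) + dist_fun (K l k) (bmx b x y * mon m)
   + dist_fun (K k y) (bmx b x l * mon m) = 0.
  have := congr1 (fun mu : D => dist_fun mu (mon m)) (bmx_wedge Kj b x k y l).
  by rewrite dist_zero !distD !act_funE.
rewrite (Kkl l k) (Kkl k x) in w1; rewrite (Kkl l k) (Kkl k y) in w2.
have {w1} -> : dist_fun (K x l) (bmx b k y * mon m) =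
    dist_fun (K k l) (bmx b x y * mon m) + dist_fun (K x k) (bmx b l y * mon m).
  by apply/eqP; rewrite -subr_eq0 -[X in _ == X]w1; apply/eqP; ring.
have {w2} -> : dist_fun (K y l) (bmx b x k * mon m) =
    dist_fun (K k l) (bmx b x y * mon m) + dist_fun (K y k) (bmx b x l * mon m).
  by apply/eqP; rewrite -subr_eq0 -[X in _ == X]w2; apply/eqP; ring.
ring.
Qed.

(** By the Leibniz rule every block contributes -2; [m] collects the blocks already passed. *)
Lemma fam_mon k l bs m : (size bs + size m = d.+1)%N ->
  \sum_q dist_fun (K q l) (dmon (rot_gen R k q) bs * mon m)
  - \sum_q dist_fun (K q k) (dmon (rot_gen R l q) bs * mon m)
  = - (dist_fun (K k l) (mon bs * mon m) *+ (2 * size bs)).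
Proof.
elim: bs m => [|[b [x y]] bs IH] m sm.
  by rewrite muln0 mulr0n oppr0 !big1 ?subr0 // => q _; rewrite /= mul0r dist_fun0.
have sm1 : size (bs ++ m) = d by rewrite size_cat; case: sm.
have sm2 : (size bs + size ((b, (x, y)) :: m) = d.+1)%N by rewrite /= addnS -addSn.
have := fam_block b x y k l sm1; have := IH _ sm2.
have E1 k' l' : \sum_q dist_fun (K q l') (dmon (rot_gen R k' q) ((b, (x, y)) :: bs) * mon m)
  = \sum_q dist_fun (K q l') (dblk (rot_gen R k' q) (b, (x, y)) * mon (bs ++ m))
   + \sum_q dist_fun (K q l') (dmon (rot_gen R k' q) bs * mon ((b, (x, y)) :: m)).
  rewrite -big_split; apply: eq_bigr => q _ /=; rewrite -dist_funD; congr (dist_fun _ _).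
  by rewrite mon_cat mon_cons; ring.
have E2 : mon ((b, (x, y)) :: bs) * mon m = bmx b x y * mon (bs ++ m).
  by rewrite mon_cat mon_cons /blk /= mulrA.
have E3 : mon bs * mon ((b, (x, y)) :: m) = bmx b x y * mon (bs ++ m).
  by rewrite mon_cat mon_cons /blk /=; ring.
rewrite !E1 E2 E3 => e1 e2; rewrite -[size (_ :: _)]/((size bs).+1) mulnS.
move: (2 * size bs)%N e1 => n2 e1; rewrite mulrnDr [RHS]opprD -e1 -e2; ring.
Qed.

(** The same sum is 2 (N - 2) times the value by [fam_inf] and -2 (d + 1) times it by [fam_mon]. The
    factors have different signs, so the value is zero. *)
Lemma fam_vanish_succ k l : vanish (K k l) d.+1.
Proof.
move=> bs sbs.
have E k' l' : \sum_q dist_fun (K q l') (dmon (rot_gen R k' q) bs * mon [::])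
   = (N%:R - 2) * dist_fun (K k' l') (mon bs).
  by rewrite -fam_inf; apply: eq_bigr => q _; rewrite /mon big_nil mulr1.
have := @fam_mon k l bs [::] _; rewrite !E addn0 => /(_ sbs).
rewrite (Ks l) distN {4}/mon big_nil mulr1 sbs => e.
have cn0 : ((2 * N%:R - 4 + (2 * d.+1)%:R : C)) != 0.
  have -> : (2 * N%:R - 4 + (2 * d.+1)%:R : C) = (2 * (N - 2) + 2 * d.+1)%:R.
    by rewrite natrD !natrM natrB 1?ltnW //; ring.
  by rewrite pnatr_eq0 mulnS addnC.
apply: (mulfI cn0); rewrite mulr0.
apply/eqP; rewrite -[X in _ == X](subrr (- (dist_fun (K k l) (mon bs) *+ (2 * d.+1)))) -{1}e.
by apply/eqP; rewrite -[_ *+ (2 * d.+1)]mulr_natl; ring.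
Qed.
End FamStep.

Lemma fam_vanish0 k l : vanish (K k l) 0.
Proof.
case=> // _; have := fam_inf k l [::]; rewrite big1 => [|q _]; last exact: dist_fun0.
have n0 : (N%:R - 2 : C) != 0.
  by rewrite -natrB 1?ltnW // pnatr_eq0 -lt0n subn_gt0.
by move/esym/eqP; rewrite mulf_eq0 (negbTE n0) => /eqP.
Qed.

(** The invariance of K is used on monomials with one more block p_kj and summed over j; the terms
    that rotate the summed index j cancel because [X] is skew. *)
Lemma sfam_inf p q : inf_inv (sfam K) (rot_gen R p q).
Proof.
set X := rot_gen R p q.
have Xs i j : X i j = - X j i.
  by rewrite /X /rot_gen !mxE andbC [in X in _ - X]andbC opprB.
have Ki := inf_inv_rot_gen p q N3 (null_equiv K_null).
move=> k l bs.
have sE x y f : dist_fun (sfam K x y) f = \sum_j dist_fun (K j y) (bmx true x j * f).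
  by rewrite dist_sum.
have e : \sum_j (\sum_m X j m * dist_fun (K m l) (bmx true k j * mon bs)
   + \sum_m X l m * dist_fun (K j m) (bmx true k j * mon bs)
   + dist_fun (K j l) (dblk X (true, (k, j)) * mon bs + bmx true k j * dmon X bs)) = 0.
  rewrite big1 // => j _; have := Ki j l ((true, (k, j)) :: bs).
  by rewrite mon_cons.
have T2 : \sum_j \sum_m X l m * dist_fun (K j m) (bmx true k j * mon bs) =
    \sum_m X l m * dist_fun (sfam K k m) (mon bs).
  rewrite exchange_big; apply: eq_bigr => m _; rewrite sE mulr_sumr //.
have T3 : \sum_j dist_fun (K j l) (dblk X (true, (k, j)) * mon bs) =
    \sum_m X k m * dist_fun (sfam K m l) (mon bs)
    - \sum_j \sum_m X j m * dist_fun (K m l) (bmx true k j * mon bs).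
  rewrite [X in _ - X]exchange_big /= -sumrN.
  under [X in _ = X + _]eq_bigr do rewrite sE mulr_sumr.
  rewrite [X in _ = X + _]exchange_big -big_split /=; apply: eq_bigr => j _.
  rewrite -sumrN -big_split /= /dblk /= mulr_suml dist_fun_sum; apply: eq_bigr => m _.
  rewrite mulrDl !regfun_scaleA dist_funD !dist_funZ (Xs j); ring.
rewrite -[RHS]e !big_split /= T2.
under [X in _ = _ + X]eq_bigr do rewrite dist_funD.
rewrite big_split /= T3 sE; ring.
Qed.

(** The analogue of [fam_inf] for a symmetric family. Its trace survives and carries the invariants
    that [null_trs] sets to zero. *)
Lemma sfam_contr k l bs : \sum_q dist_fun (sfam K k q) (dmon (rot_gen R l q) bs)
  = N%:R * dist_fun (sfam K k l) (mon bs) - (k == l)%:R * dist_fun (trs K) (mon bs).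
Proof.
have Ssym := sfam_sym Ks Kj.
have e : \sum_q (\sum_m rot_gen R l q k m * dist_fun (sfam K m q) (mon bs)
   + \sum_m rot_gen R l q q m * dist_fun (sfam K k m) (mon bs)
   + dist_fun (sfam K k q) (dmon (rot_gen R l q) bs)) = 0.
  by rewrite big1 // => q _; exact: sfam_inf.
apply/eqP; rewrite -subr_eq0 -[X in _ == X]e !big_split /=.
under [X in _ == X + _ + _]eq_bigr do rewrite sum_rot_gen.
under [X in _ == _ + X + _]eq_bigr do rewrite sum_rot_gen eqxx mul1r [_ == l]eq_sym.
rewrite !sumrB -mulr_sumr !sum_delta_mul sumr_const card_ord (Ssym l) /trs dist_sum.
by apply/eqP; rewrite -[_ *+ N]mulr_natl; ring.
Qed.
End Step.

(** The statement concerns all null families at once: the step from d to d + 1 for K appeals to it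
    for tau K and tau^2 K. *)
Definition level d := forall K, null_fam K ->
  forall x y, vanish (K x y) d /\ vanish (sfam K x y) d.

Lemma dist_funMn (mu : D) f n : dist_fun mu (f *+ n) = dist_fun mu f *+ n.
Proof. exact: (linearMn (mu : {scalar OG})). Qed.

Section SymStep.
Variables (K : fam) (d : nat).
Hypothesis K_null : null_fam K.
Hypothesis IH : level d.
Hypothesis HK : forall K, null_fam K -> forall x y, vanish (K x y) d.+1.

Let Ks := null_skew K_null.
Let Kj := null_jac K_null.
Let K1 := null_fam_tau K_null.
Let K2 := null_fam_tau K1.

Lemma vanish_tau24 x y m : size m = d ->
  dist_fun ((tau * (tau - 4)) \> K x y) (mon m) = 0.
Proof.
move=> sm; have e : (tau * (tau - 4)) \> K x y = tau_fam (tau_fam K) x y - tau_fam K x y *+ 4.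
  rewrite /tau_fam; apply: distP => f; rewrite distD distN distMnE !act_funE.
  by rewrite -dist_funMn -dist_funN -dist_funD; congr (dist_fun _ _); ring.
rewrite e distD distN distMnE (proj1 (IH K2 x y)) // (proj1 (IH K1 x y)) //.
by rewrite mul0rn subr0.
Qed.

Lemma sfam_contract_vanish b x y m : size m = d ->
  \sum_q dist_fun (sfam K x q) (bmx b q y * mon m) = 0.
Proof.
move=> sm; have := sfam_mul_bmx Ks Kj b x y.
move/(congr1 (fun mu : D => dist_fun mu (mon m))); rewrite dist_sum => e.
transitivity (dist_fun (if b then (tau * (tau - 4)) \> K x y else tau \> sfam K x y) (mon m)).
  by rewrite -e; apply: eq_bigr.
case: b {e}; first exact: vanish_tau24.
by rewrite -sfam_tau; exact: (proj2 (IH K1 x y)).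
Qed.

(** The error term of [sfam_swap] is K on a monomial of degree d + 1. This is why, in each degree, K
    is treated before s. *)
Lemma sfam_swap_vanish b x y k l m : size m = d ->
  dist_fun (sfam K k y) (bmx b x l * mon m) = dist_fun (sfam K k l) (bmx b x y * mon m).
Proof.
move=> sm; apply/esym/eqP; rewrite -subr_eq0; apply/eqP.
have := congr1 (fun mu : D => dist_fun mu (mon m)) (sfam_swap Ks Kj b x y k l).
rewrite distD distN !act_funE => ->.
have h1 : dist_fun (K y l) (bmx (~~ b) k x * mon m) = 0.
  by have := HK K_null y l (_ : size ((~~ b, (k, x)) :: m) = d.+1); rewrite mon_cons; apply; rewrite /= sm.
have h2 : dist_fun (K y l) (tau * (bmx (~~ b) k x * mon m)) = 0.
  by have := HK K1 y l (_ : size ((~~ b, (k, x)) :: m) = d.+1); rewrite mon_cons; apply; rewrite /= sm.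
have -> : bmx (~~ b) k x * ((if b then 4 - tau else tau) * mon m)
   = (if b then 4 - tau else tau) * (bmx (~~ b) k x * mon m) by rewrite mulrCA.
case: b h1 h2 => h1 h2 //=.
by rewrite mulrBl dist_funD dist_funN h2 mulr_natl dist_funMn h1 mul0rn subr0.
Qed.

Lemma sfam_block b x y k l m : size m = d ->
  \sum_q dist_fun (sfam K k q) (dblk (rot_gen R l q) (b, (x, y)) * mon m)
  = - (dist_fun (sfam K k l) (bmx b x y * mon m) *+ 2).
Proof.
move=> sm.
have c1 := sfam_contract_vanish b k y sm; have c2 := sfam_contract_vanish b k x sm.
transitivity (\sum_q ((x == l)%:R * dist_fun (sfam K k q) (bmx b q y * mon m)
    - (x == q)%:R * dist_fun (sfam K k q) (bmx b l y * mon m)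
    + ((y == l)%:R * ((-1) ^+ b * dist_fun (sfam K k q) (bmx b q x * mon m))
    - (y == q)%:R * dist_fun (sfam K k q) (bmx b x l * mon m)))).
  apply: eq_bigr => q _; rewrite dblk_rot_gen.
  rewrite !mulrDl !dist_funD !mulNr !dist_funN !regfun_scaleA !dist_funZ.
  by rewrite [bmx b x q]bmx_trZ !regfun_scaleA !dist_funZ.
rewrite big_split /= !sumrB -!mulr_sumr c1 c2 !sum_delta_mul.
rewrite (sfam_swap_vanish b x y k l sm) [bmx b l y]bmx_trZ regfun_scaleA dist_funZ.
rewrite (sfam_swap_vanish b y x k l sm) [bmx b y x]bmx_trZ regfun_scaleA dist_funZ.
by rewrite mulrA -expr2 sqrr_sign; ring.
Qed.

Lemma sfam_mon k l bs m : (size bs + size m = d.+1)%N ->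
  \sum_q dist_fun (sfam K k q) (dmon (rot_gen R l q) bs * mon m)
  = - (dist_fun (sfam K k l) (mon bs * mon m) *+ (2 * size bs)).
Proof.
elim: bs m => [|[b [x y]] bs IHbs] m sm.
  by rewrite muln0 mulr0n oppr0 big1 // => q _; rewrite /= mul0r dist_fun0.
have sm1 : size (bs ++ m) = d by rewrite size_cat; case: sm.
have sm2 : (size bs + size ((b, (x, y)) :: m) = d.+1)%N by rewrite /= addnS -addSn.
have := sfam_block b x y k l sm1; have := IHbs _ sm2.
have E1 k' l' : \sum_q dist_fun (sfam K k' q) (dmon (rot_gen R l' q) ((b, (x, y)) :: bs) * mon m)
  = \sum_q dist_fun (sfam K k' q) (dblk (rot_gen R l' q) (b, (x, y)) * mon (bs ++ m))
   + \sum_q dist_fun (sfam K k' q) (dmon (rot_gen R l' q) bs * mon ((b, (x, y)) :: m)).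
  rewrite -big_split; apply: eq_bigr => q _ /=; rewrite -dist_funD; congr (dist_fun _ _).
  by rewrite mon_cat mon_cons; ring.
have E2 : mon ((b, (x, y)) :: bs) * mon m = bmx b x y * mon (bs ++ m).
  by rewrite mon_cat mon_cons /blk /= mulrA.
have E3 : mon bs * mon ((b, (x, y)) :: m) = bmx b x y * mon (bs ++ m).
  by rewrite mon_cat mon_cons /blk /=; ring.
rewrite !E1 E2 E3 => e1 e2; rewrite -[size (_ :: _)]/((size bs).+1) mulnS.
move: (2 * size bs)%N e1 => n2 e1; rewrite mulrnDr [RHS]opprD -e1 -e2; ring.
Qed.

(** [bmx_trs] absorbs one block into null families, in degree d; the trace is an independent datum
    only against powers of tau. *)
Lemma trs_vanish : vanish (trs K) d.+1.
Proof.
case=> [//|[b [x y]] m] [sm]; rewrite mon_cons /blk /=.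
have := congr1 (fun mu : D => dist_fun mu (mon m)) (bmx_trs Ks Kj b x y).
rewrite act_funE distMnE => ->.
case: b; first by rewrite vanish_tau24 ?mul0rn.
by rewrite -sfam_tau (proj2 (IH K1 x y)) ?mul0rn.
Qed.

Lemma sfam_vanish_succ k l : vanish (sfam K k l) d.+1.
Proof.
move=> bs sbs.
have E : \sum_q dist_fun (sfam K k q) (dmon (rot_gen R l q) bs * mon [::])
   = N%:R * dist_fun (sfam K k l) (mon bs).
  transitivity (\sum_q dist_fun (sfam K k q) (dmon (rot_gen R l q) bs)).
    by apply: eq_bigr => q _; rewrite /mon big_nil mulr1.
  by rewrite (sfam_contr K_null) trs_vanish // mulr0 subr0.
have := @sfam_mon k l bs [::] _; rewrite E addn0 => /(_ sbs).
rewrite {3}/mon big_nil mulr1 sbs => e.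
have cn0 : ((N%:R + (2 * d.+1)%:R : C)) != 0.
  by rewrite -natrD pnatr_eq0 mulnS addnC.
apply: (mulfI cn0); rewrite mulr0 mulrDl e mulr_natl addNr //.
Qed.
End SymStep.

Lemma level_all d : level d.
Proof.
elim: d => [|d IH] K K_null x y.
  split; first exact: fam_vanish0.
  case=> // _; have := sfam_contr K_null x y [::].
  rewrite big1 => [|q _]; last exact: dist_fun0.
  have -> : dist_fun (trs K) (mon [::]) = 0.
    (* The instance n = 0; the others reach this point through the families multiplied by powers of
       tau. *)
    by rewrite /mon big_nil -(expr0 tau); exact: null_trs.
  rewrite mulr0 subr0.
  have n0 : (N%:R : C) != 0 by rewrite pnatr_eq0 -lt0n (leq_trans _ N3).
  by move/esym/eqP; rewrite mulf_eq0 (negbTE n0) => /eqP.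
have HK K' : null_fam K' -> forall x y, vanish (K' x y) d.+1.
  move=> K'n; apply: (fam_vanish_succ K'n).
    by move=> x' y'; exact: (proj1 (IH _ (null_fam_tau K'n) x' y')).
  by move=> x' y'; exact: (proj2 (IH _ K'n x' y')).
by split; [exact: HK | exact: sfam_vanish_succ].
Qed.

(** The blocks generate the functions, as a matrix entry g_ij is the Kronecker delta minus half the
    sum of the two blocks at (i, j). *)
Lemma mon_dense (mu : D) : (forall bs, dist_fun mu (mon bs) = 0) -> mu = 0.
Proof.
move=> mu0; apply: distP => f; rewrite dist_zero.
(* The auxiliary factor [h] makes the property stable under products. *)
pose good (f : OG) := forall h : OG, (forall bs, dist_fun mu (h * mon bs) = 0) ->
    forall bs, dist_fun mu (f * h * mon bs) = 0.
suff h : good f.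
  have := h 1 _ [::]; rewrite mulr1 {2}/mon big_nil mulr1; apply=> bs.
  by rewrite mul1r.
pose P (f : G -> C) := exists2 f' : OG, f = regfun_val f' & good f'.
suff [f' ff' gf'] : P f by rewrite (_ : f = f') //; apply: val_inj.
move: (regfun_regular f); move: (regfun_val f); apply: regular_ind.
- move=> a; exists (mk_regfun (regular_cst N a)) => // h h0 bs.
  have -> : mk_regfun (regular_cst N a) * h * mon bs = a *: (h * mon bs).
    by apply: regfunP => g; rewrite regfunZE !regfunME /= mulrA.
  by rewrite dist_funZ h0 mulr0.
- move=> i j; exists (mk_regfun (@regular_entry R N i j)) => // h h0 bs.
  have -> : mk_regfun (@regular_entry R N i j) * h * mon bs = (i == j)%:R *: (h * mon bs)
     - 2^-1 *: (h * mon ((false, (i, j)) :: bs)) - 2^-1 *: (h * mon ((true, (i, j)) :: bs)).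
    have e : (mk_regfun (@regular_entry R N i j) : OG) = (i == j)%:R *: (1 : OG) - 2^-1 *: (bmx false i j + bmx true i j).
      have -> : bmx false i j + bmx true i j = 2%:R *: amx i j.
        by rewrite bmxE0 bmxE1 addrACA subrr addr0 scaler_nat.
      rewrite scalerA mulVf ?pnatr_eq0 // scale1r.
      apply: regfunP => g; rewrite -[RHS]/((i == j)%:R * 1 - ev g (amx i j)).
      have /matrixP/(_ i j) := map_amx g; rewrite mxE => ->.
      by rewrite !mxE mulr1 opprB addrC subrK.
    rewrite e !mon_cons /blk /=.
    rewrite -mulrA mulrBl !regfun_scaleA mul1r mulrDl scalerDr opprD addrA.
    by rewrite ![_ * (h * _)]mulrCA.
  by rewrite !dist_funD !dist_funN !dist_funZ !h0 !mulr0 !subr0.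
- move=> f1 f2 [f1' -> g1] [f2' -> g2]; exists (f1' + f2') => // h h0 bs.
  by rewrite !mulrDl dist_funD g1 // g2 // addr0.
- move=> f1 f2 [f1' -> g1] [f2' -> g2]; exists (f1' * f2') => // h h0 bs.
  by rewrite -[f1' * f2' * h]mulrA; apply: g1 => cs; exact: g2.
Qed.

Theorem null_fam_eq0 K : null_fam K -> forall x y, K x y = 0.
Proof. by move=> Kn x y; apply: mon_dense => bs; exact: (proj1 (@level_all (size bs) K Kn x y) bs erefl). Qed.
End Uniqueness.

(** * Gaussian means of polynomials *)

Section Gaussian.
Import freeg ssrcomplements mpoly.
Variables (C : numFieldType) (n : nat).
Local Notation P := {mpoly C[n]}.

(** The double factorial (k - 1)!! for k even, 0 for k odd. *)
Fixpoint moment (k : nat) : nat :=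
  match k with 0 => 1 | 1 => 0 | k'.+2 => k'.+1 * moment k' end.

Lemma momentS k : moment k.+1 = (k * moment k.-1)%N.
Proof. by case: k. Qed.

(* The moments of n independent standard Gaussians, weighted by the degree. *)
Definition gauss (b : nat -> C) (p : P) : C :=
  \sum_(m <- msupp p) p@_m * (b (mdeg m) * (\prod_i moment (m i))%:R).

Lemma gaussE b k p : (msize p <= k)%N -> gauss b p =
  \sum_(m : 'X_{1..n < k}) p@_m * (b (mdeg m) * (\prod_i moment (m i))%:R).
Proof.
move=> le; rewrite /gauss.
pose I : subFinType _ := 'X_{1..n < k}.
rewrite (big_mksub I) /=; first last.
- by move=> m /msize_mdeg_lt/leq_trans/(_ le).
- exact: msupp_uniq.
by rewrite big_rmcond //= => m /memN_msupp_eq0 ->; rewrite mul0r.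
Qed.

Lemma gauss_linear b : scalar (gauss b).
Proof.
move=> a p q; pose k := maxn (maxn (msize p) (msize q)) (msize (a *: p + q)).
rewrite !(gaussE b (k := k)) ?leq_max ?leqnn ?orbT //.
rewrite mulr_sumr -big_split /=; apply: eq_bigr => m _.
by rewrite mcoeffD mcoeffZ; ring.
Qed.

HB.instance Definition _ b := GRing.isLinear.Build C P C *%R (gauss b) (gauss_linear b).

Lemma gaussZ b a p : gauss b (a *: p) = a * gauss b p.
Proof. exact: linearZ_LR. Qed.

Lemma gaussX b m : gauss b 'X_[m] = b (mdeg m) * (\prod_i moment (m i))%:R.
Proof. by rewrite /gauss msuppX big_seq1 mcoeffX eqxx mul1r. Qed.

Definition shift2 (b : nat -> C) k := b k.+2.

(** Gaussian integration by parts. Multiplication by X_i and differentiation differ by 2 in degree,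
    hence the shift of the weight. *)
Lemma gauss_mulX b i p : gauss b ('X_i * p) = gauss (shift2 b) p^`M(i).
Proof.
elim/mpolyind: p => [|c m p _ _ IH]; first by rewrite mulr0 mderiv0 !raddf0.
rewrite mulrDr mderivD !raddfD /= IH; congr (_ + _).
rewrite -scalerAr mderivZ !linearZ /=; congr (_ * _).
rewrite -mpolyXD mderivX linearZ /= !gaussX.
rewrite (bigD1 i) //= [in RHS](bigD1 i) //= !mnmE eqxx.
rewrite -[(true + m i)%N]/(1 + m i)%N -[(m i - true)%N]/(m i - 1)%N add1n subn1 momentS.
rewrite (eq_bigr (fun j => moment (m j))); last first.
  by move=> j ji; rewrite !mnmE eq_sym (negbTE ji) add0n.
rewrite [in RHS](eq_bigr (fun j => moment (m j))); last first.
  by move=> j ji; rewrite !mnmE eq_sym (negbTE ji) subn0.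
rewrite mdegD mdeg1 /shift2.
have [mi|mi] := posnP (m i); first by rewrite mi mul0n mul0n mulr0 mul0r.
have -> : (mdeg (m - U_(i))).+2 = (1 + mdeg m)%N.
  have {2}-> : m = (U_(i) + (m - U_(i)))%MM.
    by rewrite addmC submK // lep1mP -lt0n.
  by rewrite mdegD mdeg1.
by rewrite !natrM; ring.
Qed.

Lemma mderivXU i j : ('X_j : P)^`M(i) = (j == i)%:R%:MP.
Proof.
rewrite mderivX mnm1E; have [->|_] := eqVneq j i; last by rewrite scale0r mpolyC0.
have -> : (U_(i) - U_(i) = 0 :> 'X_{1..n})%MM by apply/mnmP => k; rewrite !mnmE subnn.
by rewrite mpolyX0 scale1r.
Qed.

Section Substitution.
Variable M : 'M[C]_n.
Definition lin_sub : n.-tuple P := [tuple \sum_l M k l *: 'X_l | k < n].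
Local Notation sub p := (p \mPo lin_sub).

Lemma sub_X k : sub 'X_k = \sum_l M k l *: 'X_l.
Proof. by rewrite comp_mpolyXU -tnth_nth tnth_mktuple. Qed.

Lemma sub_M p q : sub (p * q) = sub p * sub q.
Proof. exact: (rmorphM (comp_mpoly lin_sub)). Qed.

Lemma mpoly_ind_alg (Q : P -> Prop) : (forall c, Q c%:MP) ->
  (forall i p, Q p -> Q ('X_i * p)) -> (forall p q, Q p -> Q q -> Q (p + q)) ->
  forall p, Q p.
Proof.
move=> Qc QX QD; elim/mpolyind => [|c m p _ _ IH].
  by rewrite -(mpolyC0 n C); exact: Qc.
apply: QD IH; elim: {m}(mdeg m) {-2}m (erefl (mdeg m)) => [|d IHd] m dm.
  have -> : m = 0%MM by apply/eqP; rewrite -mdeg_eq0 dm.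
  by rewrite mpolyX0 -mul_mpolyC mulr1; exact: Qc.
have [i mi] : exists i, m i != 0%N.
  apply/existsP; rewrite -negb_forall; apply: contra_eqN dm => /forallP h.
  by rewrite mdegE big1 // => i _; apply/eqP.
have mE : m = (U_(i) + (m - U_(i)))%MM by rewrite addmC submK // lep1mP.
rewrite mE mpolyXD scalerAr; apply: QX; apply: IHd.
by move: dm; rewrite {1}mE mdegD mdeg1 => -[].
Qed.

Lemma mderiv_sub k p : (sub p)^`M(k) = \sum_l M l k *: sub p^`M(l).
Proof.
elim/mpoly_ind_alg: p => [c|i p IH|p q IHp IHq].
- rewrite comp_mpolyC mderivC big1 // => l _.
  by rewrite mderivC comp_mpoly0 scaler0.
- rewrite sub_M mderivM IH sub_X.
  have -> : (\sum_l M i l *: 'X_l : P)^`M(k) = (M i k)%:MP.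
    rewrite raddf_sum (bigD1 k) //= big1 ?addr0 => [|l lk].
      by rewrite mderivZ mderivXU eqxx -mul_mpolyC mulr1.
    by rewrite mderivZ mderivXU (negbTE lk) mpolyC0 scaler0.
  have E l : M l k *: sub ('X_i * p)^`M(l) = M l k *: (sub ('X_i)^`M(l) * sub p)
     + M l k *: (sub 'X_i * sub p^`M(l)).
    by rewrite mderivM comp_mpolyD !sub_M scalerDr.
  rewrite (eq_bigr _ (fun l _ => E l)) big_split /= sub_X; congr (_ + _).
    rewrite (bigD1 i) //= big1 ?addr0 => [|l li].
      by rewrite mderivXU eqxx comp_mpoly1 mul1r mul_mpolyC.
    by rewrite mderivXU eq_sym (negbTE li) mpolyC0 comp_mpoly0 mul0r scaler0.
  by rewrite mulr_sumr; apply: eq_bigr => l _; rewrite scalerAr.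
- rewrite comp_mpolyD mderivD IHp IHq -big_split /=; apply: eq_bigr => l _.
  by rewrite mderivD comp_mpolyD scalerDr.
Qed.

Hypothesis MMt : M *m M^T = 1%:M.

(** Rotation invariance of the Gaussian measure, with any weight in each degree. Integration by
    parts and the chain rule produce M M^T and lower the degree; the induction keeps [b] general
    because the weight gets shifted. *)
Lemma gauss_sub b p : gauss b (sub p) = gauss b p.
Proof.
suff h d m : (mdeg m <= d)%N -> forall b, gauss b (sub 'X_[m]) = gauss b 'X_[m].
  elim/mpolyind: p => [|c m p _ _ IH]; first by rewrite comp_mpoly0.
  by rewrite comp_mpolyD !raddfD /= IH comp_mpolyZ !linearZ /= (h (mdeg m)).
elim: d m => [|d IH] m dm {}b.
  have -> : m = 0%MM by apply/eqP; rewrite -mdeg_eq0 -leqn0.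
  by rewrite mpolyX0 comp_mpoly1.
have [dm'|] := leqP (mdeg m) d; first exact: IH.
move=> dm'; have {dm dm'} dm : mdeg m = d.+1 by apply/eqP; rewrite eqn_leq dm.
have [i mi] : exists i, m i != 0%N.
  apply/existsP; rewrite -negb_forall; apply: contra_eqN dm => /forallP h.
  by rewrite mdegE big1 // => i _; apply/eqP.
have mE : m = (U_(i) + (m - U_(i)))%MM by rewrite addmC submK // lep1mP.
move: dm; rewrite mE mdegD mdeg1 add1n => -[]; set m' := (m - U_(i))%MM => dm.
rewrite mpolyXD sub_M sub_X mulr_suml raddf_sum /= gauss_mulX.
transitivity (\sum_l (M *m M^T) i l * gauss (shift2 b) (sub ('X_[m'])^`M(l))).
  under eq_bigr do rewrite -scalerAl linearZ /= gauss_mulX mderiv_sub raddf_sum mulr_sumr.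
  rewrite exchange_big; apply: eq_bigr => l _; rewrite mxE mulr_suml.
  by apply: eq_bigr => k _; rewrite /= linearZ /= mxE mulrA.
rewrite MMt (bigD1 i) //= big1 ?addr0 => [|l li]; last first.
  by rewrite mxE eq_sym (negbTE li) mul0r.
rewrite mxE eqxx mul1r mderivX comp_mpolyZ !linearZ /= IH //.
by rewrite -dm (leq_trans (mdegB _ _)).
Qed.
End Substitution.

(** Restriction to a line parallel to an axis shows that the partial derivatives vanish as functions
    as well; the coefficients are, up to nonzero factors, values of iterated derivatives at 0. *)
Lemma mpoly_eval_eq0 (p : P) : (forall v, p.@[v] = 0) -> p = 0.
Proof.
have der (q : P) i : (forall v, q.@[v] = 0) -> forall v, q^`M(i).@[v] = 0.
  move=> q0 v; pose w t j := v j + t * (j == i)%:R.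
  have [Q Qw Qd] : exists2 Q : {poly C}, forall t, Q.[t] = q.@[w t] & Q^`().[0] = q^`M(i).@[v].
    elim/mpoly_ind_alg: q {q0} => [c|j q [Q Qw Qd]|p1 p2 [Q1 Qw1 Qd1] [Q2 Qw2 Qd2]].
    - by exists c%:P; rewrite ?mderivC ?meval0 ?derivC ?horner0 // => t; rewrite hornerC mevalC.
    - exists (((v j)%:P + (j == i)%:R *: 'X) * Q).
        by move=> t; rewrite mevalM mevalXU hornerM Qw hornerD hornerC hornerZ hornerX /w [t * _]mulrC.
      have Q0 : Q.[0] = q.@[v] by rewrite Qw; apply: meval_eq => k; rewrite /w mul0r addr0.
      rewrite derivM mderivM mevalD !mevalM mevalXU mderivXU mevalC.
      rewrite hornerD !hornerM derivD derivC add0r derivZ derivX hornerZ hornerC.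
      by rewrite hornerD hornerC hornerZ hornerX mulr0 addr0 Qd Q0 mulr1.
    - exists (Q1 + Q2); first by move=> t; rewrite hornerD mevalD Qw1 Qw2.
      by rewrite derivD hornerD Qd1 Qd2 mderivD mevalD.
  rewrite -Qd; have -> : Q = 0; last by rewrite deriv0 horner0.
  apply/eqP/negPn/negP => Qn0.
  pose rs := [seq k%:R : C | k <- iota 0 (size Q)].
  have := @max_poly_roots _ Q rs Qn0; rewrite size_map size_iota ltnn.
  have -> : all (root Q) rs by apply/allP => _ /mapP[k _ ->]; rewrite /root Qw q0.
  have -> : uniq rs by rewrite map_inj_uniq ?iota_uniq // => x y /eqP; rewrite eqr_nat => /eqP.
  by move/(_ isT isT).
move=> p0; apply/mpolyP => m; rewrite mcoeff0.
elim: {m}(mdeg m) {-2}m (erefl (mdeg m)) p p0 => [|d IH] m dm p p0.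
  have -> : m = 0%MM by apply/eqP; rewrite -mdeg_eq0 dm.
  rewrite -(p0 (fun=> 0)) mevalE.
  have [h|h] := boolP (0%MM \in msupp p).
    rewrite (bigD1_seq _ h) ?msupp_uniq //= big1 ?mulr1 => [|i _]; last by rewrite mnmE expr0.
    rewrite big1 ?addr0 // => k k0.
    have [i ki] : exists i, k i != 0%N.
      apply/existsP; rewrite -negb_forall; apply: contraNN k0 => /forallP hk.
      by apply/eqP/mnmP => i; rewrite mnmE; apply/eqP.
    by rewrite (bigD1 i) //= expr0n (negbTE ki) mul0r mulr0.
  rewrite (memN_msupp_eq0 h) big_seq big1 // => k ks.
  have [i ki] : exists i, k i != 0%N.
    apply/existsP; rewrite -negb_forall; apply: contraNN h => /forallP hk.
    by rewrite (_ : 0%MM = k) //; apply/mnmP => i; rewrite mnmE; apply/esym/eqP.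
  by rewrite (bigD1 i) //= expr0n (negbTE ki) mul0r mulr0.
have [i mi] : exists i, m i != 0%N.
  apply/existsP; rewrite -negb_forall; apply: contra_eqN dm => /forallP h.
  by rewrite mdegE big1 // => i _; apply/eqP.
have mE : m = ((m - U_(i)) + U_(i))%MM by rewrite submK // lep1mP.
have := mcoeff_mderiv i p (m - U_(i))%MM; rewrite -mE.
rewrite (IH (m - U_(i))%MM) ?(der p) //; last first.
- exact: der.
- by move: dm; rewrite {1}mE mdegD mdeg1 addn1 => -[].
by move/esym/eqP; rewrite mulrn_eq0 /= => /eqP.
Qed.
End Gaussian.

(** * The Gram determinant of two Gaussian vectors *)

Section GramPolynomial.
Import mpoly.
Variables (C : numFieldType) (n : nat).
Local Notation P := {mpoly C[n + n]}.

Definition px (i : 'I_n) : P := 'X_(lshift n i).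
Definition py (i : 'I_n) : P := 'X_(rshift n i).
Local Notation XX := (\sum_i px i * px i).
Local Notation XY := (\sum_i px i * py i).
Local Notation YY := (\sum_i py i * py i).
Definition pgram : P := XX * YY - XY ^+ 2.
(** Half of the partial derivative of [pgram] in the i-th coordinate of x; [wy] is its counterpart
    for y. *)
Definition wx i : P := px i * YY - py i * XY.
Definition wy i : P := py i * XX - px i * XY.

Lemma sum_delta (i : 'I_n) (F : 'I_n -> P) : \sum_k (k == i)%:R%:MP * F k = F i.
Proof.
rewrite (bigD1 i) //= eqxx mul1r big1 ?addr0 // => k ki.
by rewrite (negbTE ki) mpolyC0 mul0r.
Qed.

Local Notation dx i := (fun p : P => p^`M(lshift n i)).
Local Notation dy i := (fun p : P => p^`M(rshift n i)).

Lemma dx_px i j : (px j)^`M(lshift n i) = (j == i)%:R%:MP.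
Proof. by rewrite mderivXU (inj_eq (@lshift_inj _ _)). Qed.
Lemma dx_py i j : (py j)^`M(lshift n i) = 0.
Proof. by rewrite mderivXU eq_rlshift mpolyC0. Qed.
Lemma dy_py i j : (py j)^`M(rshift n i) = (j == i)%:R%:MP.
Proof. by rewrite mderivXU (inj_eq (@rshift_inj _ _)). Qed.
Lemma dy_px i j : (px j)^`M(rshift n i) = 0.
Proof. by rewrite mderivXU eq_lrshift mpolyC0. Qed.

Lemma dx_YY i : YY^`M(lshift n i) = 0.
Proof. by rewrite raddf_sum big1 //= => k _; rewrite mderivM dx_py mul0r mulr0 addr0. Qed.
Lemma dx_XY i : XY^`M(lshift n i) = py i.
Proof.
rewrite raddf_sum -[RHS](sum_delta i) /=; apply: eq_bigr => k _.
by rewrite mderivM dx_py dx_px mulr0 addr0.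
Qed.
Lemma dx_XX i : XX^`M(lshift n i) = px i *+ 2.
Proof.
rewrite raddf_sum -(sum_delta i) -sumrMnl /=; apply: eq_bigr => k _.
by rewrite mderivM dx_px; ring.
Qed.
Lemma dy_XX i : XX^`M(rshift n i) = 0.
Proof. by rewrite raddf_sum big1 //= => k _; rewrite mderivM dy_px mul0r mulr0 addr0. Qed.
Lemma dy_XY i : XY^`M(rshift n i) = px i.
Proof.
rewrite raddf_sum -[RHS](sum_delta i) /=; apply: eq_bigr => k _.
by rewrite mderivM dy_py dy_px mul0r add0r mulrC.
Qed.
Lemma dy_YY i : YY^`M(rshift n i) = py i *+ 2.
Proof.
rewrite raddf_sum -(sum_delta i) -sumrMnl /=; apply: eq_bigr => k _.
by rewrite mderivM dy_py; ring.
Qed.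

Lemma dx_gram i : pgram^`M(lshift n i) = wx i *+ 2.
Proof.
rewrite /pgram mderivB mderivM expr2 mderivM dx_XX dx_YY dx_XY /wx.
by rewrite mulr0 addr0; ring.
Qed.
Lemma dy_gram i : pgram^`M(rshift n i) = wy i *+ 2.
Proof.
rewrite /pgram mderivB mderivM expr2 mderivM dy_XX dy_YY dy_XY /wy.
by rewrite mul0r add0r; ring.
Qed.

Lemma mderivXn i (p : P) k : (p ^+ k)^`M(i) = p ^+ k.-1 * p^`M(i) *+ k.
Proof.
elim: k => [|k IH]; first by rewrite expr0 mulr0n mderivC.
rewrite exprS mderivM IH /=; case: k {IH} => [|k]; first by rewrite mulr0n expr0; ring.
by rewrite /= exprS; ring.
Qed.

Lemma sum_px_wx : \sum_i px i * wx i = pgram.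
Proof.
rewrite /wx /pgram; under eq_bigr do rewrite mulrBr !mulrA.
by rewrite sumrB -!mulr_suml expr2.
Qed.

Lemma sum_py_wy : \sum_i py i * wy i = pgram.
Proof.
rewrite /wy /pgram; under eq_bigr do rewrite mulrBr !mulrA [py _ * px _]mulrC.
by rewrite sumrB -!mulr_suml expr2 [YY * XX]mulrC.
Qed.

Lemma sum_wx_wx : \sum_i wx i * wx i = YY * pgram.
Proof.
transitivity (\sum_i ((px i * px i) * YY ^+ 2 - (px i * py i) * (YY * XY *+ 2) + (py i * py i) * XY ^+ 2)).
  by apply: eq_bigr => i _; rewrite /wx; move: YY XY => a b; ring.
rewrite big_split /= sumrB -!mulr_suml /pgram.
by move: XX XY YY => a b c; ring.
Qed.

Lemma dx_wx i : (wx i)^`M(lshift n i) = YY - py i * py i.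
Proof.
rewrite /wx mderivB !mderivM dx_YY dx_px dx_py dx_XY eqxx.
by rewrite mulr0 addr0 mul0r add0r mul1r.
Qed.

Lemma gauss_natr b (m : nat) (p : P) : gauss b (m%:R * p) = m%:R * gauss b p.
Proof. by rewrite !mulr_natl raddfMn. Qed.

(** The Gram determinant is distributed as a product of independent chi-square variables with n - 1
    and n degrees of freedom, whence the two factors. They come from integration by parts in x, then
    in y. *)
Lemma gauss_gram_step b k : (0 < n)%N -> gauss b (pgram ^+ k.+1) =
  ((n - 1 + 2 * k) * (n + 2 * k))%:R * gauss (shift2 (shift2 b)) (pgram ^+ k).
Proof.
move=> n0; have nE : n%:R = (n - 1)%:R + 1 :> P by rewrite subn1 -[X in _ + X]/(1%:R) -natrD addn1 prednK.
have gk (q : P) : q * (pgram ^+ k.-1 * pgram) *+ k = q * pgram ^+ k *+ k.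
  by case: k => [|k]; rewrite ?mulr0n //= -exprSr.
have e1 : gauss b (pgram ^+ k.+1) = (n - 1 + 2 * k)%:R * gauss (shift2 b) (YY * pgram ^+ k).
  rewrite exprS -{1}sum_px_wx mulr_suml raddf_sum /=.
  under eq_bigr do rewrite -mulrA gauss_mulX.
  rewrite -raddf_sum /= -gauss_natr; congr (gauss _ _).
  transitivity (\sum_i (YY * pgram ^+ k - (py i * py i) * pgram ^+ k
      + (wx i * wx i) * (pgram ^+ k.-1 *+ 2 *+ k))).
    apply: eq_bigr => i _; rewrite mderivM mderivXn dx_gram dx_wx.
    by move: (wx i) YY (py i) (pgram ^+ k) (pgram ^+ k.-1) => w a y g h; ring.
  rewrite big_split /= sumrB -!mulr_suml sum_wx_wx sumr_const card_ord.
  rewrite -[_ *+ n]mulr_natl nE.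
  have -> : YY * pgram * (pgram ^+ k.-1 *+ 2 *+ k) = YY * pgram ^+ k *+ k *+ 2.
    by rewrite -gk; move: YY pgram (pgram ^+ k.-1) => a g h; move: (k%:R : P) => u; ring.
  rewrite natrD natrM; move: YY (pgram ^+ k) ((n - 1)%:R : P) => a g v; ring.
rewrite e1 natrM -mulrA; congr (_ * _).
rewrite mulr_suml raddf_sum /=.
under eq_bigr do rewrite -mulrA gauss_mulX.
rewrite -raddf_sum /= -gauss_natr; congr (gauss _ _).
transitivity (\sum_i (pgram ^+ k + (py i * wy i) * (pgram ^+ k.-1 *+ 2 *+ k))).
  apply: eq_bigr => i _; rewrite mderivM mderivXn dy_gram dy_py eqxx mul1r; congr (_ + _).
  by move: (wy i) (py i) (pgram ^+ k.-1) => w y h; ring.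
rewrite big_split /= -!mulr_suml sum_py_wy sumr_const card_ord.
have -> : pgram * (pgram ^+ k.-1 *+ 2 *+ k) = pgram ^+ k *+ k *+ 2.
  have := gk 1; rewrite !mul1r => <-.
  by move: pgram (pgram ^+ k.-1) => g h; move: (k%:R : P) => u; ring.
by rewrite natrD natrM -[_ *+ n]mulr_natr; move: (pgram ^+ k) (n%:R : P) => g v; ring.
Qed.

Fixpoint gram_moment k : nat :=
  if k is k'.+1 then (n - 1 + 2 * k') * (n + 2 * k') * gram_moment k' else 1.

Lemma gram_moment_gt0 k : (1 < n)%N -> (0 < gram_moment k)%N.
Proof.
move=> n1; elim: k => //= k IH; rewrite !muln_gt0 IH andbT !addn_gt0 subn_gt0 n1 /=.
by rewrite ltnW.
Qed.

Lemma gauss_gram b k : (0 < n)%N ->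
  gauss b (pgram ^+ k) = (gram_moment k)%:R * b (4 * k)%N.
Proof.
move=> n0; elim: k b => [|k IH] b.
  rewrite expr0 -mpolyX0 gaussX mdeg0 muln0 big1 ?mulr1 ?mul1r // => i _.
  by rewrite mnmE.
by rewrite gauss_gram_step // IH mulnS mulrA -natrM.
Qed.
End GramPolynomial.

(** * Existence of the invariant distribution *)

Section Average.
Import mpoly.
Variables (R : realType) (N : nat).
Local Notation C := R[i].
Local Notation V := 'cV[C]_N.
Local Notation G := (SO R N).
Local Notation OG := (regfun R N).
Local Notation D := (dist R N).
Local Notation P := {mpoly C[N + N]}.

Definition pt (x y : V) (k : 'I_(N + N)) : C :=
  match fintype.split k with inl i => x i 0 | inr j => y j 0 end.

Lemma pt_px x y i : (px C i).@[pt x y] = x i 0.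
Proof.
by rewrite mevalXU /pt; case: split_ordP => j /eqP; rewrite ?eq_lrshift // => /eqP/lshift_inj ->.
Qed.

Lemma pt_py x y i : (py C i).@[pt x y] = y i 0.
Proof.
by rewrite mevalXU /pt; case: split_ordP => j /eqP; rewrite ?eq_rlshift // => /eqP/rshift_inj ->.
Qed.

Lemma pt_surj v : exists x y, pt x y =1 v.
Proof.
exists (\col_i v (lshift N i)), (\col_i v (rshift N i)) => k.
by rewrite /pt; case: split_ordP => i ->; rewrite mxE.
Qed.

Lemma meval_sum v I (r : seq I) (F : I -> P) :
  (\sum_(i <- r) F i).@[v] = \sum_(i <- r) (F i).@[v].
Proof. exact: raddf_sum. Qed.

Lemma so_formE (x y : V) : so_form x y = \sum_i x i 0 * y i 0.
Proof. by rewrite /so_form mxE; apply: eq_bigr => i _; rewrite mxE. Qed.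

Lemma pt_gram x y : (pgram C N).@[pt x y] = gram x y.
Proof.
rewrite /pgram /gram mevalB rmorphXn /= mevalM !meval_sum !so_formE.
by congr (_ * _ - _ ^+ 2); apply: eq_bigr => i _; rewrite mevalM ?pt_px ?pt_py.
Qed.

(* The functions of a rotation a, x, y, written P0 + a P1 with polynomials P0
   and P1 in x and y; the part P0 is the mean of f over g and g^-1. *)
Definition rot_rep (f : G -> C) (P0 P1 : P) : Prop :=
  forall a x y (h : a ^+ 2 + gram x y = 1),
    f (rot h) = P0.@[pt x y] + a * P1.@[pt x y].

(** Every pair (x, y) admits a square root a of 1 - gram x y, and -a is another one; adding both
    values isolates the even part. *)
Lemma rot_rep_unique f P0 P1 Q0 Q1 : rot_rep f P0 P1 -> rot_rep f Q0 Q1 -> P0 = Q0.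
Proof.
move=> hP hQ; apply/eqP; rewrite -subr_eq0; apply/eqP/mpoly_eval_eq0 => v.
have [x [y xy]] := pt_surj v; rewrite -(meval_eq _ xy) mevalB.
pose a := sqrtC (1 - gram x y).
have ha : a ^+ 2 + gram x y = 1 by rewrite sqrtCK subrK.
have hb : (- a) ^+ 2 + gram x y = 1 by rewrite sqrrN.
have e1 := hP _ _ _ ha; rewrite (hQ _ _ _ ha) in e1.
have e2 := hP _ _ _ hb; rewrite (hQ _ _ _ hb) in e2.
apply: (@mulrSn_eq0 R _ 1); rewrite -[RHS](subrr (P0.@[pt x y] + a * P1.@[pt x y])) -{2}e1.
apply/eqP; rewrite -subr_eq0 -[X in _ == X](subrr (P0.@[pt x y] + (- a) * P1.@[pt x y])) -{2}e2.
by apply/eqP; ring.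
Qed.

Definition pom i j : P := px C i * py C j - py C i * px C j.

Lemma pt_pom x y i j : (pom i j).@[pt x y] = bivec x y i j.
Proof.
rewrite mevalB !mevalM !pt_px !pt_py /bivec !mxE !big_ord1 !mxE.
by [].
Qed.

(** The expressions P0 + a P1 are stable under products because a^2 = 1 - gram. *)
Lemma rot_rep_ex f : regular f -> exists P0 P1, rot_rep f P0 P1.
Proof.
move: f; apply: regular_ind.
- move=> a; exists a%:MP, 0 => b x y h.
  by rewrite mevalC meval0 mulr0 addr0.
- move=> i j.
  exists ((i == j)%:R%:MP + 2 *: \sum_k pom i k * pom k j), (2 *: pom i j) => a x y h.
  rewrite mevalD mevalC !mevalZ meval_sum pt_pom /= /rot_mx /quad !mxE.
  rewrite [\sum_k (pom i k * pom k j).@[_]](eq_bigr (fun k => bivec x y i k * bivec x y k j)).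
    by rewrite -mulr_natr mul1r; ring.
  by move=> k _; rewrite mevalM !pt_pom.
- move=> f1 f2 [P0 [P1 e1]] [Q0 [Q1 e2]]; exists (P0 + Q0), (P1 + Q1) => a x y h.
  by rewrite !mevalD e1 e2; ring.
- move=> f1 f2 [P0 [P1 e1]] [Q0 [Q1 e2]].
  exists (P0 * Q0 + (1 - pgram C N) * (P1 * Q1)), (P0 * Q1 + P1 * Q0) => a x y h.
  have eg : (1 - pgram C N).@[pt x y] = a ^+ 2 by rewrite mevalB meval1 pt_gram -h addrK.
  rewrite e1 e2 !mevalD (mevalM _ (1 - pgram C N)) eg !mevalM; ring.
Qed.

Definition even_part (f : OG) : P := projT1 (cid (rot_rep_ex (regfun_regular f))).

Lemma even_partP (f : OG) : exists P1, rot_rep f (even_part f) P1.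
Proof. exact: (projT2 (cid (rot_rep_ex (regfun_regular f)))). Qed.

Lemma even_partE (f : OG) P0 P1 : rot_rep f P0 P1 -> even_part f = P0.
Proof. by move=> h; have [Q1 hQ] := even_partP f; exact: rot_rep_unique hQ h. Qed.

Variable b : nat -> C.

Fact average_scalar : scalar (fun f => gauss b (even_part f)).
Proof.
move=> a f h; have [P1 hP] := even_partP f; have [Q1 hQ] := even_partP h.
rewrite (@even_partE _ (a *: even_part f + even_part h) (a *: P1 + Q1)).
  exact: gauss_linear.
move=> c x y e; rewrite regfunDE regfunZE hP hQ !mevalD !mevalZ; ring.
Qed.

Definition average : D := mk_dist average_scalar.

Lemma average_eq (f h : OG) : (forall a x y (e : a ^+ 2 + gram x y = 1), f (rot e) = h (rot e)) ->
  dist_fun average f = dist_fun average h.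
Proof.
move=> fh; have [P1 hP] := even_partP f; rewrite !mk_distE; congr (gauss _ _).
by apply/esym/even_partE => a x y e; rewrite -fh; exact: hP.
Qed.

Lemma rank_rot a (x y : V) (e : a ^+ 2 + gram x y = 1) : in_S (rot e).
Proof.
rewrite /in_S /= /rot_mx /quad.
have -> : 1%:M - (1%:M + (2 * a) *: bivec x y + 2 *: (bivec x y *m bivec x y)) =
   - bivec x y *m ((2 * a)%:M + 2 *: bivec x y).
  by rewrite mulmxDr mul_mx_scalar -scalemxAr mulNmx scalerN scalerN opprD opprD !addrA subrr sub0r.
apply: leq_trans (mxrankM_maxl _ _) _; rewrite mxrank_opp /bivec.
apply: leq_trans (mxrank_add _ _) _; rewrite mxrank_opp (@leq_add _ _ 1 1) //.
  by apply: leq_trans (mxrankM_maxl _ _) _; exact: rank_leq_col.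
by apply: leq_trans (mxrankM_maxl _ _) _; exact: rank_leq_col.
Qed.

Lemma average_supported : supported_on_S average.
Proof.
move=> f f0; rewrite -[RHS](dist_fun0 average); apply: average_eq => a x y e.
by rewrite f0 //; exact: rank_rot.
Qed.

Lemma pt_sub (g : G) P0 x y :
  (P0 \mPo lin_sub (block_mx (so_val g) 0 0 (so_val g))).@[pt x y] = P0.@[pt (so_val g *m x) (so_val g *m y)].
Proof.
rewrite comp_mpoly_meval; apply: meval_eq => k; rewrite tnth_mktuple meval_sum.
under eq_bigr do rewrite mevalZ mevalXU.
rewrite big_split_ord /= /pt; case: split_ordP => i ->.
  rewrite mxE [X in _ + X]big1 ?addr0 => [|j _]; last by rewrite block_mxEur mxE mul0r.
  apply: eq_bigr => j _; rewrite block_mxEul; congr (_ * _).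
  by case: split_ordP => k' /eqP; rewrite ?eq_lrshift // => /eqP/lshift_inj ->.
rewrite mxE big1 ?add0r => [|j _]; last by rewrite block_mxEdl mxE mul0r.
apply: eq_bigr => j _; rewrite block_mxEdr; congr (_ * _).
by case: split_ordP => k' /eqP; rewrite ?eq_rlshift // => /eqP/rshift_inj ->.
Qed.

Lemma so_form_so (g : G) (x y : V) : so_form (so_val g *m x) (so_val g *m y) = so_form x y.
Proof. by rewrite /so_form trmx_mul mulmxA -[X in X *m y]mulmxA so_trmul mulmx1. Qed.

Lemma bivec_so (g : G) x y : bivec (so_val g *m x) (so_val g *m y) = so_val g *m bivec x y *m (so_val g)^T.
Proof. by rewrite /bivec !trmx_mul mulmxBr mulmxBl !mulmxA. Qed.

(** Conjugation by g carries the rotation of (a, x, y) to that of (a, g x, g y), an orthogonal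
    substitution of the 2 N variables. *)
Lemma average_invariant : conj_invariant average.
Proof.
move=> g; apply: distP => f.
have [P1 hP] := even_partP f.
pose M := block_mx (so_val g) 0 0 (so_val g).
have MMt : M *m M^T = 1%:M.
  rewrite tr_block_mx mulmx_block !trmx0 !mulmx0 !mul0mx !addr0 add0r so_multr.
  by rewrite -scalar_mx_block.
have -> : dist_fun (act_conj g average) f = gauss b (even_part (conj_fun g f)) by [].
rewrite (@even_partE _ (even_part f \mPo lin_sub M) (P1 \mPo lin_sub M)).
  by rewrite gauss_sub.
move=> a x y e.
have e' : a ^+ 2 + gram (so_val g *m x) (so_val g *m y) = 1 by rewrite /gram !so_form_so.
transitivity ((even_part f).@[pt (so_val g *m x) (so_val g *m y)] + a * P1.@[pt (so_val g *m x) (so_val g *m y)]); last first.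
  by congr (_ + _ * _); apply/esym; exact: pt_sub.
rewrite -(hP _ _ _ e').
suff -> : rot e' = (g * (rot e * g^-1))%g by [].
apply: val_inj => /=.
rewrite /rot_mx /quad bivec_so.
have -> : so_val g *m bivec x y *m (so_val g)^T *m (so_val g *m bivec x y *m (so_val g)^T)
    = so_val g *m (bivec x y *m bivec x y) *m (so_val g)^T.
  by rewrite !mulmxA -(mulmxA (so_val g *m bivec x y) _ (so_val g)) so_trmul mulmx1.
move: (bivec x y) => w.
by rewrite !mulmxDl !mulmxDr -!scalemxAl -!scalemxAr mul1mx so_multr !mulmxA.
Qed.

Lemma tr_bivec (x y : V) : \tr (bivec x y) = 0.
Proof.
have := mxtrace_tr (bivec x y); rewrite bivec_tr raddfN /= => e.
by apply: (@mulrSn_eq0 R _ 1); rewrite mulr2n -{1}e addNr.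
Qed.

Lemma tr_bivec_sqr (x y : V) : \tr (bivec x y *m bivec x y) = - (gram x y *+ 2).
Proof.
have trf (u v : V) : \tr (u *m v^T) = so_form v u.
  by rewrite mxtrace_mulC /so_form /mxtrace big_ord1.
rewrite {2}/bivec mulmxBr !mulmxA raddfB /= !trf !bivec_mul.
rewrite so_formC [X in _ - X]so_formC.
have E (a c : C) (u v w : V) : so_form (a *: u - c *: v) w = a * so_form u w - c * so_form v w.
  by rewrite -scaleNr so_formDl !so_formZl mulNr.
by rewrite !E (so_formC y x) /gram; ring.
Qed.

Lemma ev_tau (g : G) : tau R N g = \tr (1%:M - so_val g).
Proof. by rewrite -map_amx trace_map_mx. Qed.

Lemma tau_rot a x y (e : a ^+ 2 + gram x y = 1) : tau R N (rot e) = 4 * gram x y.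
Proof.
rewrite ev_tau /= /rot_mx /quad.
have -> : 1%:M - (1%:M + (2 * a) *: bivec x y + 2 *: (bivec x y *m bivec x y)) =
   - (2 * a) *: bivec x y - 2 *: (bivec x y *m bivec x y).
  by rewrite !opprD !addrA subrr sub0r scaleNr.
by rewrite raddfB /= !mxtraceZ tr_bivec tr_bivec_sqr; ring.
Qed.

Definition trp2 : OG := \tr (bmx R N true *m bmx R N true).

(** On these rotations p = -4 a w, tr (w^2) = -2 gram and tau = 4 gram, with a^2 = 1 - gram. *)
Lemma trp2_rot a x y (e : a ^+ 2 + gram x y = 1) :
  trp2 (rot e) = (tau R N * (tau R N - 4)) (rot e) *+ 2.
Proof.
have -> : (tau R N * (tau R N - 4)) (rot e) = 4 * gram x y * (4 * gram x y - 4).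
  by rewrite -(tau_rot e).
rewrite -[LHS]/(ev (rot e) _) /trp2 -trace_map_mx map_mxM map_bmx map_amx /=.
have wt := bivec_tr x y.
have -> : 1%:M - rot_mx a x y - (1%:M - rot_mx a x y)^T = (- (4 * a)) *: bivec x y.
  rewrite [(1%:M - _)^T]raddfB /= trmx1 /rot_mx (quad_tr wt) /quad.
  by move: (bivec x y) (bivec x y *m bivec x y) => w w2; apply/matrixP => i j; rewrite !mxE; ring.
rewrite -scalemxAl -scalemxAr scalerA mxtraceZ tr_bivec_sqr.
have -> : gram x y = 1 - a ^+ 2 by rewrite -e addrC addKr.
ring.
Qed.
End Average.

Section Existence.
Import mpoly.
Variables (R : realType) (N : nat).
Local Notation C := R[i].
Local Notation D := (dist R N).

Lemma exists_invariant (b : nat -> C) : (1 < N)%N -> exists c : D,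
  [/\ conj_invariant c, supported_on_S c,
      forall k, dist_fun c (tau R N ^+ k) = b k
    & forall f, dist_fun c (trp2 R N * f) = dist_fun c (tau R N * (tau R N - 4) * f) *+ 2].
Proof.
move=> N1.
(* [pgram ^ k] has degree 4 k and unweighted mean [gram_moment N k], and tau is 4 times the Gram
   determinant: the weight in degree 4 k is normalized by both. *)
pose d k := b k / (4 ^+ k * (gram_moment N k)%:R).
exists (average N (fun k => d (k %/ 4)%N)); split.
- exact: average_invariant.
- exact: average_supported.
- move=> k; rewrite mk_distE (@even_partE _ _ _ (4 ^+ k *: pgram C N ^+ k) 0).
    rewrite gaussZ gauss_gram; last exact: ltnW.
    rewrite mulKn // /d mulrC.
    have n0 : (gram_moment N k)%:R != 0 :> C by rewrite pnatr_eq0 -lt0n gram_moment_gt0.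
    have n4 : 4 ^+ k != 0 :> C by rewrite expf_neq0 // pnatr_eq0.
    by rewrite mulrC mulrA mulrC mulfVK // mulf_neq0.
  move=> a x y e; rewrite meval0 mulr0 addr0 mevalZ rmorphXn /= pt_gram.
  rewrite -[LHS]/(ev (rot e) _) rmorphXn /= /ev tau_rot exprMn //.
- move=> f; rewrite -dist_funMn; apply: average_eq => a x y e.
  rewrite regfunMnE !regfunME trp2_rot regfunME. ring.
Qed.
End Existence.

(** All forms involved are pulled back by [W] from a space of dimension at most 2, where 3-forms
    vanish. *)
Lemma wedge_rank2 (F : numFieldType) N r (L : 'M[F]_(N, r)) (W : 'M[F]_(r, N)) (Q : 'M[F]_r) :
  (r <= 2)%N -> Q^T = - Q -> forall u x y z,
  (L *m W) u z * (W^T *m Q *m W) x y + (L *m W) u x * (W^T *m Q *m W) y z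
  + (L *m W) u y * (W^T *m Q *m W) z x = 0.
Proof.
move=> r2 Qs u x y z.
have Qij i j : Q i j = - Q j i by have /matrixP/(_ j i) := Qs; rewrite !mxE.
have Q0 i : Q i i = 0.
  have := Qij i i; move/eqP; rewrite -addr_eq0 -mulr2n mulrn_eq0 /= => /eqP //.
have E a b : (W^T *m Q *m W) a b = \sum_i \sum_j Q j i * (W j a * W i b).
  rewrite mxE; apply: eq_bigr => i _; rewrite mxE mulr_suml.
  by apply: eq_bigr => j _; rewrite mxE; ring.
rewrite !E !mxE {E}; case: r L W Q {Qs} r2 Qij Q0 => [|[|[|r]]] L W Q // _ Qij Q0.
- by rewrite !big_ord0; ring.
- by rewrite !big_ord_recl !big_ord0 !Q0; ring.
- rewrite !big_ord_recl !big_ord0 !Q0 (Qij (lift ord0 ord0) ord0).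
  move: (W _ x) (W ord0 x) (W _ y) (W ord0 y) (W _ z) (W ord0 z) => a b c d e f.
  by move: (Q _ _) (L _ _) (L _ _) => q l1 l2; ring.
Qed.

(** A skew matrix whose rows lie in the row space of [W] has its columns there too, so it is W^T Q W
    with Q skew. *)
Lemma wedge_factor (F : numFieldType) N r (L Z : 'M[F]_(N, r)) (W : 'M[F]_(r, N))
    (W' : 'M[F]_(N, r)) (p : 'M[F]_N) :
  (r <= 2)%N -> W *m W' = 1%:M -> p = Z *m W -> p^T = - p -> forall u x y z,
  (L *m W) u z * p x y + (L *m W) u x * p y z + (L *m W) u y * p z x = 0.
Proof.
move=> r2 WW' pZ ps.
have pW : p *m W' *m W = p by rewrite pZ -!mulmxA (mulmxA W) WW' mul1mx.
have Wp : W^T *m W'^T *m p = p.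
  apply: oppr_inj; rewrite -mulmxN -ps -trmx_mul -trmx_mul; congr (_^T).
  by rewrite mulmxA pW.
pose Q := W'^T *m p *m W'.
have Qs : Q^T = - Q by rewrite /Q !trmx_mul trmxK ps mulNmx mulmxN mulmxA.
have -> : p = W^T *m Q *m W by rewrite /Q !mulmxA Wp pW.
exact: wedge_rank2.
Qed.

(** * Distributions on S and solutions of the Jacobi identity *)

Section Invariants.
Variables (R : realType) (N : nat).
Local Notation C := R[i].
Local Notation V := 'cV[C]_N.
Local Notation G := (SO R N).
Local Notation D := (dist R N).
Local Notation "f \> mu" := (act_fun f mu) (at level 38, right associativity).
Local Notation bmx := (@bmx R N).
Local Notation amx := (@amx R N).
Local Notation tau := (tau R N).

Lemma in_S_wedge (g : G) u x y z : in_S g ->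
  amx u z g * bmx true x y g + amx u x g * bmx true y z g + amx u y g * bmx true z x g = 0.
Proof.
move=> gS; pose M := 1%:M - so_val g.
have aE i j : amx i j g = M i j.
  by have /matrixP/(_ i j) := map_amx g; rewrite mxE.
have bE i j : bmx true i j g = (M - M^T) i j.
  by have /matrixP/(_ i j) := map_bmx true g; rewrite mxE map_amx.
rewrite !aE !bE.
(* Orthogonality puts the rows of M^T, hence those of p, into the row space of M, whose dimension is
   at most 2 on S. *)
have MT : M^T = - ((so_val g)^T *m M).
  by rewrite /M raddfB /= trmx1 mulmxBr mulmx1 so_trmul opprB.
have [W' WW'] : exists B, row_base M *m B = 1%:M by apply/row_freeP/row_base_free.
have ME : M = col_base M *m row_base M by rewrite mulmx_base.
have pZ : M - M^T = ((1%:M + (so_val g)^T) *m col_base M) *m row_base M.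
  by rewrite MT opprK -mulmxA -ME mulmxDl mul1mx.
have tB (B : 'M[C]_N) : (B - B^T)^T = - (B - B^T) by rewrite raddfB /= trmxK opprB.
have ps := tB M.
have := wedge_factor (col_base M) gS WW' pZ ps u x y z.
by rewrite -ME.
Qed.

Definition pair_fam (c : D) i j : D := bmx true i j \> c.

Lemma pair_fam_skew c : skew_fam (pair_fam c).
Proof. by move=> x y; rewrite /pair_fam -act_funNl bmx_tr expr1 mulN1r. Qed.

Lemma pair_fam_jacobi c : supported_on_S c -> jacobi (pair_fam c).
Proof.
move=> cS u x y z; rewrite /pair_fam -!act_funM -!act_funDl; apply: distP => f.
rewrite act_funE dist_zero cS // => g gS.
by rewrite regfunME -[X in X * _]/(amx u z g * bmx true x y g + amx u x g * bmx true y z g + amx u y g * bmx true z x g)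
  in_S_wedge // mul0r.
Qed.

Lemma pair_fam_equiv c : conj_invariant c -> equivariant_fam (pair_fam c).
Proof.
move=> ci g k l f; rewrite -{1}(ci g) /pair_fam.
have -> : dist_fun (bmx true k l \> act_conj g c) f = dist_fun c (conj_fun g (bmx true k l) * conj_fun g f).
  by rewrite -conj_funM.
rewrite conj_bmx mulr_suml dist_fun_sum; apply: eq_bigr => p _.
rewrite regfun_scaleA dist_funZ mulr_suml dist_fun_sum mulr_sumr; apply: eq_bigr => q _.
by rewrite regfun_scaleA dist_funZ mulrA.
Qed.

Lemma trs_pair_fam c : trs (pair_fam c) = trp2 R N \> c.
Proof.
rewrite /trs /trp2 /mxtrace act_fun_suml; apply: eq_bigr => k _.
by rewrite mxE act_fun_suml; apply: eq_bigr => j _; rewrite act_funM.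
Qed.

Definition basis_fam (kappa : V -> V -> D) i j : D := kappa (delta_mx i 0) (delta_mx j 0).

(** The signs agree: p = A - A^T = g^T - g, and its entry (i, j) is the entry (j, i) of g - g^T,
    which pairs e_i with e_j. *)
Lemma pairing_fun_expand x y : pairing_fun x y =
  \sum_i \sum_j (x i 0 * y j 0) *: bmx true i j.
Proof.
apply: regfunP => g; transitivity (\sum_i \sum_j (x i 0 * y j 0) * bmx true i j g).
  rewrite exchange_big /= so_formE; apply: eq_bigr => j _.
  rewrite mxE mulr_suml; apply: eq_bigr => i _.
  have -> : bmx true i j g = (so_val g - so_val g^-1%g) j i.
    have /matrixP/(_ i j) := map_bmx true g; rewrite mxE map_amx => e.
    by rewrite -[LHS]/(ev g (bmx true i j)) e !mxE [j == i]eq_sym; ring.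
  ring.
rewrite -[RHS]/(ev g _) raddf_sum; apply: eq_bigr => i _.
by rewrite /= -[RHS]/(ev g _) raddf_sum; apply: eq_bigr => j _.
Qed.

Section Bilinear.
Variable kappa : {bilinear V -> V -> D}.

Lemma basis_expand (x y : V) : kappa x y = \sum_i \sum_j (x i 0 * y j 0) *: basis_fam kappa i j.
Proof.
have E (z : V) : z = \sum_i z i 0 *: delta_mx i 0.
  by rewrite {1}(matrix_sum_delta z); apply: eq_bigr => i _; rewrite big_ord1.
rewrite {1}(E x) {1}(E y) linear_sumlz; apply: eq_bigr => i _.
rewrite linearZl_LR linear_sum scaler_sumr; apply: eq_bigr => j _ /=.
by rewrite linearZr_LR scalerA.
Qed.

Lemma basis_fam_skew : skew_symmetric kappa -> skew_fam (basis_fam kappa).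
Proof. by move=> ks x y; rewrite /basis_fam ks. Qed.

Lemma basis_fam_equiv : equivariant kappa -> equivariant_fam (basis_fam kappa).
Proof.
move=> ke g k l f.
have E i : delta_mx i 0 = so_val g *m ((so_val g)^T *m delta_mx i 0) :> V.
  by rewrite mulmxA so_multr mul1mx.
rewrite {1}/basis_fam (E k) (E l) ke.
rewrite -[LHS]/(dist_fun (kappa _ _) (conj_fun g f)) basis_expand dist_sum.
have F i j : ((so_val g)^T *m delta_mx i 0 : V) j 0 = so_val g i j.
  rewrite mxE (bigD1 i) //= !mxE !eqxx mulr1 big1 ?addr0 // => m mi.
  by rewrite !mxE (negbTE mi) mulr0.
apply: eq_bigr => k' _; rewrite dist_sum; apply: eq_bigr => l' _.
by rewrite distZ !F.
Qed.

Theorem exists_invariant_of_jacobi : (2 < N)%N -> skew_symmetric kappa ->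
  equivariant kappa -> jacobi (basis_fam kappa) ->
  exists c : D, [/\ conj_invariant c, supported_on_S c
    & forall x y, kappa x y = pairing_fun x y \> c].
Proof.
move=> N3 ks ke kj; pose K := basis_fam kappa.
(* As tr (p^2) acts on c like 2 tau (tau - 4), the traces of K and p c agree if 2 b (n + 2) - 8 b (n
   + 1) is the n-th moment of [trs K]. The first two values are set to 0, and [bb] carries two
   consecutive ones. *)
pose bb := fix bb n : C * C := if n is n'.+1 then
   let b := bb n' in (b.2, (dist_fun (trs K) (tau ^+ n') + 8 * b.2) / 2) else (0, 0).
pose b n := (bb n).1.
have bE n : b n.+2 *+ 2 = dist_fun (trs K) (tau ^+ n) + 8 * b n.+1.
  by rewrite /b /= -[LHS]mulr_natr divfK // pnatr_eq0.
have [c [ci cS ct cp]] := exists_invariant b (ltnW N3).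
exists c; split=> //.
have Ks : skew_fam K := basis_fam_skew ks.
have Ke : equivariant_fam K := basis_fam_equiv ke.
have Kj : jacobi K := kj.
have Kn : null_fam (fun i j => K i j - pair_fam c i j).
  split.
  - by move=> x y; rewrite Ks (pair_fam_skew c x) opprB opprK addrC.
  - move=> u x y z; rewrite !act_funDr !act_funNr.
    have E (a1 a2 a3 b1 b2 b3 : D) : a1 - b1 + (a2 - b2) + (a3 - b3) = a1 + a2 + a3 - (b1 + b2 + b3).
      by rewrite !opprD (addrACA a1) (addrACA (a1 + a2)).
    by rewrite E Kj pair_fam_jacobi // subrr.
  - move=> g k l f; rewrite distD distN (Ke g) (pair_fam_equiv ci g).
    rewrite -sumrB; apply: eq_bigr => k' _; rewrite -sumrB; apply: eq_bigr => l' _.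
    by rewrite distD distN mulrBr.
  - move=> n.
    have -> : trs (fun i j => K i j - pair_fam c i j) = trs K - trs (pair_fam c).
      rewrite /trs -sumrB; apply: eq_bigr => k _; rewrite /sfam -sumrB; apply: eq_bigr => j _.
      by rewrite act_funDr act_funNr.
    rewrite distD distN trs_pair_fam act_funE cp.
    have -> : tau * (tau - 4) * tau ^+ n = tau ^+ n.+2 - tau ^+ n.+1 *+ 4.
      by rewrite !exprS; ring.
    by rewrite dist_funD dist_funN dist_funMn !ct mulrnBl bE; ring.
have KE := null_fam_eq0 N3 Kn.
move=> x y; rewrite basis_expand pairing_fun_expand act_fun_suml; apply: eq_bigr => i _.
rewrite act_fun_suml; apply: eq_bigr => j _.
have -> : basis_fam kappa i j = pair_fam c i j.
  by apply/eqP; rewrite -subr_eq0; apply/eqP; exact: KE.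
by apply: distP => f; rewrite distZ !act_funE regfun_scaleA dist_funZ.
Qed.

Lemma jacobi_of_invariant c : supported_on_S c ->
  (forall x y, kappa x y = pairing_fun x y \> c) -> jacobi (basis_fam kappa).
Proof.
move=> cS kE.
suff E x y : basis_fam kappa x y = pair_fam c x y.
  by move=> u x y z; rewrite !E; exact: pair_fam_jacobi.
rewrite /basis_fam kE /pair_fam; congr (_ \> _).
rewrite pairing_fun_expand (bigD1 x) //= (bigD1 y) //= !mxE !eqxx mulr1 scale1r.
rewrite big1 => [|j jy]; last by rewrite !mxE (negbTE jy) mulr0 scale0r.
rewrite big1 ?addr0 // => i ix; rewrite big1 // => j _.
by rewrite !mxE (negbTE ix) mul0r scale0r.
Qed.
End Bilinear.
End Invariants.

(** * Rewriting to normal form *)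

Section Twist.
Variables (R : realType) (N : nat).
Local Notation C := R[i].
Local Notation OG := (regfun R N).
Local Notation D := (dist R N).
Local Notation "f \> mu" := (act_fun f mu) (at level 38, right associativity).
Local Notation word := (seq 'I_N).

Lemma distZl (a : C) (mu nu : D) : (a *: mu) * nu = a *: (mu * nu).
Proof. exact: distP. Qed.

Lemma integrateZ (a : C) (nu : D) f : integrate (a *: nu) f = a *: integrate nu f.
Proof. exact: regfunP. Qed.

Lemma distZr (a : C) (mu nu : D) : mu * (a *: nu) = a *: (mu * nu).
Proof.
apply: distP => f; rewrite distZ.
rewrite -[LHS]/(dist_fun mu (integrate (a *: nu) f)) integrateZ dist_funZ.
by [].
Qed.

Lemma act_funZr f (a : C) (mu : D) : f \> (a *: mu) = a *: (f \> mu).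
Proof. exact: distP. Qed.

Definition tact (j i : 'I_N) (mu : D) : D := entry R j i \> mu.

Lemma tactD j i mu nu : tact j i (mu + nu) = tact j i mu + tact j i nu.
Proof. exact: act_funDr. Qed.

Lemma tactZ j i a mu : tact j i (a *: mu) = a *: tact j i mu.
Proof. exact: act_funZr. Qed.

Lemma tactC j i k l mu : tact j i (tact k l mu) = tact k l (tact j i mu).
Proof. by rewrite /tact -!act_funM mulrC. Qed.

(** The coproduct of the matrix entry g_ki is the sum over l of the tensors of g_kl and g_li. *)
Lemma tactM k i mu nu : tact k i (mu * nu) = \sum_l tact k l mu * tact l i nu.
Proof.
apply: distP => f; rewrite dist_sum.
rewrite -[LHS]/(dist_fun mu (integrate nu (entry R k i * f))).
have -> : integrate nu (entry R k i * f) = \sum_l entry R k l * integrate (tact l i nu) f.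
  apply: regfunP => g; transitivity (dist_fun nu (\sum_l so_val g k l *: (entry R l i * translate g f))).
    rewrite -[LHS]/(dist_fun nu _); congr (dist_fun nu _); apply: regfunP => h.
    rewrite -[RHS]/(ev h _) raddf_sum.
    transitivity (\sum_l so_val g k l * (so_val h l i * f (g * h)%g)); last by apply: eq_bigr.
    rewrite -[LHS]/((so_val g *m so_val h) k i * f (g * h)%g) mxE mulr_suml.
    by apply: eq_bigr => l _; rewrite mulrA.
  rewrite dist_fun_sum -[RHS]/(ev g _) raddf_sum; apply: eq_bigr => l _.
  by rewrite dist_funZ.
by rewrite dist_fun_sum; apply: eq_bigr.
Qed.

Lemma tact1 j i : tact j i 1 = (j == i)%:R *: (1 : D).
Proof.
apply: distP => f; rewrite distZ -[LHS]/((entry R j i * f) 1%g) regfunME.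
by rewrite -[X in X * _]/((1%:M : 'M[C]_N) j i) mxE.
Qed.

(* The coefficient at the word w of the right action of mu on a family L of
   distributions indexed by words:
   sum over the words v of the length of w of L v * (v^*, g w) mu. *)
Fixpoint tw (w : word) (mu : D) (L : word -> D) : D :=
  if w is i :: w' then \sum_j tw w' (tact j i mu) (fun v => L (j :: v)) else L [::] * mu.

Lemma tw_ext w mu L L' : (forall v, size v = size w -> L v = L' v) -> tw w mu L = tw w mu L'.
Proof.
elim: w mu L L' => [|i w IH] mu L L' e /=; first by rewrite e.
by apply: eq_bigr => j _; apply: IH => v sv; apply: e; rewrite /= sv.
Qed.

Lemma twDl w mu nu L : tw w (mu + nu) L = tw w mu L + tw w nu L.
Proof.
elim: w mu nu L => [|i w IH] mu nu L /=; first exact: mulrDr.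
by rewrite -big_split; apply: eq_bigr => j _; rewrite tactD IH.
Qed.

Lemma twZl w a mu L : tw w (a *: mu) L = a *: tw w mu L.
Proof.
elim: w mu L => [|i w IH] mu L /=; first exact: distZr.
by rewrite scaler_sumr; apply: eq_bigr => j _; rewrite tactZ IH.
Qed.

Lemma tw0l w L : tw w 0 L = 0.
Proof. by have := twZl w 0 0 L; rewrite !scale0r. Qed.

Lemma twNl w mu L : tw w (- mu) L = - tw w mu L.
Proof. by rewrite -scaleN1r twZl scaleN1r. Qed.

Lemma tw_suml w I (r : seq I) (F : I -> D) L :
  tw w (\sum_(i <- r) F i) L = \sum_(i <- r) tw w (F i) L.
Proof. by apply: (big_morph (fun mu => tw w mu L) (fun mu nu => twDl w mu nu L) (tw0l w L)). Qed.

Lemma twDr w mu L L' : tw w mu (fun v => L v + L' v) = tw w mu L + tw w mu L'.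
Proof.
elim: w mu L L' => [|i w IH] mu L L' /=; first exact: mulrDl.
by rewrite -big_split; apply: eq_bigr => j _; rewrite IH.
Qed.

Lemma twNr w mu L : tw w mu (fun v => - L v) = - tw w mu L.
Proof.
elim: w mu L => [|i w IH] mu L /=; first exact: mulNr.
by rewrite -sumrN; apply: eq_bigr => j _; rewrite IH.
Qed.

Lemma twZr w a mu L : tw w mu (fun v => a *: L v) = a *: tw w mu L.
Proof.
elim: w mu L => [|i w IH] mu L /=; first exact: distZl.
by rewrite scaler_sumr; apply: eq_bigr => j _; rewrite IH.
Qed.

Lemma tw0r w mu : tw w mu (fun=> 0) = 0.
Proof.
elim: w mu => [|i w IH] mu /=; first exact: mul0r.
by rewrite big1 // => j _; rewrite IH.
Qed.

Lemma tw_sumr w I (r : seq I) mu (F : I -> word -> D) :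
  tw w mu (fun v => \sum_(i <- r) F i v) = \sum_(i <- r) tw w mu (F i).
Proof.
elim: r => [|i r IH].
  by rewrite big_nil -[RHS](tw0r w mu); apply: tw_ext => v _; rewrite big_nil.
rewrite big_cons -IH -twDr; apply: tw_ext => v _; by rewrite big_cons.
Qed.

Lemma twM w mu nu L : tw w (mu * nu) L = tw w nu (fun v => tw v mu L).
Proof.
elim: w mu nu L => [|i w IH] mu nu L /=; first exact: mulrA.
transitivity (\sum_j \sum_k tw w (tact k i nu) (fun v => tw v (tact j k mu) (fun u => L (j :: u)))).
  apply: eq_bigr => j _; rewrite tactM tw_suml; apply: eq_bigr => k _; exact: IH.
by rewrite exchange_big; apply: eq_bigr => k _; rewrite tw_sumr.
Qed.

Lemma tw1 w L : tw w 1 L = L w.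
Proof.
elim: w L => [|i w IH] L /=; first exact: mulr1.
rewrite (bigD1 i) //= big1 ?addr0 => [|j ji].
  by rewrite tact1 eqxx scale1r IH.
by rewrite tact1 (negbTE ji) scale0r tw0l.
Qed.

Variable K : 'I_N -> 'I_N -> D.

(** The relation [e_i, e_j] = K_ij between the words u and v, as seen by a functional [L]; [tw]
    records how K_ij moves past v to the right end. *)
Definition comm_rel (L : word -> D) (u : word) i j v :=
  L (u ++ i :: j :: v) - L (u ++ j :: i :: v) = tw v (K i j) (fun v' => L (u ++ v')).

Hypothesis K_equiv : equivariant_fam K.

(** The integrated form of delta_g K(x, y) = K(g x, g y) delta_g: equivariance carries K to the left
    and leaves matrix entries as factors of [mu]. *)
Lemma mul_equiv mu i j :
  mu * K i j = \sum_a \sum_b K a b * tact b j (tact a i mu).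
Proof.
apply: distP => f; rewrite dist_sum; under [RHS]eq_bigr do rewrite dist_sum.
have [s fs] := regular_comp_mul f.
pose r g : OG := mk_regfun (regular_mulr f g).
have rE g : r g = \sum_(p <- s) p.2 g *: p.1.
  apply: regfunP => h; rewrite -[LHS]/(f (h * g)%g) fs -[RHS]/(ev h _) raddf_sum.
  by apply: eq_bigr => p _; rewrite mulrC.
have tE h : translate h f = \sum_(p <- s) p.1 h *: p.2.
  apply: regfunP => g; rewrite -[LHS]/(f (h * g)%g) fs -[RHS]/(ev g _) raddf_sum.
  by apply: eq_bigr.
have L1 : integrate (K i j) f = \sum_a \sum_b \sum_(p <- s) dist_fun (K a b) p.1 *: (entry R a i * entry R b j * p.2).
  apply: regfunP => g; rewrite -[LHS]/(dist_fun (K i j) (translate g f)).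
  rewrite (K_equiv g^-1%g) -[RHS]/(ev g _) raddf_sum; apply: eq_bigr => a _.
  rewrite /= raddf_sum; apply: eq_bigr => b _.
  have -> : conj_fun g^-1%g (translate g f) = r g.
    apply: regfunP => h; rewrite -[LHS]/(f (g * (g^-1 * (h * g^-1^-1)))%g) -[RHS]/(f (h * g)%g).
    by rewrite mulKVg invgK.
  rewrite rE dist_fun_sum mulr_sumr /= raddf_sum; apply: eq_bigr => p _.
  rewrite dist_funZ !mxE -[RHS]/(dist_fun (K a b) p.1 * (so_val g a i * so_val g b j * p.2 g)); ring.
rewrite -[LHS]/(dist_fun mu (integrate (K i j) f)) L1 dist_fun_sum.
apply: eq_bigr => a _; rewrite dist_fun_sum; apply: eq_bigr => b _; rewrite dist_fun_sum.
rewrite -[RHS]/(dist_fun (K a b) (integrate (tact b j (tact a i mu)) f)).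
have -> : integrate (tact b j (tact a i mu)) f = \sum_(p <- s) dist_fun mu (entry R a i * entry R b j * p.2) *: p.1.
  apply: regfunP => h; rewrite -[LHS]/(dist_fun _ (translate h f)) tE dist_fun_sum -[RHS]/(ev h _) raddf_sum.
  apply: eq_bigr => p _; rewrite dist_funZ -[RHS]/(dist_fun mu (entry R a i * entry R b j * p.2) * p.1 h) mulrC.
  by rewrite /tact !act_funE mulrA.
by rewrite dist_fun_sum; apply: eq_bigr => p _; rewrite !dist_funZ mulrC.
Qed.

(** The hypothesis is restricted to words of the given lengths because the confluence proof applies
    it while the relations are known only for shorter words. *)
Lemma tw_comm_rel L mu u i j v :
  (forall u' i' j' v', size u' = size u -> size v' = size v -> comm_rel L u' i' j' v') ->
  comm_rel (fun w => tw w mu L) u i j v.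
Proof.
elim: u L mu => [|k u IH] L mu h; rewrite /comm_rel /=.
  transitivity (\sum_a \sum_b tw v (tact b j (tact a i mu)) (fun v' => L [:: a, b & v'] - L [:: b, a & v'])).
    have -> : \sum_a \sum_b tw v (tact b i (tact a j mu)) (fun v' => L [:: a, b & v'])
       = \sum_a \sum_b tw v (tact b j (tact a i mu)) (fun v' => L [:: b, a & v']).
      rewrite exchange_big; apply: eq_bigr => a _; apply: eq_bigr => b _.
      by rewrite tactC.
    rewrite -sumrB; apply: eq_bigr => a _; rewrite -sumrB; apply: eq_bigr => b _.
    by rewrite twDr twNr.
  rewrite -twM mul_equiv tw_suml; apply: eq_bigr => a _; rewrite tw_suml; apply: eq_bigr => b _.
  rewrite twM; apply: tw_ext => v' sv'; exact: (h [::] a b v').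
rewrite -sumrB tw_sumr; apply: eq_bigr => l _.
apply: IH => u' i' j' v' su' sv'.
by have := h (l :: u') i' j' v'; rewrite /= su' => /(_ erefl sv').
Qed.
End Twist.

Lemma cat_eq_prefix (T : Type) (u1 u2 x y : seq T) : u1 ++ x = u2 ++ y ->
  (size u1 <= size u2)%N -> exists2 t, u2 = u1 ++ t & x = t ++ y.
Proof.
elim: u1 u2 => [|a u1 IH] [|b u2] //=; first by exists [::].
- by exists (b :: u2).
- by move=> [-> e] su; have [t -> ->] := IH _ e su; exists t.
Qed.

(** * Descents of words and termination *)

Section Words.
Variable N : nat.
Local Notation word := (seq 'I_N).

Fixpoint descent (w : word) : option (word * 'I_N * 'I_N * word) :=
  if w is x :: w' then
    if w' is y :: v then
      if (y < x)%N then Some ([::], x, y, v)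
      else if descent w' is Some (u, a, b, v') then Some (x :: u, a, b, v') else None
    else None
  else None.

Lemma descent_some w u a b v : descent w = Some (u, a, b, v) ->
  w = u ++ a :: b :: v /\ (b < a)%N.
Proof.
elim: w u a b v => [//|x [//|y w] IH] u a b v.
have -> : descent [:: x, y & w] = if (y < x)%N then Some ([::], x, y, w)
  else if descent (y :: w) is Some (u, a, b, v') then Some (x :: u, a, b, v') else None by [].
case: ltnP => [yx [<- <- <- <-] //|_].
case E : (descent (y :: w)) => [[[[u' a'] b'] v']|//] [<- <- <- <-].
by have [-> ba] := IH _ _ _ _ E.
Qed.

Definition word_le (i j : 'I_N) := (i <= j)%N.

Lemma descent_none w : (descent w == None) = sorted word_le w.
Proof.
elim: w => [//|x [//|y w] IH].
have -> : descent [:: x, y & w] = if (y < x)%N then Some ([::], x, y, w)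
  else if descent (y :: w) is Some (u, a, b, v') then Some (x :: u, a, b, v') else None by [].
have -> : sorted word_le [:: x, y & w] = (x <= y)%N && sorted word_le (y :: w) by [].
rewrite -IH; case: ltnP => // _; rewrite andTb.
by case: (descent (y :: w)) => [[[[? ?] ?] ?]|].
Qed.

Fixpoint weight (w : word) : nat := if w is i :: w' then i * (size w') + weight w' else 0.

Lemma weight_swap (u : word) (a b : 'I_N) v : (b < a)%N -> (weight (u ++ b :: a :: v) < weight (u ++ a :: b :: v))%N.
Proof.
move=> ba; elim: u => [|x u IH] /=; first by rewrite !mulnS; lia.
by rewrite !size_cat /= ltn_add2l.
Qed.

Lemma weight_le (w : word) : (weight w <= N * (size w) ^ 2)%N.
Proof.
elim: w => [//|i w IH] /=.
have iw : (i * size w <= N * size w)%N by rewrite leq_mul2r ltnW ?orbT.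
rewrite -!mulnn in IH *; rewrite mulnS mulSn; lia.
Qed.

(** An exchange lowers [weight] at constant length. A commutator shortens the word by 2 and may
    raise [weight], which is at most N times the squared length; the cubic term outweighs it. *)
Definition measure (w : word) : nat := weight w + N * (size w) ^ 3.

Lemma measure_swap (u : word) (a b : 'I_N) v : (b < a)%N -> (measure (u ++ b :: a :: v) < measure (u ++ a :: b :: v))%N.
Proof. by move=> ba; rewrite /measure !size_cat /= ltn_add2r weight_swap. Qed.

Lemma measure_size (w w' : word) : (size w').+2 = size w -> (measure w' < measure w)%N.
Proof.
move=> e; have := weight_le w'; rewrite /measure -e.
have N0 : (0 < N)%N by case: w e => // i _ _; case: N i => // -[].
nia.
Qed.
End Words.

(** * Confluence of the rewriting *)

Section Coefficients.
Variables (R : realType) (N : nat).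
Local Notation D := (dist R N).
Local Notation word := (seq 'I_N).
Local Notation "f \> mu" := (act_fun f mu) (at level 38, right associativity).
Variable K : 'I_N -> 'I_N -> D.
Hypothesis K_skew : skew_fam K.
Hypothesis K_jac : jacobi K.
Hypothesis K_equiv : equivariant_fam K.
Variable s : word.

(* The coefficient at the sorted word s of the normal form of w; the fuel is an
   upper bound of the number of rewriting steps. *)
Fixpoint coef_fuel (k : nat) (w : word) : D :=
  if k is k'.+1 then
    if descent w is Some (u, a, b, v) then
      coef_fuel k' (u ++ b :: a :: v) + tw v (K a b) (fun v' => coef_fuel k' (u ++ v'))
    else if w == s then 1 else 0
  else 0.

Definition coef w := coef_fuel (measure w).+1 w.

Lemma coef_fuelE k w : (measure w < k)%N -> coef_fuel k w = coef w.
Proof.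
suff h m k' : (measure w < m)%N -> (measure w < k')%N -> coef_fuel m w = coef_fuel k' w.
  by move=> wk; apply: h.
elim: m k' w k {-2}k => [//|m IH] [//|k'] w _ _ wm wk /=.
case E : (descent w) => [[[[u a] b] v]|//].
have [wE ba] := descent_some E.
have ms := measure_swap u v ba; rewrite -wE in ms.
congr (_ + _); first by apply: IH => //; lia.
apply: tw_ext => v' sv'.
have mz : (measure (u ++ v') < measure w)%N.
  by apply: measure_size; rewrite wE !size_cat /= sv' !addnS.
by apply: IH => //; lia.
Qed.

Definition corr u a b v := tw v (K a b) (fun v' => coef (u ++ v')).

Lemma coef_descent w u a b v : descent w = Some (u, a, b, v) ->
  coef w = coef (u ++ b :: a :: v) + corr u a b v.
Proof.
move=> E; have [wE ba] := descent_some E; rewrite /coef [LHS]/= E.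
have ms := measure_swap u v ba; rewrite -wE in ms.
rewrite coef_fuelE //; congr (_ + _); apply: tw_ext => v' sv'.
by apply: coef_fuelE; apply: measure_size; rewrite wE !size_cat /= sv' !addnS.
Qed.

Lemma coef_sorted w : sorted (@word_le N) w -> coef w = if w == s then 1 else 0.
Proof. by rewrite -descent_none /coef /= => /eqP ->. Qed.

Lemma corr_skew u a b v : corr u a b v = - corr u b a v.
Proof. by rewrite /corr K_skew twNl. Qed.

Lemma corr_diag u a v : corr u a a v = 0.
Proof.
rewrite /corr; suff -> : K a a = 0 by exact: tw0l.
apply: distP => f; have := congr1 (fun mu : D => dist_fun mu f) (K_skew a a).
rewrite distN => e; apply: (@mulrSn_eq0 R _ 1); by rewrite mulr2n {1}e addNr.
Qed.

(** Carrying a letter x from the left of K_yz to its right replaces it by the sum of g_lx e_l; the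
    defect has the coefficients of A = 1 - g, and the three defects add up to the Jacobi
    identity. *)
Lemma corr_jacobi u a b c v :
  corr u b c (a :: v) - corr (rcons u a) b c v + (corr u c a (b :: v) - corr (rcons u b) c a v)
  + (corr u a b (c :: v) - corr (rcons u c) a b v) = 0.
Proof.
have E x y z : corr u y z (x :: v) - corr (rcons u x) y z v =
   - \sum_l tw v (amx R N l x \> K y z) (fun v' => coef (u ++ l :: v')).
  have -> : corr (rcons u x) y z v = \sum_l tw v ((l == x)%:R *: K y z) (fun v' => coef (u ++ l :: v')).
    rewrite (bigD1 x) //= eqxx scale1r big1 ?addr0 => [|l lx]; last by rewrite (negbTE lx) scale0r tw0l.
    by apply: tw_ext => v' _; rewrite cat_rcons.
  rewrite /corr /= -sumrB -sumrN; apply: eq_bigr => l _; rewrite -twNl -twDl -twNl; congr (tw _ _ _).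
  have -> : amx R N l x \> K y z = (l == x)%:R *: K y z - tact l x (K y z).
    apply: distP => f; rewrite distD distN distZ !act_funE.
    have -> : amx R N l x * f = (l == x)%:R *: f - entry R l x * f.
      apply: regfunP => g.
      have e : amx R N l x g = (l == x)%:R - so_val g l x.
        have /matrixP/(_ l x) := map_amx g; rewrite mxE => h.
        by rewrite -[LHS]/(ev g (amx R N l x)) h !mxE.
      rewrite regfunME e.
      by rewrite -[RHS]/((l == x)%:R * f g - so_val g l x * f g); ring.
    by rewrite dist_funD dist_funN dist_funZ.
  by rewrite opprB.
rewrite !E -!opprD -[RHS]oppr0; congr (- _).
rewrite -!big_split big1 //= => l _; rewrite -!twDl.
by rewrite K_jac tw0l.
Qed.

(** [D] is a noncommutative ring, so this linear rearrangement is carried out in C, after evaluation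
    at a function. *)
Lemma sum_overlap (x a b c d e f : D) : a - b + (- c - - d) + (e - f) = 0 ->
  x + a + d + e = x + f + c + b.
Proof.
move=> h; apply: distP => k.
have {h} := congr1 (fun mu : D => dist_fun mu k) h; rewrite !(distD, distN) dist_zero => h.
by apply/eqP; rewrite -subr_eq0 -[X in _ == X]h; apply/eqP; ring.
Qed.

Lemma sum_disjoint (x a b c d : D) : a - b = c - d -> x + d + a = x + b + c.
Proof.
move=> h; apply: distP => k.
have {h} := congr1 (fun mu : D => dist_fun mu k) h; rewrite !(distD, distN) => h.
apply/eqP; rewrite -subr_eq0; apply/eqP.
transitivity (dist_fun a k - dist_fun b k - (dist_fun c k - dist_fun d k)); first by ring.
by rewrite h subrr.
Qed.

(** The diamond lemma, by induction on the measure: [coef] resolves the leftmost descent, and any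
    other descent must give the same value. *)
Lemma coef_rel_aux m u a b v : (measure (u ++ a :: b :: v) < m)%N ->
  (measure (u ++ b :: a :: v) < m)%N -> comm_rel K coef u a b v.
Proof.
(* Both sides change sign when the two letters are exchanged and vanish when they are equal, so only
   descents matter. *)
suff h k : forall u a b v, (measure (u ++ a :: b :: v) < k)%N -> (b < a)%N ->
    coef (u ++ a :: b :: v) = coef (u ++ b :: a :: v) + corr u a b v.
  move=> m1 m2; rewrite /comm_rel; case: (ltngtP a b) => ab.
  - by rewrite (h _ _ _ _ _ m2 ab) opprD addNKr -corr_skew.
  - by rewrite (h _ _ _ _ _ m1 ab) addrC addKr.
  - by rewrite (val_inj ab) subrr -/(corr u b b v) corr_diag.
elim: k {m u a b v} => [//|k IH] u a b v.
have rel u' i j v' : (measure (u' ++ i :: j :: v') < k)%N -> (measure (u' ++ j :: i :: v') < k)%N ->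
    comm_rel K coef u' i j v'.
  move=> m1 m2; rewrite /comm_rel; case: (ltngtP i j) => ab.
  - by rewrite (IH _ _ _ _ m2 ab) opprD addNKr -corr_skew.
  - by rewrite (IH _ _ _ _ m1 ab) addrC addKr.
  - by rewrite (val_inj ab) subrr -/(corr u' j j v') corr_diag.
(* Descents sharing the letter b': both routes are continued to c' b' a', and their corrections
   differ by [corr_jacobi]. *)
have overlap u' a' b' c' v' : (measure (u' ++ a' :: b' :: c' :: v') <= k)%N -> (b' < a')%N -> (c' < b')%N ->
    coef (u' ++ b' :: a' :: c' :: v') + corr u' a' b' (c' :: v') =
    coef (u' ++ a' :: c' :: b' :: v') + corr (rcons u' a') b' c' v'.
  move=> mk ba cb; have ca := ltn_trans cb ba.
  have m1 := measure_swap u' (c' :: v') ba.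
  have m2 := measure_swap (rcons u' a') v' cb; rewrite !cat_rcons in m2.
  have m3 := measure_swap (rcons u' b') v' ca; rewrite !cat_rcons in m3.
  have m4 := measure_swap u' (b' :: v') ca.
  have e1 := IH (rcons u' b') a' c' v'; rewrite !cat_rcons in e1.
  rewrite e1 //; last by lia.
  rewrite (IH u' b' c' (a' :: v')) //; last by lia.
  rewrite (IH u' a' c' (b' :: v')) //; last by lia.
  have e2 := IH (rcons u' c') a' b' v'; rewrite !cat_rcons in e2.
  rewrite e2 //; last by lia.
  have := corr_jacobi u' a' b' c' v'.
  rewrite (corr_skew u' c' a') (corr_skew (rcons u' b') c' a').
  exact: sum_overlap.
(* Separate descents: the distribution created on the left must cross c' d', which is harmless
   because the twisted action preserves the relations of shorter words. *)
have disjoint u' a' b' r c' d' v' : (measure (u' ++ a' :: b' :: r ++ c' :: d' :: v') <= k)%N ->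
    (b' < a')%N -> (d' < c')%N ->
    coef (u' ++ b' :: a' :: r ++ c' :: d' :: v') + corr u' a' b' (r ++ c' :: d' :: v') =
    coef (u' ++ a' :: b' :: r ++ d' :: c' :: v') + corr (u' ++ a' :: b' :: r) c' d' v'.
  move=> mk ba dc.
  have m1 := measure_swap u' (r ++ c' :: d' :: v') ba.
  have m2 := measure_swap (u' ++ a' :: b' :: r) v' dc; rewrite -!catA /= in m2.
  have e1 := IH (u' ++ b' :: a' :: r) c' d' v'; rewrite -!catA /= in e1.
  rewrite e1 //; last by lia.
  rewrite (IH u' a' b' (r ++ d' :: c' :: v')) //; last by lia.
  have h1 : corr u' a' b' (r ++ c' :: d' :: v') - corr u' a' b' (r ++ d' :: c' :: v') =
      tw v' (K c' d') (fun w => corr u' a' b' (r ++ w)).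
    apply: (tw_comm_rel K_equiv) => u1 i j v1 su sv; rewrite /comm_rel.
    have mz i' j' : (measure (u' ++ u1 ++ i' :: j' :: v1) < k)%N.
      apply: leq_trans mk; apply: measure_size; rewrite !size_cat /= !size_cat /= su sv; lia.
    by have := rel (u' ++ u1) i j v1; rewrite /comm_rel -!catA => /(_ (mz i j) (mz j i)) ->;
      apply: tw_ext => w _; rewrite -catA.
  have h2 : corr (u' ++ a' :: b' :: r) c' d' v' - corr (u' ++ b' :: a' :: r) c' d' v' =
      tw v' (K c' d') (fun w => corr u' a' b' (r ++ w)).
    rewrite /corr -twNr -twDr; apply: tw_ext => w sw; rewrite -!catA /=.
    apply: rel; apply: leq_trans mk; apply: measure_size; rewrite !size_cat /= !size_cat /= sw; lia.
  exact: sum_disjoint (etrans h1 (esym h2)).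
(* Two descents of one word coincide, overlap in a letter or are disjoint, according to the offset
   [t] of 0, 1 or more letters. *)
have conf u1 a1 b1 v1 u2 a2 b2 v2 : u1 ++ a1 :: b1 :: v1 = u2 ++ a2 :: b2 :: v2 ->
    (size u1 <= size u2)%N -> (measure (u1 ++ a1 :: b1 :: v1) <= k)%N ->
    (b1 < a1)%N -> (b2 < a2)%N ->
    coef (u1 ++ b1 :: a1 :: v1) + corr u1 a1 b1 v1 = coef (u2 ++ b2 :: a2 :: v2) + corr u2 a2 b2 v2.
  move=> e su mk h1 h2; have [t ut vt] := cat_eq_prefix e su.
  case: t ut vt => [|x [|y t]] /=.
  - by rewrite cats0 => -> [-> -> ->].
  - move=> -> [? ? ?]; subst; rewrite cats1 !cat_rcons; exact: overlap.
  - move=> -> [? ? ?]; subst; rewrite -!catA /=; exact: disjoint.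
move=> mk ba; case E : (descent (u ++ a :: b :: v)) => [[[[u0 a0] b0] v0]|]; last first.
  move/eqP: E; rewrite descent_none => /cat_sorted2[_ /=].
  by rewrite {1}/word_le leqNgt ba.
rewrite (coef_descent E); have [wE ba0] := descent_some E.
case/orP: (leq_total (size u0) (size u)) => su.
  by apply: conf su _ ba0 ba; rewrite -?wE.
by apply/esym; apply: conf su _ ba ba0; rewrite -?wE.
Qed.

Lemma coef_rel u a b v : comm_rel K coef u a b v.
Proof.
apply: (@coef_rel_aux (measure (u ++ a :: b :: v) + measure (u ++ b :: a :: v)).+1).
  by rewrite ltnS leq_addr.
by rewrite ltnS leq_addl.
Qed.

(** Rewriting never lengthens a word. *)
Lemma coef_short w : (size w < size s)%N -> coef w = 0.
Proof.
elim: {w}(measure w).+1 {-2}w (ltnSn (measure w)) => [//|k IH] w mk sw.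
case E : (descent w) => [[[[u a] b] v]|]; last first.
  rewrite coef_sorted -?descent_none ?E //; case: eqP => // ws.
  by rewrite ws ltnn in sw.
rewrite (coef_descent E); have [wE ba] := descent_some E.
have ms := measure_swap u v ba; rewrite -wE in ms.
have sz : size (u ++ b :: a :: v) = size w by rewrite wE !size_cat.
rewrite IH ?sz //; last by lia.
rewrite add0r /corr -[RHS](tw0r v (K a b)); apply: tw_ext => v' sv'.
have szv : (size (u ++ v')).+2 = size w by rewrite wE !size_cat /= sv' !addnS.
by apply: IH; [have := measure_size szv | ]; lia.
Qed.
End Coefficients.

Lemma zmod_nmod_morphism (U W : zmodType) (f : U -> W) : zmod_morphism f -> nmod_morphism f.
Proof.
move=> fB; have f0 : f 0 = 0 by rewrite -(subrr (0 : U)) fB subrr.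
by split=> // x y; rewrite -{1}[y]opprK fB -(sub0r y) fB f0 sub0r opprK.
Qed.

(** * Actions of algebras given by generators and relations *)

Section Endomorphisms.
Variable U : zmodType.

Record endo : Type := Endo {
  endo_fun :> U -> U;
  endoD : forall x y, endo_fun (x + y) = endo_fun x + endo_fun y }.
HB.instance Definition _ := gen_eqMixin endo.
HB.instance Definition _ := gen_choiceMixin endo.

Lemma endoP (f g : endo) : (forall x, f x = g x) -> f = g.
Proof.
case: f g => [f fD] [g gD] /= /funext fg; case: _ / fg in gD *.
by congr Endo; exact: Prop_irrelevance.
Qed.

Fact endo_zero_subproof (x y : U) : 0 = 0 + 0 :> U.
Proof. by rewrite addr0. Qed.
Fact endo_add_subproof (f g : endo) x y : f (x + y) + g (x + y) = f x + g x + (f y + g y).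
Proof. by rewrite !endoD addrACA. Qed.
Fact endo_opp_subproof (f : endo) x y : - f (x + y) = - f x + - f y.
Proof. by rewrite endoD opprD. Qed.
Fact endo_mul_subproof (f g : endo) x y : g (f (x + y)) = g (f x) + g (f y).
Proof. by rewrite !endoD. Qed.

Definition endo_zero := Endo endo_zero_subproof.
Definition endo_add f g := Endo (endo_add_subproof f g).
Definition endo_opp f := Endo (endo_opp_subproof f).
Definition endo_one := Endo (fun x y : U => erefl (x + y)).
(* The opposite of composition: endomorphisms act on the right. *)
Definition endo_mul f g := Endo (endo_mul_subproof f g).

Fact endo_addA : associative endo_add.
Proof. by move=> f g h; apply: endoP => x; apply: addrA. Qed.
Fact endo_addC : commutative endo_add.
Proof. by move=> f g; apply: endoP => x; apply: addrC. Qed.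
Fact endo_add0 : left_id endo_zero endo_add.
Proof. by move=> f; apply: endoP => x; apply: add0r. Qed.
Fact endo_addN : left_inverse endo_zero endo_opp endo_add.
Proof. by move=> f; apply: endoP => x; apply: addNr. Qed.
HB.instance Definition _ :=
  GRing.isZmodule.Build endo endo_addA endo_addC endo_add0 endo_addN.

Fact endo_mulA : associative endo_mul.
Proof. by move=> f g h; apply: endoP. Qed.
Fact endo_mul1 : left_id endo_one endo_mul.
Proof. by move=> f; apply: endoP. Qed.
Fact endo_1mul : right_id endo_one endo_mul.
Proof. by move=> f; apply: endoP. Qed.
Fact endo_mulDl : left_distributive endo_mul +%R.
Proof. by move=> f g h; apply: endoP => x /=; rewrite endoD. Qed.
Fact endo_mulDr : right_distributive endo_mul +%R.
Proof. by move=> f g h; apply: endoP. Qed.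
HB.instance Definition _ := GRing.Zmodule_isPzRing.Build endo
  endo_mulA endo_mul1 endo_1mul endo_mulDl endo_mulDr.

End Endomorphisms.

Section Extension.
Import xfinmap monalg.
Variables (R : realType) (N : nat) (S : pzRingType).
Local Notation C := R[i].
Local Notation V := 'cV[C]_N.
Local Notation D := (dist R N).
Local Notation gens := (D + V)%type.
Local Notation free := (free_alg R N).
Variables (iota : {rmorphism C -> S}) (h : gens -> S).
Hypothesis iota_central : forall a g, iota a * h g = h g * iota a.

Definition word_ext (m : {fmonom gens}) : S := \prod_(g <- fmonom_val m) h g.

(** [S] is only a ring; the central map [iota] stands for its structure of algebra over C. *)
Definition free_ext (f : free) : S := \sum_(m <- msupp f) iota f@_m * word_ext m.

Lemma free_extEw (d : {fset {fmonom gens}}) (f : free) : (msupp f `<=` d)%fset ->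
  free_ext f = \sum_(m <- d) iota f@_m * word_ext m.
Proof.
move=> le; rewrite [LHS](big_fset_incl _ le) => //= x xd /mcoeff_outdom ->.
by rewrite raddf0 mul0r.
Qed.

Lemma free_extU (c : C) m : free_ext (<< c *g m >> : free) = iota c * word_ext m.
Proof. by rewrite (free_extEw msuppU_le) big_seq_fset1 mcoeffUU. Qed.

Lemma free_ext_zmod : zmod_morphism free_ext.
Proof.
move=> f1 f2; pose E := (msupp f1 `|` msupp f2 `|` msupp (f1 - f2))%fset.
have E1 : (msupp f1 `<=` E)%fset by rewrite /E -fsetUA fsubsetUl.
have E2 : (msupp f2 `<=` E)%fset by rewrite /E fsetUAC fsubsetUr.
rewrite (free_extEw E1) (free_extEw E2) (free_extEw (fsubsetUr _ _ : (_ `<=` E)%fset)).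
by rewrite -sumrB; apply: eq_bigr => k _; rewrite mcoeffB raddfB mulrBl.
Qed.
HB.instance Definition _ := GRing.isNmodMorphism.Build free S free_ext (zmod_nmod_morphism free_ext_zmod).

Lemma word_extM m1 m2 : word_ext (mmul m1 m2) = word_ext m1 * word_ext m2.
Proof. by rewrite /word_ext fmM big_cat. Qed.

Lemma word_ext_central a m : iota a * word_ext m = word_ext m * iota a.
Proof.
rewrite /word_ext; elim: (fmonom_val m) => [|g s IH].
  by rewrite big_nil mulr1 mul1r.
by rewrite big_cons mulrA iota_central -mulrA IH mulrA.
Qed.

Lemma free_ext1 : free_ext 1 = 1.
Proof.
rewrite -[X in free_ext X]/(<< 1 *g mone >> : free) free_extU rmorph1 mul1r.
by rewrite /word_ext fm1 big_nil.
Qed.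

Lemma free_ext_monoid : monoid_morphism free_ext.
Proof.
split=> [|f1 f2]; first exact: free_ext1.
rewrite malgME raddf_sum mulr_suml /=; apply: eq_bigr=> i _.
rewrite raddf_sum mulr_sumr /=; apply: eq_bigr=> j _.
by rewrite free_extU rmorphM word_extM -mulrA [X in _ * X = _]mulrA word_ext_central !mulrA.
Qed.
HB.instance Definition _ := GRing.isMonoidMorphism.Build free S free_ext free_ext_monoid.

Definition ext_rmorphism : {rmorphism free -> S} := free_ext.

Lemma free_ext_dist mu : free_ext (free_dist mu) = h (inl mu).
Proof. by rewrite free_extU rmorph1 mul1r /word_ext fmuE big_seq1. Qed.

Lemma free_ext_vec x : free_ext (free_vec x) = h (inr x).
Proof. by rewrite free_extU rmorph1 mul1r /word_ext fmuE big_seq1. Qed.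

Lemma free_extZ a f : free_ext (a *: f) = iota a * free_ext f.
Proof. by rewrite -mul_malgC rmorphM /= free_extU /word_ext fm1 big_nil mulr1. Qed.
End Extension.

Section IdealLift.
Variables (A S : pzRingType) (f : {rmorphism A -> S}) (X : A -> Prop).
Hypothesis f0 : forall x, X x -> f x = 0.

Lemma gen_ideal_ker x : gen_ideal X x -> f x = 0.
Proof.
elim=> [y /f0 //||y z _ e1 _ e2|a y _ e|a y _ e].
- exact: rmorph0.
- by rewrite rmorphD e1 e2 addr0.
- by rewrite rmorphM e mulr0.
- by rewrite rmorphM e mul0r.
Qed.

Definition lift_quot (q : quot_ring (ideal_of X)) : S := f (qrepr q).

Lemma lift_quotE x : lift_quot (qpi (ideal_of X) x) = f x.
Proof.
apply/eqP; rewrite -subr_eq0 -rmorphB; apply/eqP/gen_ideal_ker.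
exact: (qreprP (ideal_of X)).
Qed.

Lemma lift_quot_zmod : zmod_morphism lift_quot.
Proof. by move=> p q; rewrite -(qreprK p) -(qreprK q) -rmorphB /= !lift_quotE rmorphB. Qed.
Lemma lift_quot_monoid : monoid_morphism lift_quot.
Proof.
split; first by rewrite -[1]/(qpi (ideal_of X) 1) lift_quotE rmorph1.
by move=> p q; rewrite -(qreprK p) -(qreprK q) -rmorphM /= !lift_quotE rmorphM.
Qed.
HB.instance Definition _ := GRing.isNmodMorphism.Build _ S lift_quot (zmod_nmod_morphism lift_quot_zmod).
HB.instance Definition _ := GRing.isMonoidMorphism.Build _ S lift_quot lift_quot_monoid.
Definition lift_rmorphism : {rmorphism quot_ring (ideal_of X) -> S} := lift_quot.
End IdealLift.

(** * The right module of families of distributions on words *)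

Section DualModule.
Variables (R : realType) (N : nat).
Local Notation C := R[i].
Local Notation V := 'cV[C]_N.
Local Notation D := (dist R N).
Local Notation word := (seq 'I_N).
Local Notation "f \> mu" := (act_fun f mu) (at level 38, right associativity).
Variable K : 'I_N -> 'I_N -> D.
Hypothesis K_equiv : equivariant_fam K.

(** Coordinates on words of a map L to O(SO_N)^* which is linear for right multiplication by
    distributions; [comm_rel] is its compatibility with the commutators. An element q acts by (L
    q)(h) = L (q h). *)
Record dual_mod : Type := DualMod {
  dual_fun :> word -> D;
  dual_rel : forall u i j v, comm_rel K dual_fun u i j v }.
HB.instance Definition _ := gen_eqMixin dual_mod.
HB.instance Definition _ := gen_choiceMixin dual_mod.

Lemma dualP (L L' : dual_mod) : (forall w, L w = L' w) -> L = L'.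
Proof.
case: L L' => [L Lr] [L' Lr'] /= /funext LL'; case: _ / LL' in Lr' *.
by congr DualMod; exact: Prop_irrelevance.
Qed.

Fact dual_zero_rel u i j v : comm_rel K (fun=> 0) u i j v.
Proof. by rewrite /comm_rel subrr tw0r. Qed.
Fact dual_add_rel (L L' : dual_mod) u i j v : comm_rel K (fun w => L w + L' w) u i j v.
Proof. by rewrite /comm_rel opprD addrACA twDr !dual_rel. Qed.
Fact dual_opp_rel (L : dual_mod) u i j v : comm_rel K (fun w => - L w) u i j v.
Proof. by rewrite /comm_rel twNr -dual_rel opprB opprK addrC. Qed.

Definition dual_zero := DualMod dual_zero_rel.
Definition dual_add L L' := DualMod (dual_add_rel L L').
Definition dual_opp L := DualMod (dual_opp_rel L).
Fact dual_addA : associative dual_add.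
Proof. by move=> L L' L''; apply: dualP => w; apply: addrA. Qed.
Fact dual_addC : commutative dual_add.
Proof. by move=> L L'; apply: dualP => w; apply: addrC. Qed.
Fact dual_add0 : left_id dual_zero dual_add.
Proof. by move=> L; apply: dualP => w; apply: add0r. Qed.
Fact dual_addN : left_inverse dual_zero dual_opp dual_add.
Proof. by move=> L; apply: dualP => w; apply: addNr. Qed.
HB.instance Definition _ :=
  GRing.isZmodule.Build dual_mod dual_addA dual_addC dual_add0 dual_addN.

Fact dual_scale_rel (a : C) (L : dual_mod) u i j v : comm_rel K (fun w => a *: L w) u i j v.
Proof. by rewrite /comm_rel twZr -scalerBr dual_rel. Qed.
Fact dual_dist_rel (mu : D) (L : dual_mod) u i j v : comm_rel K (fun w => tw w mu L) u i j v.
Proof. by apply: (tw_comm_rel K_equiv) => u' i' j' v' _ _; exact: dual_rel. Qed.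
Fact dual_vec_rel (x : V) (L : dual_mod) u i j v :
  comm_rel K (fun w => \sum_k x k 0 *: L (k :: w)) u i j v.
Proof.
rewrite /comm_rel -sumrB tw_sumr; apply: eq_bigr => k _.
by rewrite twZr -scalerBr (dual_rel L (k :: u)).
Qed.

Definition dual_scale (a : C) : endo dual_mod.
Proof.
exists (fun L => DualMod (dual_scale_rel a L)).
by move=> L L'; apply: dualP => w; apply: scalerDr.
Defined.
Definition dual_dist (mu : D) : endo dual_mod.
Proof.
exists (fun L => DualMod (dual_dist_rel mu L)).
by move=> L L'; apply: dualP => w; apply: twDr.
Defined.
Definition dual_vec (x : V) : endo dual_mod.
Proof.
exists (fun L => DualMod (dual_vec_rel x L)).
move=> L L'; apply: dualP => w; rewrite -[RHS]/(_ + _) /= -big_split.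
by apply: eq_bigr => k _; rewrite scalerDr.
Defined.

Lemma dual_scale_zmod : zmod_morphism dual_scale.
Proof. by move=> a b; apply: endoP => L; apply: dualP => w; apply: scalerBl. Qed.
Lemma dual_scale_monoid : monoid_morphism dual_scale.
Proof.
split=> [|a b]; apply: endoP => L; apply: dualP => w; first exact: scale1r.
by rewrite -[RHS]/(b *: (a *: L w)) scalerA mulrC.
Qed.
HB.instance Definition _ := GRing.isNmodMorphism.Build C (endo dual_mod) dual_scale (zmod_nmod_morphism dual_scale_zmod).
HB.instance Definition _ := GRing.isMonoidMorphism.Build C (endo dual_mod) dual_scale dual_scale_monoid.

Definition dual_gen (g : D + V) := match g with inl mu => dual_dist mu | inr x => dual_vec x end.

Lemma dual_gen_central a g : dual_scale a * dual_gen g = dual_gen g * dual_scale a.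
Proof.
apply: endoP => L; apply: dualP => w; case: g => [mu|x]; first exact: twZr.
rewrite -[LHS]/(\sum_k x k 0 *: (a *: L (k :: w))) -[RHS]/(a *: \sum_k x k 0 *: L (k :: w)).
by rewrite scaler_sumr; apply: eq_bigr => k _; rewrite !scalerA mulrC.
Qed.

Definition act_free : {rmorphism free_alg R N -> endo dual_mod} :=
  ext_rmorphism dual_gen_central.

Lemma act_free_dist mu : act_free (free_dist mu) = dual_dist mu.
Proof. exact: free_ext_dist. Qed.

Lemma act_free_vec x : act_free (free_vec x) = dual_vec x.
Proof. exact: free_ext_vec. Qed.

Lemma act_freeZ a f : act_free (a *: f) = dual_scale a * act_free f.
Proof. exact: (free_extZ dual_gen_central). Qed.

Lemma dual_eval_sum I (r : seq I) (F : I -> endo dual_mod) L w :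
  (\sum_(i <- r) F i) L w = \sum_(i <- r) F i L w.
Proof. by elim: r => [|i r IH]; rewrite ?big_nil // !big_cons -IH. Qed.

Lemma dual_vecE x (L : dual_mod) w : dual_vec x L w = \sum_k x k 0 *: L (k :: w).
Proof. by []. Qed.

Lemma dual_distE mu (L : dual_mod) w : dual_dist mu L w = tw w mu L.
Proof. by []. Qed.

Lemma dual_vec_delta k (L : dual_mod) w : dual_vec (delta_mx k 0) L w = L (k :: w).
Proof.
rewrite dual_vecE (bigD1 k) //= mxE !eqxx scale1r big1 ?addr0 // => j jk.
by rewrite mxE (negbTE jk) scale0r.
Qed.

Lemma coord_fun_expand (x : V) j : coord_fun x j = \sum_k x k 0 *: entry R j k.
Proof.
apply: regfunP => g; rewrite -[RHS]/(ev g _) raddf_sum /= mxE.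
by apply: eq_bigr => k _; rewrite mulrC.
Qed.

Lemma act_funZl (a : C) f (mu : D) : (a *: f) \> mu = a *: (f \> mu).
Proof. by apply: distP => h; rewrite distZ !act_funE regfun_scaleA dist_funZ. Qed.

Lemma act_free_rel r : smashT_rel r -> act_free r = 0.
Proof.
case=> {r} [a mu nu||mu nu|a x y|mu x]; rewrite rmorphB; apply/eqP; rewrite subr_eq0; apply/eqP;
  apply: endoP => L; apply: dualP => w.
- rewrite rmorphD act_freeZ !act_free_dist -[RHS]/(tw w mu (fun v => a *: L v) + tw w nu L).
  by rewrite dual_distE twDl twZl twZr.
- by rewrite rmorph1 act_free_dist; exact: tw1.
- by rewrite rmorphM !act_free_dist; exact: twM.
- rewrite rmorphD act_freeZ !act_free_vec.
  rewrite -[RHS]/(\sum_k x k 0 *: (a *: L (k :: w)) + \sum_k y k 0 *: L (k :: w)) -big_split.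
  by apply: eq_bigr => k _; rewrite !mxE scalerDl scalerA mulrC.
- rewrite rmorphM act_free_dist act_free_vec rmorph_sum dual_eval_sum.
  rewrite -[LHS]/(\sum_k x k 0 *: \sum_j tw w (tact j k mu) (fun v => L (j :: v))).
  under eq_bigr do rewrite scaler_sumr.
  rewrite exchange_big; apply: eq_bigr => j _.
  rewrite rmorphM act_free_vec act_free_dist.
  rewrite -[RHS]/(tw w (coord_fun x j \> mu) (dual_vec (delta_mx j 0) L)).
  rewrite coord_fun_expand act_fun_suml tw_suml; apply: eq_bigr => k _.
  rewrite act_funZl twZl; congr (_ *: _); apply: tw_ext => v _.
  by rewrite dual_vec_delta.
Qed.

Definition act_smashT : {rmorphism smashT R N -> endo dual_mod} :=
  lift_rmorphism act_free_rel.

Lemma act_smashT_dist mu : act_smashT (smashT_dist mu) = dual_dist mu.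
Proof. by rewrite -act_free_dist; exact: (lift_quotE act_free_rel). Qed.

Lemma act_smashT_vec x : act_smashT (smashT_vec x) = dual_vec x.
Proof. by rewrite -act_free_vec; exact: (lift_quotE act_free_rel). Qed.

Lemma act_smashT_comm x y : act_smashT (smashT_vec x * smashT_vec y - smashT_vec y * smashT_vec x)
  = dual_dist (\sum_i \sum_j (x i 0 * y j 0) *: K i j).
Proof.
have mulE z t : act_smashT (smashT_vec z * smashT_vec t) = dual_vec z * dual_vec t.
  by rewrite rmorphM; congr (_ * _); exact: act_smashT_vec.
transitivity (dual_vec x * dual_vec y - dual_vec y * dual_vec x).
  by rewrite rmorphB; congr (_ - _); exact: mulE.
apply: endoP => L; apply: dualP => w.
rewrite -[LHS]/(\sum_j y j 0 *: (\sum_i x i 0 *: L [:: i, j & w])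
   - \sum_i x i 0 *: (\sum_j y j 0 *: L [:: j, i & w])) dual_distE tw_suml.
under eq_bigr do rewrite scaler_sumr.
rewrite exchange_big -sumrB; apply: eq_bigr => i _; rewrite scaler_sumr -sumrB tw_suml.
apply: eq_bigr => j _; rewrite twZl -(dual_rel L [::]) /= scalerBr !scalerA.
by rewrite mulrC.
Qed.
End DualModule.

Section FreeInd.
Import xfinmap monalg.
Variables (R : realType) (N : nat).
Local Notation free := (free_alg R N).

Lemma free_alg_ind (P : free -> Prop) : (forall c, P (c *: 1)) ->
  (forall mu f, P f -> P (free_dist mu * f)) ->
  (forall x f, P f -> P (free_vec x * f)) ->
  (forall f h, P f -> P h -> P (f + h)) -> forall f, P f.
Proof.
move=> Pc Pd Pv PD f; rewrite [f]monalgE.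
elim: (enum_fset _) => [|m s IH]; first by rewrite big_nil -(scale0r (1 : free)).
rewrite big_cons; apply: PD IH; move: (f@_m) => c.
case: m => m; elim: m => [|g m IH].
  rewrite -[X in P X]/(<< c *g FMonom [::] >> : free).
  have -> : << c *g FMonom [::] >> = c *: (1 : free).
    rewrite -mul_malgC mulr1; congr << c *g _ >>.
    by apply/eqP; rewrite -val_eqE /= fm1.
  exact: Pc.
have -> : << c *g FMonom (g :: m) >> = (<< fmu g >> : free) * << c *g FMonom m >>.
  rewrite malgM_def fgmulUU mul1r; congr << c *g _ >>.
  by apply/eqP; rewrite -val_eqE /= fmM fmuE.
by case: g => [mu|x]; [exact: Pd | exact: Pv].
Qed.
End FreeInd.

Section Relations.
Variables (R : realType) (N : nat).
Local Notation C := R[i].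
Local Notation V := 'cV[C]_N.
Local Notation D := (dist R N).
Local Notation I := (ideal_of (@smashT_rel R N)).
Local Notation pi := (qpi I).
Local Notation "f \> mu" := (act_fun f mu) (at level 38, right associativity).

Lemma smashT_eq f h : smashT_rel (f - h) -> pi f = pi h.
Proof. by move=> r; apply/qpiP; exact: gen_ideal_in. Qed.

Lemma smashT_dist_one : smashT_dist (1 : D) = 1.
Proof. exact: smashT_eq (smashT_dist1 R N). Qed.

Lemma smashT_dist_mul (mu nu : D) : smashT_dist (mu * nu) = smashT_dist mu * smashT_dist nu.
Proof.
apply: (etrans (smashT_eq (smashT_distM mu nu))).
exact: (rmorphM pi).
Qed.

Lemma smashT_distD (mu nu : D) : smashT_dist (mu + nu) = smashT_dist mu + smashT_dist nu.
Proof.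
have := smashT_eq (smashT_dist_linear 1 mu nu); rewrite !scale1r => e.
by apply: (etrans e); exact: (rmorphD pi).
Qed.

Lemma smashT_vecD (x y : V) : smashT_vec (x + y) = smashT_vec x + smashT_vec y.
Proof.
have := smashT_eq (smashT_vec_linear 1 x y); rewrite !scale1r => e.
by apply: (etrans e); exact: (rmorphD pi).
Qed.

Lemma smashT_dist0 : smashT_dist (0 : D) = 0.
Proof. by apply: (@addrI _ (smashT_dist 0)); rewrite -smashT_distD !addr0. Qed.

Lemma smashT_vec0 : smashT_vec (0 : V) = 0.
Proof. by apply: (@addrI _ (smashT_vec 0)); rewrite -smashT_vecD !addr0. Qed.

Lemma smashT_scalar a : pi (a *: 1) = smashT_dist (a *: (1 : D)).
Proof.
have e := smashT_eq (smashT_dist_linear a 1 0); rewrite addr0 in e.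
rewrite /smashT_dist e; apply: esym.
apply: (etrans (rmorphD pi _ _)); rewrite -[X in _ + X]/(smashT_dist 0) smashT_dist0 addr0.
have sE (f : free_alg R N) : a *: f = (a *: 1) * f.
  by rewrite -scalerAl mul1r.
rewrite sE; apply: (etrans (rmorphM pi _ _)).
by rewrite -[X in _ * X]/(smashT_dist 1) smashT_dist_one mulr1.
Qed.

Lemma smashT_vecZ a (x : V) : smashT_vec (a *: x) = smashT_dist (a *: (1 : D)) * smashT_vec x.
Proof.
have e := smashT_eq (smashT_vec_linear a x 0); rewrite addr0 in e.
apply: (etrans e); apply: (etrans (rmorphD pi _ _)).
rewrite -[X in _ + X]/(smashT_vec 0) smashT_vec0 addr0.
have sE (f : free_alg R N) : a *: f = (a *: 1) * f.
  by rewrite -scalerAl mul1r.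
rewrite sE; apply: (etrans (rmorphM pi _ _)).
exact: (congr1 (fun z => z * smashT_vec x) (smashT_scalar a)).
Qed.

Lemma smashT_cross_eq (mu : D) (x : V) : smashT_dist mu * smashT_vec x =
  \sum_i smashT_vec (delta_mx i 0) * smashT_dist (coord_fun x i \> mu).
Proof.
apply: (etrans (esym (rmorphM pi _ _))).
apply: (etrans (smashT_eq (smashT_cross mu x))).
apply: (etrans (rmorph_sum pi _ _ _)); apply: eq_bigr => i _.
exact: (rmorphM pi).
Qed.
End Relations.

(** * Rings generated by distributions and vectors *)

Section SmashPairs.
Variables (R : realType) (N : nat).
Local Notation C := R[i].
Local Notation V := 'cV[C]_N.
Local Notation D := (dist R N).
Local Notation "f \> mu" := (act_fun f mu) (at level 38, right associativity).

(** The relations of O(SO_N)^* |x TV in a bare ring, with scalars acting through multiples of the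
    unit distribution. The smash products, H_kappa and its graded ring share the lemmas below. *)
Record smash_pair (Q : pzRingType) (d : D -> Q) (v : V -> Q) : Prop := SmashPair {
  sp_dD : forall mu nu, d (mu + nu) = d mu + d nu;
  sp_d1 : d 1 = 1;
  sp_dM : forall mu nu, d (mu * nu) = d mu * d nu;
  sp_vD : forall x y, v (x + y) = v x + v y;
  sp_vZ : forall a x, v (a *: x) = d (a *: (1 : D)) * v x;
  sp_cross : forall mu x, d mu * v x =
    \sum_i v (delta_mx i 0) * d (coord_fun x i \> mu) }.

Lemma smash_pair_smashT : smash_pair (@smashT_dist R N) (@smashT_vec R N).
Proof.
split; [exact: smashT_distD | exact: smashT_dist_one | exact: smashT_dist_mul |
  exact: smashT_vecD | exact: smashT_vecZ | exact: smashT_cross_eq].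
Qed.

Lemma smash_pair_comp (Q Q' : pzRingType) (f : {rmorphism Q -> Q'}) d v :
  smash_pair d v -> smash_pair (fun mu => f (d mu)) (fun x => f (v x)).
Proof.
case=> dD d1 dM vD vZ cr; split=> *; rewrite ?dD ?d1 ?dM ?vD ?vZ ?rmorphD ?rmorphM ?rmorph1 //.
rewrite -rmorphM cr rmorph_sum; apply: eq_bigr => i _.
by rewrite rmorphM.
Qed.

Section Pair.
Variables (Q : pzRingType) (d : D -> Q) (v : V -> Q).
Hypothesis dv : smash_pair d v.

Lemma sp_d0 : d 0 = 0.
Proof. by apply: (@addrI _ (d 0)); rewrite -(sp_dD dv) !addr0. Qed.

Lemma sp_dsum I (r : seq I) (P : pred I) (F : I -> D) :
  d (\sum_(i <- r | P i) F i) = \sum_(i <- r | P i) d (F i).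
Proof. exact: (big_morph d (sp_dD dv) sp_d0). Qed.

Lemma sp_dZ a mu : d (a *: mu) = d (a *: (1 : D)) * d mu.
Proof. by rewrite -(sp_dM dv) distZl mul1r. Qed.

Lemma coord_fun1 (x : V) i : coord_fun x i \> (1 : D) = x i 0 *: (1 : D).
Proof.
apply: distP => f; rewrite distZ act_funE.
rewrite -[LHS]/((1%:M *m x) i 0 * f 1%g) mul1mx.
by [].
Qed.

Lemma sp_expand x : v x = \sum_i v (delta_mx i 0) * d (x i 0 *: (1 : D)).
Proof.
rewrite -[LHS]mul1r -(sp_d1 dv) (sp_cross dv).
by apply: eq_bigr => i _; rewrite coord_fun1.
Qed.

Lemma sp_central_dist a mu : d (a *: (1 : D)) * d mu = d mu * d (a *: (1 : D)).
Proof. by rewrite -!(sp_dM dv) distZl distZr mul1r mulr1. Qed.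

Lemma sp_central_vec a x : d (a *: (1 : D)) * v x = v x * d (a *: (1 : D)).
Proof.
rewrite (sp_cross dv) [in RHS]sp_expand mulr_suml; apply: eq_bigr => i _.
rewrite act_funZr coord_fun1 -mulrA -(sp_dM dv) distZr mulr1.
by [].
Qed.

Definition sp_scalar (a : C) : Q := d (a *: (1 : D)).
Lemma sp_scalar_zmod : zmod_morphism sp_scalar.
Proof.
move=> a b; rewrite /sp_scalar scalerBl (sp_dD dv); congr (_ + _).
by apply/eqP; rewrite -addr_eq0 -(sp_dD dv) addNr sp_d0.
Qed.
Lemma sp_scalar_monoid : monoid_morphism sp_scalar.
Proof.
split; first by rewrite /sp_scalar scale1r (sp_d1 dv).
by move=> a b; rewrite /sp_scalar -(sp_dM dv) distZl mul1r scalerA.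
Qed.
HB.instance Definition _ := GRing.isNmodMorphism.Build C Q sp_scalar (zmod_nmod_morphism sp_scalar_zmod).
HB.instance Definition _ := GRing.isMonoidMorphism.Build C Q sp_scalar sp_scalar_monoid.

Definition sp_gen (g : D + V) : Q := match g with inl mu => d mu | inr x => v x end.

Lemma sp_gen_central a g : sp_scalar a * sp_gen g = sp_gen g * sp_scalar a.
Proof. by case: g => [mu|x]; [exact: sp_central_dist | exact: sp_central_vec]. Qed.

Definition sp_free : {rmorphism free_alg R N -> Q} := ext_rmorphism sp_gen_central.

Lemma sp_free_dist mu : sp_free (free_dist mu) = d mu.
Proof. exact: free_ext_dist. Qed.

Lemma sp_free_vec x : sp_free (free_vec x) = v x.
Proof. exact: free_ext_vec. Qed.

Lemma sp_freeZ a f : sp_free (a *: f) = sp_scalar a * sp_free f.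
Proof. exact: (free_extZ sp_gen_central). Qed.

Lemma sp_free_rel r : smashT_rel r -> sp_free r = 0.
Proof.
case=> {r} [a mu nu||mu nu|a x y|mu x]; rewrite rmorphB; apply/eqP; rewrite subr_eq0; apply/eqP.
- by rewrite rmorphD sp_freeZ !sp_free_dist (sp_dD dv) sp_dZ.
- by rewrite rmorph1 sp_free_dist (sp_d1 dv).
- by rewrite rmorphM !sp_free_dist (sp_dM dv).
- by rewrite rmorphD sp_freeZ !sp_free_vec (sp_vD dv) (sp_vZ dv).
- rewrite rmorphM sp_free_dist sp_free_vec rmorph_sum (sp_cross dv).
  by apply: eq_bigr => i _; rewrite rmorphM sp_free_vec sp_free_dist.
Qed.

Definition sp_lift : {rmorphism smashT R N -> Q} := lift_rmorphism sp_free_rel.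

Lemma sp_lift_dist mu : sp_lift (smashT_dist mu) = d mu.
Proof. by rewrite -sp_free_dist; exact: (lift_quotE sp_free_rel). Qed.

Lemma sp_lift_vec x : sp_lift (smashT_vec x) = v x.
Proof. by rewrite -sp_free_vec; exact: (lift_quotE sp_free_rel). Qed.

Definition vword (w : seq 'I_N) : Q := \prod_(i <- w) v (delta_mx i 0).

Definition vspan (q : Q) : Prop :=
  exists l : seq (seq 'I_N * D), q = \sum_(p <- l) vword p.1 * d p.2.

Lemma vword_cons i w : vword (i :: w) = v (delta_mx i 0) * vword w.
Proof. exact: big_cons. Qed.

Lemma vspan1 w mu : vspan (vword w * d mu).
Proof. by exists [:: (w, mu)]; rewrite big_seq1. Qed.

Lemma vspan_d mu : vspan (d mu).
Proof. by have := vspan1 [::] mu; rewrite /vword big_nil mul1r. Qed.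

Lemma vspanD q q' : vspan q -> vspan q' -> vspan (q + q').
Proof. by case=> l -> [l' ->]; exists (l ++ l'); rewrite big_cat. Qed.

Lemma vspan_sum I (r : seq I) (F : I -> Q) : (forall i, vspan (F i)) -> vspan (\sum_(i <- r) F i).
Proof.
move=> h; elim/big_ind: _ => //; last exact: vspanD.
by exists [::]; rewrite big_nil.
Qed.

Lemma vspan_e i q : vspan q -> vspan (v (delta_mx i 0) * q).
Proof.
case=> l ->; rewrite mulr_sumr; apply: vspan_sum => p.
by rewrite mulrA -vword_cons; exact: vspan1.
Qed.

Lemma vspan_v x q : vspan q -> vspan (v x * q).
Proof.
move=> h; rewrite sp_expand mulr_suml; apply: vspan_sum => i.
rewrite -mulrA; apply: vspan_e; case: h => l ->.
rewrite mulr_sumr; apply: vspan_sum => p.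
have -> : d (x i 0 *: (1 : D)) * (vword p.1 * d p.2) = vword p.1 * d (x i 0 *: p.2).
  rewrite [in RHS]sp_dZ mulrA [in RHS]mulrA; congr (_ * _); elim: p.1 => [|k w IH].
    by rewrite /vword big_nil mulr1 mul1r.
  by rewrite vword_cons mulrA sp_central_vec -mulrA IH mulrA.
exact: vspan1.
Qed.

Lemma vspan_dl nu q : vspan q -> vspan (d nu * q).
Proof.
case=> l ->; rewrite mulr_sumr; apply: vspan_sum => -[w mu] /=.
elim: w nu => [|k w IH] nu; first by rewrite /vword big_nil mul1r -(sp_dM dv); exact: vspan_d.
rewrite vword_cons -mulrA mulrA (sp_cross dv) mulr_suml; apply: vspan_sum => i.
by rewrite -mulrA; apply: vspan_e; exact: IH.
Qed.
End Pair.

Lemma sp_comp_vword (Q Q' : pzRingType) (f : {rmorphism Q -> Q'}) (v : V -> Q) w :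
  f (vword v w) = vword (fun x => f (v x)) w.
Proof. exact: rmorph_prod. Qed.

Lemma vword_perm (Q : pzRingType) (v : V -> Q) : (forall x y, v x * v y = v y * v x) ->
  forall w w' : seq 'I_N, perm_eq w w' -> vword v w = vword v w'.
Proof.
move=> vC; have front i w1 w2 : vword v (w1 ++ i :: w2) = vword v (i :: w1 ++ w2).
  elim: w1 => [//|k w1 IH]; rewrite !cat_cons vword_cons IH !vword_cons !mulrA.
  by rewrite vC.
elim=> [|i w IH] w' e; first by rewrite perm_sym in e; move/perm_nilP: e => ->.
have iw : i \in w' by rewrite -(perm_mem e) mem_head.
case/path.splitPr: iw e => w1 w2 e.
rewrite front !vword_cons (IH (w1 ++ w2)) // -(perm_cons i); apply: (perm_trans e).
by rewrite -(cat1s i w2) perm_catCA.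
Qed.

Lemma smashT_span t : vspan (@smashT_dist R N) (@smashT_vec R N) t.
Proof.
have dv := smash_pair_smashT.
rewrite -(qreprK t); move: (qrepr t) => {t} f; elim/free_alg_ind: f => [c|mu f h|x f h|f f' h h'].
- by rewrite smashT_scalar; exact: vspan_d.
- have e : qpi _ (free_dist mu * f) = smashT_dist mu * qpi _ f := rmorphM (qpi _) _ _.
  exact: (eq_ind_r (vspan (@smashT_dist R N) (@smashT_vec R N)) (vspan_dl dv mu h) e).
- have e : qpi _ (free_vec x * f) = smashT_vec x * qpi _ f := rmorphM (qpi _) _ _.
  exact: (eq_ind_r (vspan (@smashT_dist R N) (@smashT_vec R N)) (vspan_v dv x h) e).
- have e := rmorphD (qpi (ideal_of (@smashT_rel R N))) f f'.
  exact: (eq_ind_r (vspan (@smashT_dist R N) (@smashT_vec R N)) (vspanD h h') e).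
Qed.
End SmashPairs.

(** * The associated graded algebra *)

Section GradedClasses.
Variables (A : pzRingType) (F : filtration A).
Local Notation pi := (qpi (rees_lower_ideal F)).

Lemma gr_class_eq n x y (Fx : F n x) (Fy : F n y) : x = y -> gr_class Fx = gr_class Fy.
Proof.
by move=> xy; case: _ / xy in Fy *; congr gr_class; exact: Prop_irrelevance.
Qed.

Lemma rees_val_sum I (r : seq I) (f : I -> rees F) n :
  rees_val (\sum_(i <- r) f i) n = \sum_(i <- r) rees_val (f i) n.
Proof. by elim: r => [|i r IH]; rewrite ?big_nil // !big_cons -IH. Qed.

Lemma gr_class_sum_eq0 I (r : seq I) (k : I -> nat) (x : I -> A)
    (Fx : forall i, F (k i) (x i)) :
  \sum_(i <- r) gr_class (Fx i) = 0 <->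
  forall n, fil_pred F n (\sum_(i <- r | k i == n) x i).
Proof.
have -> : \sum_(i <- r) gr_class (Fx i) = pi (\sum_(i <- r) Rees (monomial_rees (Fx i))).
  by rewrite raddf_sum.
have E n : rees_val (\sum_(i <- r) Rees (monomial_rees (Fx i)) - 0) n
    = \sum_(i <- r | k i == n) x i.
  rewrite subr0 rees_val_sum [RHS]big_mkcond; apply: eq_bigr => i _ /=.
  by rewrite eq_sym.
have -> : (0 : gr F) = pi 0 by rewrite rmorph0.
rewrite qpiP; split=> h n; first by rewrite -E; exact: h.
by rewrite E; exact: h.
Qed.

Lemma gr_class_eq0 n x (Fx : F n x) : fil_pred F n x -> gr_class Fx = 0.
Proof.
move=> h; have := (@gr_class_sum_eq0 unit [:: tt] (fun=> n) (fun=> x) (fun=> Fx)).2.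
rewrite big_seq1; apply=> m; rewrite big_mkcond big_seq1.
by case: eqP => [<- //|_]; exact: fil_pred0.
Qed.

Lemma gr_classD n x y (Fx : F n x) (Fy : F n y) :
  gr_class (filD Fx Fy) = gr_class Fx + gr_class Fy.
Proof.
rewrite /gr_class -rmorphD; congr pi; apply/val_inj/funext => m /=.
by rewrite -[RHS]/((if m == n then x else 0) + (if m == n then y else 0)); case: eqP; rewrite ?addr0.
Qed.

Lemma gr_classM m n x y (Fx : F m x) (Fy : F n y) :
  gr_class (filM Fx Fy) = gr_class Fx * gr_class Fy.
Proof.
rewrite /gr_class -rmorphM; congr pi; apply/val_inj/funext => k /=.
rewrite -[RHS]/(\sum_(i < k.+1) (if i == m :> nat then x else 0) * (if (k - i == n)%N then y else 0)).
have [->|kmn] := eqVneq k (m + n)%N.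
  have mk : (m < (m + n).+1)%N by rewrite ltnS leq_addr.
  rewrite (bigD1 (Ordinal mk)) //= eqxx addKn eqxx big1 ?addr0 // => i im.
  by rewrite ifN ?mul0r.
rewrite big1 // => i _; case: eqP => [im|_]; last by rewrite mul0r.
case: eqP => [kn|_]; last by rewrite mulr0.
by case/eqP: kmn; rewrite -im -kn subnKC // -ltnS.
Qed.

Lemma gr_class_sum n I (r : seq I) (x : I -> A) (Fx : forall i, F n (x i))
    (Fs : F n (\sum_(i <- r) x i)) : gr_class Fs = \sum_(i <- r) gr_class (Fx i).
Proof.
elim: r Fs => [|i r IH] Fs; [rewrite [RHS]big_nil | rewrite [RHS]big_cons].
  by apply: gr_class_eq0; rewrite big_nil; exact: fil_pred0.
have Fr : F n (\sum_(i <- r) x i) by apply: fil_sum.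
rewrite -(IH Fr) -gr_classD; apply: gr_class_eq.
by rewrite big_cons.
Qed.

Lemma gr_class1 : gr_class (fil1 F) = 1.
Proof.
rewrite -[RHS](rmorph1 pi); congr pi; apply/val_inj/funext => n /=.
by case: n.
Qed.
End GradedClasses.

Section Evaluation.
Variables (R : realType) (N : nat).
Local Notation C := R[i].
Local Notation V := 'cV[C]_N.
Local Notation D := (dist R N).
Variables (K : 'I_N -> 'I_N -> D) (Q : pzRingType) (d : D -> Q) (v : V -> Q).
Variable (act : {rmorphism Q -> endo (dual_mod K)}).
Hypotheses (K_equiv : equivariant_fam K) (act_d : forall mu, act (d mu) = dual_dist K_equiv mu)
  (act_v : forall x, act (v x) = dual_vec K x).

(** At the empty word, the action returns the functional L evaluated at the acting element. *)
Lemma act_vword w mu L : act (vword v w * d mu) L [::] = L w * mu.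
Proof.
rewrite rmorphM act_d -[LHS]/(act (vword v w) L [::] * mu); congr (_ * _).
elim: w L => [|k w IH] L; first by rewrite /vword big_nil rmorph1.
rewrite vword_cons rmorphM act_v -[LHS]/(act (vword v w) (dual_vec K (delta_mx k 0) L) [::]).
by rewrite IH dual_vec_delta.
Qed.

Definition vanish_below m (L : dual_mod K) := forall w, (size w < m)%N -> L w = 0.

Inductive sp_deg : nat -> Q -> Prop :=
| sp_deg_dist (mu : D) : sp_deg 0 (d mu)
| sp_deg_vec (x : V) : sp_deg 1 (v x).

(** An element of filtration n makes [L] be read on words at most n letters longer. *)
Lemma act_vanish n q : gen_fil sp_deg n q ->
  forall m L, vanish_below m L -> vanish_below (m - n) (act q L).
Proof.
elim=> {n q} [n q [mu|x]|n|n q q' _ IH _ IH'|n q _ IH|n q _ IH||n n' q q' _ IH _ IH'] m L Lm w sw.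
- rewrite act_d dual_distE -[RHS](tw0r w mu); apply: tw_ext => u su.
  by apply: Lm; rewrite su; lia.
- by rewrite act_v dual_vecE big1 // => k _; rewrite Lm ?scaler0 //=; lia.
- by rewrite rmorph0.
- by rewrite rmorphD -[LHS]/(act q L w + act q' L w) (IH m) // (IH' m) // addr0.
- by rewrite rmorphN -[LHS]/(- act q L w) (IH m) // oppr0.
- by apply: (IH m) => //; lia.
- by rewrite rmorph1; apply: Lm; lia.
- rewrite rmorphM -[LHS]/(act q' (act q L) w); apply: (IH' (m - n)%N); last by lia.
  exact: IH.
Qed.
End Evaluation.

Section Hecke.
Variables (R : realType) (N : nat).
Local Notation C := R[i].
Local Notation V := 'cV[C]_N.
Local Notation D := (dist R N).
Variable kappa : {bilinear V -> V -> D}.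
Local Notation K := (basis_fam kappa).
Hypothesis K_equiv : equivariant_fam K.

Lemma smash_pair_hecke : smash_pair (hecke_dist kappa) (hecke_vec kappa).
Proof. exact: (smash_pair_comp (qpi (ideal_of (hecke_rel kappa))) (smash_pair_smashT R N)). Qed.

Lemma act_hecke_rel r : hecke_rel kappa r -> act_smashT K_equiv r = 0.
Proof.
case=> x y; apply: (etrans (rmorphB (act_smashT K_equiv) _ _)).
apply/eqP; rewrite subr_eq0; apply/eqP; apply: (etrans (act_smashT_comm K_equiv x y)).
by apply: esym; rewrite basis_expand; exact: act_smashT_dist.
Qed.

Definition act_hecke : {rmorphism hecke kappa -> endo (dual_mod K)} :=
  lift_rmorphism act_hecke_rel.

Lemma act_hecke_dist mu : act_hecke (hecke_dist kappa mu) = dual_dist K_equiv mu.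
Proof. by rewrite -act_smashT_dist; exact: (lift_quotE act_hecke_rel). Qed.

Lemma act_hecke_vec x : act_hecke (hecke_vec kappa x) = dual_vec K x.
Proof. by rewrite -(act_smashT_vec K_equiv); exact: (lift_quotE act_hecke_rel). Qed.

Lemma act_hecke_vanish n q : hecke_fil kappa n q ->
  forall m L, vanish_below m L -> vanish_below (m - n) (act_hecke q L).
Proof.
move=> h; apply: (act_vanish act_hecke_dist act_hecke_vec).
elim: h => {n q} [n q [mu|x]|n|n q q' _ IH _ IH'|n q _ IH|n q _ IH||n n' q q' _ IH _ IH'].
- exact/gen_fil_in/sp_deg_dist.
- exact/gen_fil_in/sp_deg_vec.
- exact: gen_fil0.
- exact: gen_filD.
- exact: gen_filN.
- exact: gen_filS.
- exact: gen_fil1.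
- exact: gen_filM.
Qed.

Lemma hecke_commE x y : hecke_vec kappa x * hecke_vec kappa y - hecke_vec kappa y * hecke_vec kappa x
  = hecke_dist kappa (kappa x y).
Proof.
pose I := ideal_of (hecke_rel kappa).
have e := (qpiP I _ _).2 (gen_ideal_in (hecke_comm kappa x y)).
apply: (etrans _ e); apply: esym; apply: (etrans (rmorphB (qpi I) _ _)).
exact: (congr2 (fun a b : hecke kappa => a - b) (rmorphM (qpi I) _ _) (rmorphM (qpi I) _ _)).
Qed.
End Hecke.

Section Symmetric.
Variables (R : realType) (N : nat).
Local Notation C := R[i].
Local Notation V := 'cV[C]_N.
Local Notation D := (dist R N).

Lemma smash_pair_smashS : smash_pair (@smashS_dist R N) (@smashS_vec R N).
Proof. exact: (smash_pair_comp (qpi (ideal_of (@smashS_rel R N))) (smash_pair_smashT R N)). Qed.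

Lemma smashS_vecC (x y : V) : smashS_vec x * smashS_vec y = smashS_vec y * smashS_vec x.
Proof.
pose I := ideal_of (@smashS_rel R N).
have e : qpi I (smashT_vec x * smashT_vec y) = qpi I (smashT_vec y * smashT_vec x).
  by apply/qpiP; exact/gen_ideal_in/smashS_comm.
apply: (etrans (esym (rmorphM (qpi I) _ _))); apply: (etrans e).
exact: (rmorphM (qpi I)).
Qed.

(** For K = 0 the families on words form a module over [smashS], from which the coefficients of
    sorted words can be read. *)
Definition zero_fam : 'I_N -> 'I_N -> D := fun _ _ => 0.

Lemma zero_fam_equiv : equivariant_fam zero_fam.
Proof.
move=> g k l f; rewrite [RHS]big1 ?[LHS]/= // => k' _; rewrite big1 // => l' _; exact: mulr0.
Qed.

Lemma act_smashS_rel r : smashS_rel r -> act_smashT zero_fam_equiv r = 0.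
Proof.
case=> x y; apply: (etrans (act_smashT_comm zero_fam_equiv x y)).
apply: endoP => L; apply: dualP => w; rewrite dual_distE.
rewrite big1 ?tw0l // => i _; rewrite big1 // => j _.
exact: scaler0.
Qed.

Definition act_smashS : {rmorphism smashS R N -> endo (dual_mod zero_fam)} :=
  lift_rmorphism act_smashS_rel.

Lemma act_smashS_dist mu : act_smashS (smashS_dist mu) = dual_dist zero_fam_equiv mu.
Proof. by rewrite -act_smashT_dist; exact: (lift_quotE act_smashS_rel). Qed.

Lemma act_smashS_vec x : act_smashS (smashS_vec x) = dual_vec zero_fam x.
Proof. by rewrite -(act_smashT_vec zero_fam_equiv); exact: (lift_quotE act_smashS_rel). Qed.

Lemma smashS_span (q : smashS R N) : exists l : seq (seq 'I_N * D),
  all (fun p => sorted (@word_le N) p.1) l /\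
  q = \sum_(p <- l) vword (@smashS_vec R N) p.1 * smashS_dist p.2.
Proof.
have [l e] := smashT_span (qrepr q).
exists [seq (sort (@word_le N) p.1, p.2) | p <- l]; split.
  by rewrite all_map; apply/allP => p _ /=; apply: sort_sorted => i j; exact: leq_total.
rewrite big_map -[q]qreprK e; apply: (etrans (rmorph_sum (qpi _) _ _ _)).
apply: eq_bigr => p _; apply: (etrans (rmorphM (qpi _) _ _)); congr (_ * _).
apply: (etrans (rmorph_prod (qpi (ideal_of (@smashS_rel R N))) _ _ _)).
apply: (vword_perm smashS_vecC); rewrite perm_sym.
by rewrite perm_sort.
Qed.
End Symmetric.

Section GradedGeneration.
Variables (A B : pzRingType) (X : nat -> A -> Prop).
Local Notation F := (filtration_of X).
Variable phi : {rmorphism B -> gr F}.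
Hypothesis phi_gen : forall n x (Xx : X n x),
  exists b, phi b = gr_class (F := F) (gen_fil_in Xx).

Lemma gr_class_image n x (Fx : F n x) : exists b, phi b = gr_class Fx.
Proof.
(* A class depends on a proof of membership, and the induction runs over such a proof; hence the
   quantification over all of them. *)
suff : exists b, forall h : F n x, phi b = gr_class h by case=> b e; exists b.
elim: Fx => {n x} [n x Xx|n|n x y Fx [a ea] Fy [b eb]|n x Fx [a ea]|n x Fx [a ea]||
    m n x y Fx [a ea] Fy [b eb]].
- have [b e] := phi_gen Xx; exists b => h; rewrite e; exact: gr_class_eq.
- by exists 0 => h; rewrite rmorph0 gr_class_eq0 //; exact: fil_pred0.
- by exists (a + b) => h; rewrite rmorphD (ea Fx) (eb Fy) -gr_classD; exact: gr_class_eq.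
- exists (- a) => h; rewrite rmorphN (ea Fx); apply/eqP; rewrite eq_sym -addr_eq0 -gr_classD.
  by apply/eqP/gr_class_eq0; rewrite addNr; exact: fil_pred0.
- by exists 0 => h; rewrite rmorph0 gr_class_eq0.
- by exists 1 => h; rewrite rmorph1 -gr_class1; exact: gr_class_eq.
- by exists (a * b) => h; rewrite rmorphM (ea Fx) (eb Fy) -gr_classM; exact: gr_class_eq.
Qed.

Lemma gr_surjective q : exists b, phi b = q.
Proof.
rewrite -[q]qreprK; move: (qrepr q) => {q} s.
have [m sm] : exists m, forall n, (m <= n)%N -> rees_val s n = 0.
  by have /asboolP[] := rees_valP s.
have -> : s = \sum_(n < m) Rees (monomial_rees (rees_fil s n)).
  apply/val_inj/funext => n /=; rewrite rees_val_sum /=.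
  have [mn|nm] := leqP m n.
    by rewrite sm // big1 // => i _; rewrite ifN // neq_ltn (leq_trans _ mn) ?orbT.
  rewrite (bigD1 (Ordinal nm)) //= eqxx big1 ?addr0 // => i ni.
  by rewrite ifN // eq_sym.
rewrite raddf_sum /=.
elim/big_ind: _ => [|x y [a ea] [b eb]|i _]; first by exists 0; rewrite rmorph0.
  by exists (a + b); rewrite rmorphD ea eb.
exact: gr_class_image.
Qed.
End GradedGeneration.

Section GradedPair.
Variables (R : realType) (N : nat).
Local Notation C := R[i].
Local Notation V := 'cV[C]_N.
Local Notation D := (dist R N).
Variables (A : pzRingType) (F : filtration A) (d : D -> A) (v : V -> A).
Hypotheses (dv : smash_pair d v) (Fd : forall mu, F 0 (d mu)) (Fv : forall x, F 1 (v x)).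
Local Notation grd := (fun mu => gr_class (Fd mu)).
Local Notation grv := (fun x => gr_class (Fv x)).

Lemma smash_pair_gr : smash_pair grd grv.
Proof.
case: (dv) => dD d1 dM vD vZ cr; split=> /=.
- by move=> mu nu; rewrite -gr_classD; apply: gr_class_eq.
- by rewrite -gr_class1; apply: gr_class_eq.
- by move=> mu nu; rewrite -gr_classM; apply: gr_class_eq.
- by move=> x y; rewrite -gr_classD; apply: gr_class_eq.
- by move=> a x; rewrite -gr_classM; apply: gr_class_eq.
- move=> mu x; under eq_bigr do rewrite -gr_classM.
  have Fs : F 1 (\sum_i v (delta_mx i 0) * d (act_fun (coord_fun x i) mu)).
    by apply: fil_sum => i _; exact: (filM (Fv _) (Fd _)).
  rewrite -gr_classM -(gr_class_sum _ Fs).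
  by apply: gr_class_eq.
Qed.

Lemma fil_vword w mu : F (size w) (vword v w * d mu).
Proof.
elim: w => [|k w IH]; first by rewrite /vword big_nil mul1r.
by rewrite vword_cons -mulrA; exact: (filM (Fv _) IH).
Qed.

Lemma gr_vword w mu : vword grv w * grd mu = gr_class (fil_vword w mu).
Proof.
elim: w => [|k w IH].
  by rewrite /vword big_nil mul1r; apply: gr_class_eq; rewrite /vword big_nil mul1r.
rewrite vword_cons -mulrA IH -gr_classM; apply: gr_class_eq.
by rewrite vword_cons mulrA.
Qed.

Lemma gr_commute x y : F 1 (v x * v y - v y * v x) -> grv x * grv y - grv y * grv x = 0.
Proof.
move=> h; rewrite -!gr_classM; apply/eqP; rewrite subr_eq0; apply/eqP.
have -> : gr_class (filM (Fv x) (Fv y)) = gr_class (filD (filM (Fv y) (Fv x)) (filS h)).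
  by apply: gr_class_eq; rewrite addrC subrK.
by rewrite gr_classD [X in _ + X]gr_class_eq0 ?addr0.
Qed.

Lemma gr_vsum_eq0 (l : seq (seq 'I_N * D)) :
  \sum_(p <- l) vword grv p.1 * grd p.2 = 0 <->
  forall n, fil_pred F n (\sum_(p <- l | size p.1 == n) vword v p.1 * d p.2).
Proof.
under eq_bigr do rewrite gr_vword.
exact: (gr_class_sum_eq0 l (fun p => fil_vword p.1 p.2)).
Qed.
End GradedPair.

(** * The PBW property *)

Section Cyclic.
Variables (R : realType) (N : nat).
Local Notation C := R[i].
Local Notation V := 'cV[C]_N.
Local Notation D := (dist R N).
Local Notation "f \> mu" := (act_fun f mu) (at level 38, right associativity).
Variables (Q : pzRingType) (d : D -> Q) (v : V -> Q).
Hypothesis dv : smash_pair d v.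
Local Notation e i := (delta_mx i (0 : 'I_1) : V).

Definition jacobi_sum (K : 'I_N -> 'I_N -> D) u x y z : D :=
  amx R N u z \> K x y + amx R N u x \> K y z + amx R N u y \> K z x.

(** The source of A = 1 - g: moving e_z past a distribution replaces it by g e_z. *)
Lemma sp_bracket mu z :
  v (e z) * d mu - d mu * v (e z) = \sum_u v (e u) * d (amx R N u z \> mu).
Proof.
rewrite (sp_cross dv) {1}(sp_expand dv) mulr_suml -sumrB; apply: eq_bigr => u _.
rewrite -mulrA -mulrBr; congr (_ * _); rewrite -(sp_dM dv) distZl mul1r.
have -> : amx R N u z = (u == z)%:R - entry R u z.
  by rewrite /amx mxE [X in X + _]mxE mxE [X in - X]mxE.
rewrite act_funDl act_funNl (sp_dD dv) mxE eqxx andbT.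
have -> : coord_fun (e z) u = entry R u z.
  rewrite coord_fun_expand (bigD1 z) //= mxE !eqxx scale1r big1 ?addr0 // => j jz.
  by rewrite mxE (negbTE jz) scale0r.
congr (_ + _); last by apply/eqP; rewrite eq_sym -addr_eq0 -(sp_dD dv) addNr (sp_d0 dv).
by case: (u == z); rewrite ?scale1r ?act_fun1 // scale0r act_0fun.
Qed.

Lemma jacobi_sum_eq0 (K : 'I_N -> 'I_N -> D) :
  (forall i j, v (e i) * v (e j) - v (e j) * v (e i) = d (K i j)) ->
  forall x y z, \sum_u v (e u) * d (jacobi_sum K u x y z) = 0.
Proof.
move=> vK x y z; have E u : v (e u) * d (jacobi_sum K u x y z) =
    v (e u) * d (amx R N u z \> K x y) + v (e u) * d (amx R N u x \> K y z)
    + v (e u) * d (amx R N u y \> K z x) by rewrite /jacobi_sum !(sp_dD dv) !mulrDr.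
under eq_bigr do rewrite E; rewrite !big_split /= -!sp_bracket -!vK.
move: (v (e x)) (v (e y)) (v (e z)) => a b c.
rewrite !mulrBr !mulrBl !mulrA !opprB.
rewrite (addrACA (c * a * b)) (addrACA (a * b * c)) (addrACA (b * c * a)) -!opprD.
rewrite (addrC (a * b * c)) (addrC (a * c * b)) (addrC (b * a * c)) !subrKA.
exact: subrr.
Qed.

Lemma vsum_eq0 (l : seq (seq 'I_N * D)) : (forall s, \sum_(p <- l | p.1 == s) p.2 = 0) ->
  \sum_(p <- l) vword v p.1 * d p.2 = 0.
Proof.
move=> l0; pose r := undup (map fst l).
transitivity (\sum_(p <- l) \sum_(s <- r | p.1 == s) vword v s * d p.2).
  rewrite big_seq [RHS]big_seq; apply: eq_bigr => p pl.
  have pr : p.1 \in r by rewrite mem_undup map_f.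
  rewrite big_mkcond (bigD1_seq p.1) ?undup_uniq //= eqxx big1 ?addr0 // => s sp.
  by rewrite eq_sym (negbTE sp).
rewrite (exchange_big_dep predT) //= big1 // => s _.
by rewrite -mulr_sumr -(sp_dsum dv) l0 (sp_d0 dv) mulr0.
Qed.
End Cyclic.

Section Coefficients.
Variables (R : realType) (N : nat).
Local Notation C := R[i].
Local Notation V := 'cV[C]_N.
Local Notation D := (dist R N).
Variables (K : 'I_N -> 'I_N -> D) (Q : pzRingType) (d : D -> Q) (v : V -> Q).
Variable (act : {rmorphism Q -> endo (dual_mod K)}).
Hypotheses (K_skew : skew_fam K) (K_jac : jacobi K) (K_equiv : equivariant_fam K).
Hypotheses (act_d : forall mu, act (d mu) = dual_dist K_equiv mu)
  (act_v : forall x, act (v x) = dual_vec K x).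

Definition coef_mod s : dual_mod K := DualMod (coef_rel K_skew K_jac K_equiv s).

(** The normal form of a sorted word is the word itself, so [coef_mod s] extracts the coefficient of
    s. *)
Lemma act_vsum (l : seq (seq 'I_N * D)) (P : pred (seq 'I_N * D)) s :
  all (fun p => sorted (@word_le N) p.1) l ->
  act (\sum_(p <- l | P p) vword v p.1 * d p.2) (coef_mod s) [::] =
  \sum_(p <- l | P p && (p.1 == s)) p.2.
Proof.
move=> /allP ls; rewrite rmorph_sum -[LHS]/((\sum_(p <- l | P p) act (vword v p.1 * d p.2)) (coef_mod s) [::]).
rewrite -big_filter dual_eval_sum big_filter big_mkcondr big_seq_cond [RHS]big_seq_cond.
apply: eq_bigr => p /andP[pl _]; rewrite (act_vword act_d act_v) /= coef_sorted ?ls //.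
by case: eqP; rewrite ?mul1r ?mul0r.
Qed.
End Coefficients.

Section PBW.
Variables (R : realType) (N : nat).
Local Notation C := R[i].
Local Notation V := 'cV[C]_N.
Local Notation D := (dist R N).
Variable kappa : {bilinear V -> V -> D}.
Local Notation K := (basis_fam kappa).
Local Notation F := (hecke_fil kappa).
Local Notation hd := (hecke_dist kappa).
Local Notation hv := (hecke_vec kappa).
Hypotheses (ks : skew_symmetric kappa) (ke : equivariant kappa).

Let K_skew : skew_fam K := basis_fam_skew ks.
Let K_equiv : equivariant_fam K := basis_fam_equiv ke.
Let dv := smash_pair_hecke kappa.

Let Fd mu : F 0 (hd mu) := gen_fil_in (hecke_deg_dist kappa mu).
Let Fv x : F 1 (hv x) := gen_fil_in (hecke_deg_vec kappa x).

Lemma smashS_vsum_eq0 (phi : {rmorphism smashS R N -> gr F}) (l : seq (seq 'I_N * D)) :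
  (forall mu, phi (smashS_dist mu) = gr_dist kappa mu) ->
  (forall x, phi (smashS_vec x) = gr_vec kappa x) ->
  phi (\sum_(p <- l) vword (@smashS_vec R N) p.1 * smashS_dist p.2) = 0 <->
  forall n, fil_pred F n (\sum_(p <- l | size p.1 == n) vword hv p.1 * hd p.2).
Proof.
move=> pd pv; rewrite rmorph_sum -(gr_vsum_eq0 Fd Fv).
suff -> : \sum_(p <- l) phi (vword (@smashS_vec R N) p.1 * smashS_dist p.2) =
  \sum_(p <- l) vword (fun x => gr_class (Fv x)) p.1 * gr_class (Fd p.2) by [].
apply: eq_bigr => p _; rewrite rmorphM pd; congr (_ * _).
by rewrite sp_comp_vword; apply: eq_bigr => i _; rewrite pv.
Qed.

(** The cyclic sum is a relation of degree 1 in H_kappa. By injectivity the same combination of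
    vectors vanishes in [smashS], and its coefficient at the one-letter word u is the Jacobi sum. *)
Lemma jacobi_of_PBW : PBW_property kappa -> jacobi K.
Proof.
case=> phi [pd pv pb] u x y z.
pose J := jacobi_sum K ^~ x ^~ y ^~ z.
pose l := [seq ([:: u'], J u') | u' <- index_enum 'I_N].
have vE (Q : pzRingType) (v : V -> Q) i : vword v [:: i] = v (delta_mx i 0).
  by rewrite /vword big_seq1.
have h0 : \sum_(p <- l) vword hv p.1 * hd p.2 = 0.
  rewrite big_map -[RHS](jacobi_sum_eq0 dv (fun i j => hecke_commE kappa _ _) x y z).
  by apply: eq_bigr => u' _; rewrite vE.
have s0 : \sum_(p <- l) vword (@smashS_vec R N) p.1 * smashS_dist p.2 = 0.
  apply: (bij_inj pb); rewrite [RHS]rmorph0; apply/(smashS_vsum_eq0 _ pd pv) => n.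
  rewrite big_map /=; have [<-|n1] := eqVneq 1%N n; last by rewrite big_pred0_eq; exact: fil_pred0.
  rewrite (_ : \sum_(i <- _ | _) _ = 0); first exact: fil_pred0.
  by rewrite -[RHS]h0 big_map.
have a0 : act_smashS R N (\sum_(p <- l) vword (@smashS_vec R N) p.1 * smashS_dist p.2) = 0.
  by rewrite s0; exact: rmorph0.
have j0 : jacobi (@zero_fam R N) by move=> *; rewrite /zero_fam !act_fun0 !addr0.
have k0 : skew_fam (@zero_fam R N) by move=> *; rewrite /zero_fam oppr0.
have ls : all (fun p => sorted (@word_le N) p.1) l by apply/allP => p /mapP[u' _ ->].
have := act_vsum k0 j0 (@act_smashS_dist R N) (@act_smashS_vec R N) predT [:: u] ls.
rewrite a0 big_map /= => e.
have : \sum_(u' <- index_enum 'I_N | [:: u'] == [:: u]) J u' = 0 by rewrite -e.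
by rewrite (big_pred1 u) // => u'; rewrite eqseq_cons andbT.
Qed.

Lemma PBW_of_jacobi : jacobi K -> PBW_property kappa.
Proof.
move=> K_jac.
pose f0 : {rmorphism smashT R N -> gr F} := sp_lift (smash_pair_gr dv Fd Fv).
have f0_rel r : smashS_rel r -> f0 r = 0.
  case=> x y.
  have vE t : f0 (smashT_vec t) = gr_class (Fv t) := sp_lift_vec (smash_pair_gr dv Fd Fv) t.
  have F1 : F 1 (hv x * hv y - hv y * hv x) by rewrite hecke_commE; exact: filS (Fd _).
  rewrite -[RHS](gr_commute Fv F1) -!vE; apply: (etrans (rmorphB f0 _ _)).
  exact: (congr2 (fun a b : gr F => a - b) (rmorphM f0 _ _) (rmorphM f0 _ _)).
pose phi : {rmorphism smashS R N -> gr F} := lift_rmorphism f0_rel.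
have pd mu : phi (smashS_dist mu) = gr_dist kappa mu.
  apply: (etrans (lift_quotE f0_rel _)); exact: (sp_lift_dist (smash_pair_gr dv Fd Fv)).
have pv x : phi (smashS_vec x) = gr_vec kappa x.
  apply: (etrans (lift_quotE f0_rel _)); exact: (sp_lift_vec (smash_pair_gr dv Fd Fv)).
exists phi; split=> //.
have psurj q : exists b, phi b = q.
  apply: gr_surjective q => n x [mu|y]; first by exists (smashS_dist mu).
  by exists (smashS_vec y).
have pz q : phi q = 0 -> q = 0.
  have [l [ls ->]] := smashS_span q => /(smashS_vsum_eq0 l pd pv) h.
  apply: (vsum_eq0 (smash_pair_smashS R N)) => s.
  pose L := coef_mod K_skew K_jac K_equiv s.
  have Lv : vanish_below (size s) L by move=> w; exact: coef_short.
  (* By [h (size s)] the part of degree [size s] lies one step lower in the filtration. At the empty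
     word such an element reads [L] only on words shorter than s, where it is zero; in degree 0 the
     element is itself zero. *)
  have z n t : n = size s -> fil_pred F n t -> act_hecke K_equiv t L [::] = 0.
    case: n => [|n] ns /=; first by move=> ->; exact: (congr1 (fun g : endo _ => g L [::]) (rmorph0 (act_hecke K_equiv))).
    by move=> Ft; apply: (act_hecke_vanish K_equiv Ft Lv); rewrite -ns subSnn.
  rewrite -[RHS](z _ _ erefl (h (size s))).
  rewrite (act_vsum K_skew K_jac (act_hecke_dist K_equiv) (act_hecke_vec K_equiv)) //.
  by apply: eq_bigl => p; case: eqP => [->|]; rewrite ?eqxx // andbF.
have pinj : injective phi.
  move=> b b' e; apply/eqP; rewrite -subr_eq0; apply/eqP/pz.
  by rewrite rmorphB e; exact: subrr.
have [g gK] := choice psurj.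
by exists g => // b; apply: pinj; rewrite gK.
Qed.
End PBW.

Theorem theorem1p3 (R : realType) (N : nat)
    (kappa : {bilinear 'cV[R[i]]_N -> 'cV[R[i]]_N -> dist R N}) :
  (3 <= N)%N -> skew_symmetric kappa -> equivariant kappa ->
  PBW_property kappa <->
  exists c : dist R N,
    [/\ conj_invariant c, supported_on_S c
      & forall x y : 'cV[R[i]]_N, kappa x y = act_fun (pairing_fun x y) c].
Proof.
move=> N3 ks ke; split=> [/jacobi_of_PBW|[c [_ cS kE]]].
  exact: exists_invariant_of_jacobi.
exact/(PBW_of_jacobi ks ke)/(jacobi_of_invariant cS kE).
Qed.
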